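(* Let $d\geq 1$ and let $\mathbb P$ be an i.i.d. product probability measure on $\Omega$ with forbidden direction $-\hat u$, $\hat u\in\mathbb R^d\setminus\{0\}$, i.e. $\mathbb P\big(\sum_{z:\,z\cdot\hat u\geq0}\pi_{0z}=1\big)=1$. Assume (N): there is a deterministic $\delta>0$ with $\mathbb P\big(\sum_z z\cdot\hat u\,\pi_{0z}\geq\delta\big)=1$; and (M) with some $p>1$: there is a deterministic $M>0$ with $\mathbb P\big(\sum_z|z|^p\pi_{0z}\leq M^p\big)=1$. Let $v=\mathbb E_\infty(D)$. Then $$P_0\Big(\lim_{n\to\infty}n^{-1}X_n=v\Big)=1.$$ Moreover $E_0(\sigma_1)<\infty$, $v=E_0(X_{\sigma_1})/E_0(\sigma_1)$, and $\sup_n|E_0(X_n)-nv|<\infty$.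
   Context: $\Omega=\mathcal P^{\mathbb Z^d}$ where $\mathcal P$ is the set of probability vectors on $\mathbb Z^d$; an environment $\omega=(\omega_x)_x$ has $\omega_x=(\pi_{x,x+y}(\omega))_y$; shifts $\pi_{xy}(T_z\omega)=\pi_{x+z,y+z}(\omega)$. $\mathbb P$ i.i.d. product means the $\omega_x$ are i.i.d. $P^\omega_z$ is the quenched law of the Markov chain $(X_n)$ with $X_0=z$ and transitions $\pi_{xy}(\omega)$; $P_z=\int P^\omega_z\,\mathbb P(d\omega)$ is the annealed law, $E_z$ its expectation. $|\cdot|$ is the $\ell^1$ norm. $D(\omega)=\sum_z z\,\pi_{0z}(\omega)$ is the drift. $\sigma_1=\inf\{n: X_n\cdot\hat u\geq X_0\cdot\hat u+1\}$. $\mathfrak S_k=\sigma(\omega_x:x\cdot\hat u\geq k)$. $\mathbb P_\infty$ is the probability measure on $\Omega$ which is invariant for the kernel $\hat\pi(\omega,A)=P^\omega_0(T_{X_1}\omega\in A)$, absolutely continuous with respect to $\mathbb P$ on each $\mathfrak S_k$, $k\leq0$, and ergodic for this Markov process (under these hypotheses such a measure exists and is unique, and $\mathbb P_\infty(A)=\lim_n P_0(T_{X_n}\omega\in A)$ for $A\in\mathfrak S_k$, $k\leq 0$); $\mathbb E_\infty$ denotes expectation under $\mathbb P_\infty$. *)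

(* Defs.v *)
From HB Require Import structures.
From mathcomp Require Import all_boot all_order all_algebra.
From mathcomp Require Import all_classical all_reals all_analysis.
Unset Printing Implicit Defensive.
Import Order.TTheory GRing.Theory Num.Theory.
Import numFieldNormedType.Exports.
Local Open Scope classical_set_scope.
Local Open Scope ring_scope.

Definition site (d : nat) := 'rV[int]_d.

(** An environment: [w x y] is the y-th entry of the vector omega_x, i.e.
    w x y = pi_{x, x+y}(w). *)
Definition env (R : realType) (d : nat) := site d -> site d -> R.

Definition pitr {R : realType} {d : nat} (x y : site d) (w : env R d) : R :=
  w x (y - x).

Definition shift {R : realType} {d : nat} (z : site d) (w : env R d) : env R d :=
  fun x => w (x + z).

Definition dotu {R : realType} {d : nat} (z : site d) (u : 'rV[R]_d) : R :=
  \sum_(i < d) (z ord0 i)%:~R * u ord0 i.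

Definition l1 {R : realType} {d : nat} (z : site d) : R :=
  \sum_(i < d) `|((z ord0 i)%:~R : R)|.

Definition ssum {R : realType} {d : nat} (f : site d -> R) : \bar R :=
  (\esum_(z in [set: site d]) (Num.max (f z) 0)%:E
   - \esum_(z in [set: site d]) (Num.max (- f z) 0)%:E)%E.

Definition is_probvec {R : realType} {d : nat} (p : site d -> R) : Prop :=
  (forall z, 0 <= p z) /\ (\esum_(z in [set: site d]) (p z)%:E = 1)%E.

Definition env_gen (R : realType) (d : nat) : set (set (env R d)) :=
  [set A | exists (x y : site d) (B : set R), measurable B /\ A = [set w | B (w x y)]].
Definition Env (R : realType) (d : nat) := g_sigma_algebraType (env_gen R d).

Definition vec_gen (R : realType) (d : nat) : set (set (site d -> R)) :=
  [set A | exists (y : site d) (B : set R), measurable B /\ A = [set p | B (p y)]].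

Definition S_k {R : realType} {d : nat} (u : 'rV[R]_d) (k : int) : set (set (env R d)) :=
  <<s [set A | exists (x y : site d) (B : set R),
        [/\ measurable B, k%:~R <= dotu x u & A = [set w | B (w x y)]]] >>.

Definition iid_product {R : realType} {d : nat} (P : probability (Env R d) R) : Prop :=
  forall (F : seq (site d)) (A : site d -> set (site d -> R)),
    uniq F -> (forall x, <<s vec_gen R d >> (A x)) ->
    P [set w : env R d | forall x, x \in F -> A x (w x)]
    = (\prod_(x <- F) P [set w : env R d | A x (w 0%R)])%E.

(** The kernel pihat(w, A) = P^w_0 (T_{X_1} w \in A). *)
Definition pihat {R : realType} {d : nat} (w : env R d) (A : set (env R d)) : \bar R :=
  (\esum_(z in [set: site d]) (pitr 0 z w)%:E * (\1_A (shift z w))%:E)%E.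

(** Q is "P_infty": invariant for pihat, absolutely continuous w.r.t. P on
    each S_k (k <= 0), and ergodic for the Markov process with kernel pihat. *)
Definition Pinfty_spec {R : realType} {d : nat} (u : 'rV[R]_d)
    (P Q : probability (Env R d) R) : Prop :=
  [/\ (forall A : set (Env R d), measurable A -> Q A = (\int[Q]_w pihat w A)%E),
      (forall k : int, k <= 0 -> forall A : set (Env R d),
          S_k u k A -> P A = 0%E -> Q A = 0%E) &
      (forall A : set (Env R d), measurable A ->
          {ae Q, forall w, pihat w A = (\1_A w : R)%:E} ->
          Q A = 0%E \/ Q A = 1%E)].

Definition drift {R : realType} {d : nat} (w : env R d) (i : 'I_d) : \bar R :=
  ssum (fun z => (z ord0 i)%:~R * pitr 0 z w).

(** (W, X) defined on (S, Pr) has the annealed law P_0: W has law P and,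
    given W = w, X is the Markov chain started at 0 with transitions pi(w). *)
Definition annealed_walk {R : realType} {d : nat} (P : probability (Env R d) R)
    {dS : measure_display} {S : measurableType dS} (Pr : probability S R)
    (W : S -> Env R d) (X : nat -> S -> site d) : Prop :=
  [/\ measurable_fun setT W,
      (forall n x, measurable (X n @^-1` [set x])) &
      (forall (A : set (Env R d)) (n : nat) (xs : nat -> site d), measurable A ->
        Pr (W @^-1` A `&` [set s | forall i, (i <= n)%N -> X i s = xs i])
        = (\int[P]_(w in A)
            ((xs 0%N == 0)%:R * \prod_(i < n) pitr (xs i) (xs i.+1) w)%:E)%E)].

Definition hit {R : realType} {d : nat} (u : 'rV[R]_d) {T : Type}
    (X : nat -> T -> site d) (n : nat) (s : T) : Prop :=
  dotu (X 0%N s) u + 1 <= dotu (X n s) u.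

(** sigma_1 as a natural number (meaningful when it is finite). *)
Definition sigma1_idx {R : realType} {d : nat} (u : 'rV[R]_d) {T : Type}
    (X : nat -> T -> site d) (s : T) : nat :=
  xget 0%N [set n | hit u X n s /\ forall m, (m < n)%N -> ~ hit u X m s].

Definition sigma1 {R : realType} {d : nat} (u : 'rV[R]_d) {T : Type}
    (X : nat -> T -> site d) (s : T) : \bar R :=
  if `[< exists n, hit u X n s >] then ((sigma1_idx u X s)%:R)%:E else +oo%E.

(* Main.v *)
(* Cut the walk at the time sigma_1 at which it has gained level 1.  As it
   never steps backwards, it has then only used sites strictly below its
   current position, so by independence its continuation is a fresh copy of the
   annealed walk: this gives a renewal structure.  The drift assumption,
   truncated by means of the moment bound, yields
   E[sigma_1 - n; sigma_1 > n] <= C P(sigma_1 > n), whence all the moments of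
   sigma_1 that are needed.

   For 0 <= f <= |.|_1 let A_n be the sum of f over the first n steps and
   v_f = E[A_{sigma_1}] / E[sigma_1].  The renewal equation for E[A_n] - n v_f
   shows that this sequence is bounded.  If f <= K, the renewal equation for the
   second moment gives E[(A_n - n v_f)^2] <= D K^2 (n + 1); truncating f at K and
   bounding the remainder by M^p K^(1-p) makes E|A_n / n - v_f| summable along
   n = k^m for some m, and since A_n is monotone, A_n / n converges almost surely
   to v_f.

   The same summability shows that the quenched means of A_n / n tend to v_f
   along n = k^m, for almost every environment; this event only depends on the
   half-space of sites with nonnegative level, so it also has full measure for
   the stationary measure, under which the mean of the quenched mean of A_n / n
   is, for every n, the mean of the local drift of f.  Hence that mean is v_f.
   The theorem follows by taking for f the positive and negative parts of the
   coordinates. *)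

Require Import Defs.
From HB Require Import structures.
From mathcomp Require Import all_boot all_order all_algebra.
From mathcomp Require Import all_classical all_reals all_analysis.
From mathcomp Require Import measurable_realfun ring lra.
Import Order.TTheory GRing.Theory Num.Theory.
Import numFieldNormedType.Exports.
Local Open Scope classical_set_scope.
Local Open Scope ring_scope.

(** * Countable sums and integrals *)

(** The walk lives on an arbitrary probability space and is known through its finite-dimensional
    laws only. Paths are therefore lists of increments, which form a countable type, and
    expectations are countable sums over such lists: conditioning is summation over prefixes, and
    regeneration is a factorisation of path weights over disjoint sets of sites.

    With moments of order p > 1 only, single steps may have infinite variance. Second moments are
    thus taken for truncated steps alone, at a height that grows as a power of time. Sums over a
    cycle are controlled through survival probabilities: given the past, a step has mean norm at
    most M^p.

    The stationary measure is compared with [P] on half-spaces of environments, so what is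
    transferred to it must be an event of the environment alone. Summability of the quenched errors
    is such an event, unlike convergence of the walk on its own space. On good environments the
    quenched averages stay below M^p, so dominated convergence identifies the stationary drift. *)

Section esum_countable.
Context {R : realType} {T : countType}.
Local Open Scope ereal_scope.

(** [esum] is a supremum over finite subsets, so discarding the negative terms of a subset can only
    increase its sum. This gives measurability for sums of raw environment entries, whose sign is
    known only almost surely. *)
Lemma esum_max0 (D : set T) (f : T -> \bar R) :
  \esum_(z in D) f z = \esum_(z in D) maxe (f z) 0.
Proof.
apply/eqP; rewrite eq_le; apply/andP; split.
  by apply: le_esum => z _; rewrite le_max lexx.
apply: ge_ereal_sup => _ [X [finX XD] <-].
apply: esum_ge; exists (X `&` [set z | 0 <= f z]).
  by split; [exact: finite_setIl|move=> z [/XD]].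
rewrite (fsbigID [set z | 0 <= f z])//=.
rewrite (_ : \sum_(i \in X `\` _) _ = 0) ?adde0; last first.
  rewrite fsbig1// => z [_ /= /negP]; rewrite -ltNge => fz.
  by apply/max_idPr; exact: ltW.
by apply: lee_fsum => //; [exact: finite_setIl|move=> z [_ /= fz]; rewrite ge_max lexx].
Qed.

(** Codes of no element contribute 0, so a sum over [T] becomes a series over all natural numbers,
    to which the convergence theorems for series of functions apply. *)
Definition at_code (f : T -> \bar R) (k : nat) : \bar R :=
  if pickle_inv k is Some z then f z else 0.

Lemma esum_series (f : T -> \bar R) : (forall z, 0 <= f z) ->
  \esum_(z in [set: T]) f z = \sum_(k <oo) at_code f k.
Proof.
move=> f0; rewrite nneseries_esumT; last first.
  by move=> n; rewrite /at_code; case: pickle_inv.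
rewrite [RHS](_ : _ = \esum_(k in range (@pickle T)) at_code f k).
  rewrite (reindex_esum [set: T] _ pickle)//.
    by apply: eq_esum => z _; rewrite /at_code pickleK_inv.
  by apply: inj_bij => x y _ _; exact: (pcan_inj pickleK).
rewrite [RHS]esum_mkcond.
apply: eq_esum => k _; case: ifPn => // /negP; rewrite inE => /= nk.
rewrite /at_code; case E : (pickle_inv k) => [z|] //.
exfalso; apply: nk; exists z => //.
by have := @pickle_invK T k; rewrite E.
Qed.

End esum_countable.

Section integral_esum.
Context {R : realType} {T : countType} {d : measure_display} {Y : measurableType d}.
Local Open Scope ereal_scope.

Lemma measurable_esum (D : set Y) (f : T -> Y -> \bar R) :
  (forall z y, 0 <= f z y) -> (forall z, measurable_fun D (f z)) ->
  measurable_fun D (fun y => \esum_(z in [set: T]) f z y).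
Proof.
move=> f0 mf.
under eq_fun do rewrite esum_series//.
apply: (@ge0_emeasurable_sum _ _ _ D (fun k y => at_code (f ^~ y) k) xpredT).
  by move=> k x _ _; rewrite /at_code; case: pickle_inv.
move=> k _; rewrite /at_code; case: pickle_inv => //.
Qed.

Lemma integral_esum (mu : {measure set Y -> \bar R}) (D : set Y) (f : T -> Y -> \bar R) :
  measurable D ->
  (forall z y, 0 <= f z y) -> (forall z, measurable_fun D (f z)) ->
  \int[mu]_(y in D) (\esum_(z in [set: T]) f z y)
  = \esum_(z in [set: T]) \int[mu]_(y in D) f z y.
Proof.
move=> mD f0 mf.
under eq_integral do rewrite esum_series//.
rewrite integral_nneseries//.
- rewrite esum_series; last by move=> z; exact: integral_ge0.
  apply: eq_eseriesr => k _; rewrite /at_code; case: pickle_inv => //.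
  by rewrite integral0.
- by move=> n; rewrite /at_code; case: pickle_inv.
- by move=> n x Dx; rewrite /at_code; case: pickle_inv.
Qed.

Lemma esumZl (D : set T) (c : R) (f : T -> \bar R) :
  (0 <= c)%R -> (forall z, 0 <= f z) ->
  \esum_(z in D) (c%:E * f z) = c%:E * \esum_(z in D) f z.
Proof.
move=> c0 f0.
rewrite esum_mkcond esum_series; last by move=> z; case: ifP => // _; rewrite mule_ge0.
rewrite [in RHS]esum_mkcond esum_series; last by move=> z; case: ifP.
rewrite -nneseriesZl//; last by move=> n _; rewrite /at_code; case: pickle_inv => // z; case: ifP.
apply: eq_eseriesr => k _; rewrite /at_code; case: pickle_inv => [z|]; last by rewrite mule0.
by case: ifP; rewrite ?mule0.
Qed.

End integral_esum.

(* A positive additive functional that commutes with increasing limits is the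
   integral with respect to the measure it induces on indicators. *)
Section functional.
Context {R : realType} {d : measure_display} {T : measurableType d}.
Local Open Scope ereal_scope.
Variables (nu : {measure set T -> \bar R}) (I : (T -> \bar R) -> \bar R).
Hypothesis ID : forall f g : T -> \bar R,
  measurable_fun setT f -> measurable_fun setT g ->
  (forall x, 0 <= f x) -> (forall x, 0 <= g x) ->
  I (fun x => f x + g x) = I f + I g.
Hypothesis IZ : forall (c : R) (f : T -> \bar R), (0 <= c)%R ->
  measurable_fun setT f -> (forall x, 0 <= f x) ->
  I (fun x => c%:E * f x) = c%:E * I f.
Hypothesis Icvg : forall (g : nat -> T -> \bar R) (f : T -> \bar R),
  (forall n, measurable_fun setT (g n)) -> (forall n x, 0 <= g n x) ->
  (forall x, nondecreasing_seq (g ^~ x)) ->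
  (forall x, g n x @[n --> \oo] --> f x) -> I (g n) @[n --> \oo] --> I f.
Hypothesis I1 : forall A, measurable A -> I (fun x => (\1_A x)%:E) = nu A.

Import HBNNSimple.

Let I_nnsfun (h : {nnsfun T >-> R}) : I (EFin \o h) = \int[nu]_x (h x)%:E.
Proof.
(* The coefficients are clipped at 0 so that [ID] and [IZ] apply to any list [s]; the values of [h]
   are nonnegative, so clipping leaves them unchanged. *)
pose F (s : seq R) (x : T) : \bar R := \sum_(r <- s) (Num.max 0 r)%:E * (\1_(h @^-1` [set r]) x)%:E.
have F0 s x : 0 <= F s x.
  by apply: sume_ge0 => r _; rewrite mule_ge0// lee_fin// le_max lexx.
have mi r : measurable_fun [set: T] (fun x => (\1_(h @^-1` [set r]) x)%:E : \bar R).
  by apply/measurable_EFinP; exact: measurable_indic.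
have mF s : measurable_fun setT (F s).
  by apply: emeasurable_sum => r _; apply: emeasurable_funM.
have IF s : I (F s) = \int[nu]_x F s x.
  elim: s => [|r s IHs].
    have -> : F [::] = (fun x => (0%:R)%:E * (cst 0 x)) by apply/funext => x; rewrite /F big_nil mul0e.
    by rewrite IZ// mul0e; under eq_integral do rewrite mul0e; rewrite integral0.
  have -> : F (r :: s) = (fun x => (Num.max 0 r)%:E * (\1_(h @^-1` [set r]) x)%:E + F s x).
    by apply/funext => x; rewrite /F big_cons.
  have r0 : (0 <= Num.max 0 r)%R by rewrite le_max lexx.
  rewrite ID//; last 2 first.
    exact: emeasurable_funM.
    by move=> x; rewrite mule_ge0// lee_fin.
  rewrite IZ// I1// IHs ge0_integralD//; last 2 first.
    by move=> x _; rewrite mule_ge0// lee_fin.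
    exact: emeasurable_funM.
  by rewrite ge0_integralZl// ?lee_fin// integral_indic// setIT.
have hF : EFin \o h = F (finmap.enum_fset (fset_set (range h))).
  apply/funext => x /=; rewrite /F fimfunE -fsumEFin// fsbig_finite//=.
  rewrite big_seq [RHS]big_seq; apply: eq_bigr => r; rewrite in_fset_set// inE => -[y _ <-].
  by rewrite EFinM (max_idPr _).
by rewrite hF IF; apply: eq_integral => x _; rewrite -hF.
Qed.

Lemma functional_integral (f : T -> \bar R) : measurable_fun setT f ->
  (forall x, 0 <= f x) -> I f = \int[nu]_x f x.
Proof.
move=> mf f0.
pose h := nnsfun_approx measurableT mf.
have hf x : (EFin \o h n) x @[n --> \oo] --> f x.
  exact: (@cvg_nnsfun_approx _ _ _ _ measurableT f mf (fun x _ => f0 x) x Logic.I).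
have mh n : measurable_fun setT (EFin \o h n) by exact/measurable_EFinP.
have h0 n x : 0 <= (EFin \o h n) x by rewrite lee_fin.
have ndh x : nondecreasing_seq ((fun n => EFin \o h n) ^~ x).
  by move=> m n mn; rewrite lee_fin; exact/lefP/nd_nnsfun_approx.
have := Icvg _ _ mh h0 ndh hf.
under eq_fun do rewrite I_nnsfun.
have : (\int[nu]_x (h n x)%:E) @[n --> \oo] --> \int[nu]_x f x.
  rewrite (_ : (fun x => f x) = (fun x => limn (fun n => (EFin \o h n) x))).
    exact: (@cvg_monotone_convergence _ _ _ _ _ measurableT _ mh (fun n x _ => h0 n x) (fun x _ => ndh x)).
  by apply/funext => x; apply/esym/cvg_lim => //; exact: hf.
move=> c1 c2; exact: (cvg_unique _ c2 c1).
Qed.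

End functional.

Section weighted_integral.
Context {R : realType} {T : countType}.
Local Open Scope ereal_scope.

Lemma cvg_esum_monotone (a : nat -> T -> \bar R) (b : T -> \bar R) :
  (forall n z, 0 <= a n z) -> (forall z, nondecreasing_seq (a ^~ z)) ->
  (forall z, a n z @[n --> \oo] --> b z) ->
  \esum_(z in [set: T]) a n z @[n --> \oo] --> \esum_(z in [set: T]) b z.
Proof.
move=> a0 nda ab.
have b0 z : 0 <= b z.
  rewrite -(cvg_lim _ (ab z))//; apply: lime_ge; first by apply/cvg_ex; exists (b z).
  by apply: nearW => n.
have c0 n k : 0 <= at_code (a n) k by rewrite /at_code; case: pickle_inv.
have bc0 k : 0 <= at_code b k by rewrite /at_code; case: pickle_inv.
rewrite (_ : (fun n => _) = (fun n => \int[counting]_k at_code (a n) k)); last first.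
  by apply/funext => n; rewrite esum_series// ge0_integral_count.
rewrite esum_series// -ge0_integral_count//.
rewrite (_ : (fun k => at_code b k) = (fun k => limn (fun n => at_code (a n) k))).
  apply: (@cvg_monotone_convergence _ _ _ _ _ measurableT (fun n k => at_code (a n) k)) => //.
  by move=> k _ m n mn; rewrite /at_code; case: pickle_inv => // z; exact: nda.
apply/funext => k; rewrite /at_code; case: pickle_inv => [z|].
  by apply/esym/cvg_lim => //; exact: ab.
by rewrite lim_cst.
Qed.

Context {d1 d2 : measure_display} {X : measurableType d1} {Y : measurableType d2}.
Variables (mu : {measure set X -> \bar R}) (nu : {measure set Y -> \bar R}).
Variables (G : T -> X -> R) (phi : T -> X -> Y).
Hypothesis G0 : forall z x, (0 <= G z x)%R.
Hypothesis mG : forall z, measurable_fun setT (G z).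
Hypothesis mphi : forall z, measurable_fun setT (phi z).
Hypothesis nuE : forall A, measurable A ->
  \int[mu]_x (\esum_(z in [set: T]) ((G z x)%:E * (\1_A (phi z x))%:E)) = nu A.

(** [nuE] is the case of indicators, and the left side is additive and commutes with increasing
    limits. It serves twice: with a one-point index set for independence, and with the steps as
    indices for invariance of the stationary measure. *)
Lemma integral_weighted (f : Y -> \bar R) : measurable_fun setT f ->
  (forall y, 0 <= f y) ->
  \int[mu]_x (\esum_(z in [set: T]) ((G z x)%:E * f (phi z x))) = \int[nu]_y f y.
Proof.
have Gf0 (g : Y -> \bar R) z x : (forall y, 0 <= g y) -> 0 <= (G z x)%:E * g (phi z x).
  by move=> g0; rewrite mule_ge0// lee_fin.
have mGf (g : Y -> \bar R) z : measurable_fun setT g ->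
    measurable_fun setT (fun x => (G z x)%:E * g (phi z x)).
  move=> mg; apply: emeasurable_funM; first exact/measurable_EFinP.
  exact: (measurableT_comp mg (mphi z)).
have mI (g : Y -> \bar R) : measurable_fun setT g -> (forall y, 0 <= g y) ->
    measurable_fun setT (fun x => \esum_(z in [set: T]) ((G z x)%:E * g (phi z x))).
  by move=> mg g0; apply: measurable_esum => [z x|z]; [exact: Gf0|exact: mGf].
move=> mf f0.
apply: (@functional_integral _ _ _ nu
  (fun f => \int[mu]_x \esum_(z in [set: T]) ((G z x)%:E * f (phi z x)))) => //.
- move=> g h mg mh g0 h0; rewrite -ge0_integralD//.
  + apply: eq_integral => x _; rewrite -esumD//=; last 2 first.
    * by move=> z _; exact: Gf0.
    * by move=> z _; exact: Gf0.
    by apply: eq_esum => z _; rewrite ge0_muleDr.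
  + by move=> x _; apply: esum_ge0 => z _; exact: Gf0.
  + exact: mI.
  + by move=> x _; apply: esum_ge0 => z _; exact: Gf0.
  + exact: mI.
- move=> c g c0 mg g0; rewrite -ge0_integralZl//; last 2 first.
  + exact: mI.
  + by move=> x _; apply: esum_ge0 => z _; exact: Gf0.
  apply: eq_integral => x _; rewrite -esumZl//; last by move=> z; exact: Gf0.
  by apply: eq_esum => z _; rewrite muleCA.
move=> g h mg g0 ndg gh.
pose Ig n x := \esum_(z in [set: T]) ((G z x)%:E * g n (phi z x)).
have cI x : Ig n x @[n --> \oo] --> \esum_(z in [set: T]) ((G z x)%:E * h (phi z x)).
  apply: cvg_esum_monotone => [n z|z m n mn|z].
  - exact: Gf0.
  - by apply: lee_wpmul2l; [rewrite lee_fin|exact: ndg].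
  - by apply: cvgeZl => //; exact: gh.
rewrite (_ : (fun x => \esum_(z in [set: T]) ((G z x)%:E * h (phi z x))) =
             (fun x => limn (fun n => Ig n x))).
  apply: (@cvg_monotone_convergence _ _ _ _ _ measurableT Ig).
  - by move=> n; exact: mI.
  - by move=> n x _; apply: esum_ge0 => z _; exact: Gf0.
  - move=> x _ m n mn; apply: le_esum => z _.
    by apply: lee_wpmul2l; [rewrite lee_fin|exact: ndg].
by apply/funext => x; apply/esym/cvg_lim => //; exact: cI.
Qed.

End weighted_integral.

(** * Environments and path weights *)

Section environments.
Context {R : realType} {d : nat}.

Definition pvec := g_sigma_algebraType (vec_gen R d).

Lemma measurable_into_pvec dY (Y : measurableType dY) (phi : Y -> pvec) :
  (forall z, measurable_fun setT (fun y => phi y z : R)) -> measurable_fun setT phi.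
Proof.
move=> mphi; apply: (@measurability _ _ Y (g_sigma_algebraType (vec_gen R d)) setT phi (vec_gen R d)) => //.
move=> _ [_ [z [B [mB ->]]] <-].
exact: mphi.
Qed.

Lemma measurable_into_Env dY (Y : measurableType dY) (phi : Y -> Env R d) :
  (forall x z, measurable_fun setT (fun y => phi y x z : R)) -> measurable_fun setT phi.
Proof.
move=> mphi; apply: (@measurability _ _ Y (Env R d) setT phi (env_gen R d)) => //.
move=> _ [_ [x [z [B [mB ->]]]] <-].
exact: mphi.
Qed.

Lemma measurable_pvec_coord z : measurable_fun setT (fun p : pvec => p z : R).
Proof.
move=> _ B mB; rewrite setTI; apply: sub_sigma_algebra.
by exists z, B.
Qed.

Lemma measurable_Env_coord x z : measurable_fun setT (fun w : Env R d => w x z : R).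
Proof.
move=> _ B mB; rewrite setTI; apply: sub_sigma_algebra.
by exists x, z, B.
Qed.

Lemma measurable_site x : measurable_fun setT (fun w : Env R d => w x : pvec).
Proof. by apply: measurable_into_pvec => z; exact: measurable_Env_coord. Qed.

Lemma measurable_shift x : measurable_fun setT (fun w : Env R d => Defs.shift x w : Env R d).
Proof. by apply: measurable_into_Env => y z; exact: (measurable_Env_coord (y + x) z). Qed.

End environments.
Arguments pvec : clear implicits.

(** * Independence of the sites, for bounded functions *)

Section independence.
Context {R : realType} {d : nat} (P : probability (Env R d) R).
Hypothesis iidP : iid_product P.
Local Open Scope ereal_scope.

(** [iid_product] speaks of rectangles only. Indicators are exchanged for bounded functions one site
    at a time. *)
Lemma iid_integral_prod (F : seq (site d)) (h : site d -> pvec R d -> R) :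
  uniq F -> (forall x, measurable_fun setT (h x)) -> (forall x p, (0 <= h x p <= 1)%R) ->
  \int[P]_w (\prod_(x <- F) h x (w x))%:E = \prod_(x <- F) \int[P]_w (h x (w 0%R))%:E.
Proof.
move=> uF mh h01.
have h0 x p : (0 <= h x p)%R by have /andP[] := h01 x p.
have h1 x p : (h x p <= 1)%R by have /andP[] := h01 x p.
have mev x : measurable_fun setT (fun w : Env R d => w x : pvec R d) by exact: measurable_site.
have mhx x y : measurable_fun setT (fun w : Env R d => h x (w y)) by exact: (measurableT_comp (mh x) (mev y)).
have int_le1 (f : Env R d -> R) : measurable_fun setT f ->
    (forall w, 0 <= f w <= 1)%R -> 0 <= \int[P]_w (f w)%:E <= 1.
  move=> mf f01; apply/andP; split.
    by apply: integral_ge0 => w _; rewrite lee_fin; have /andP[] := f01 w.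
  rewrite -(@probability_setT _ _ _ P) -[leRHS]mul1e -integral_cst//.
  apply: ge0_le_integral => //.
  - by move=> w _; rewrite lee_fin; have /andP[] := f01 w.
  - exact/measurable_EFinP.
  - by move=> w _; rewrite lee_fin; have /andP[] := f01 w.
(* Mixed products: functions at the sites of [F1], indicators at those of [F2]. *)
suff : forall F1 F2 (A : site d -> set (pvec R d)), uniq (F1 ++ F2) ->
    (forall x, measurable (A x)) ->
    \int[P]_w ((\prod_(x <- F1) h x (w x)) * \prod_(x <- F2) \1_(A x) (w x))%:E
    = (\prod_(x <- F1) \int[P]_w (h x (w 0%R))%:E)
      * \prod_(x <- F2) P [set w : env R d | A x (w 0%R)].
  move=> /(_ F [::] (fun=> setT)); rewrite cats0 !big_nil mule1 => <-//.
  by under [RHS]eq_integral do rewrite big_nil mulr1.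
elim=> [|x F1 IH] F2 A uF12 mA.
  under eq_integral do rewrite big_nil mul1r.
  rewrite big_nil mul1e -iidP//.
  rewrite -[X in P X]setIT -integral_indic//; last first.
    rewrite (_ : [set _ | _] = \big[setI/setT]_(x <- F2) [set w : Env R d | A x (w x)]).
      by apply: bigsetI_measurable => x _; rewrite -[X in measurable X]setTI; exact: mev.
    apply/seteqP; split=> w /=.
      move=> Aw; rewrite -bigcap_seq => x /= xF; exact: Aw.
    by rewrite -bigcap_seq => Aw x xF; exact: Aw.
  apply: eq_integral => w _; congr (_%:E).
  rewrite indicE; case: (pselect (forall x, x \in F2 -> A x (w x))) => [Aw|nAw].
    rewrite (mem_set Aw) big1_seq// => x /andP[_ xF]; rewrite indicE mem_set//.
    exact: Aw.
  rewrite memNset//.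
  have [x xF nAx] : exists2 x, x \in F2 & ~ A x (w x).
    by apply: contrapT => nex; apply: nAw => x xF; apply: contrapT => nA; apply: nex; exists x.
  by apply/eqP; rewrite prodf_seq_eq0; apply/hasP; exists x => //=; rewrite indicE memNset.
have [xF12 uF12'] : x \notin F1 ++ F2 /\ uniq (F1 ++ F2) by move: uF12 => /= /andP.
have xF1 : x \notin F1 by move: xF12; rewrite mem_cat negb_or => /andP[].
have xF2 : x \notin F2 by move: xF12; rewrite mem_cat negb_or => /andP[].
pose G (w : Env R d) : R := ((\prod_(y <- F1) h y (w y)) * \prod_(y <- F2) \1_(A y) (w y))%R.
have mG : measurable_fun setT G.
  apply: measurable_funM; apply: measurable_prod => y _ //.
  exact: (measurableT_comp (measurable_indic (mA y)) (mev y)).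
have G0 w : (0 <= G w)%R.
  by rewrite mulr_ge0//; apply: prodr_ge0.
have Gle1 w : (G w <= 1)%R.
  rewrite mulr_ile1//; try exact: prodr_ge0.
    by apply: prodr_ile1 => y _.
  by apply: prodr_ile1 => y _; rewrite indicE ler0n lern1 leq_b1.
pose c := (\prod_(x <- F1) \int[P]_w (h x (w 0%R))%:E)
      * \prod_(x <- F2) P [set w : env R d | A x (w 0%R)].
have prod01 (T : Type) (s : seq T) (f : T -> \bar R) : (forall t, 0 <= f t <= 1) ->
    0 <= \prod_(t <- s) f t <= 1.
  move=> f01; elim: s => [|t s /andP[IHs0 IHs1]]; first by rewrite big_nil lee01 lexx.
  have /andP[ft0 ft1] := f01 t.
  by rewrite big_cons mule_ge0//= -[leRHS]mule1 lee_pmul.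
have c01 : 0 <= c <= 1.
  have /andP[a0 a1] : 0 <= \prod_(x <- F1) \int[P]_w (h x (w 0%R))%:E <= 1.
    by apply: prod01 => y; apply: int_le1.
  have /andP[b0 b1] : 0 <= \prod_(x <- F2) P [set w : env R d | A x (w 0%R)] <= 1.
    apply: prod01 => y; rewrite measure_ge0/= probability_le1//.
    by rewrite -[X in measurable X]setTI; exact: mev.
  by rewrite mule_ge0//= -[leRHS]mule1 lee_pmul.
have /andP[c0 c1] := c01.
have cfin : c \is a fin_num by rewrite ge0_fin_numE// (le_lt_trans c1)// ltry.
have fc0 : (0 <= fine c)%R by rewrite fine_ge0.
pose ev0 : {mfun (Env R d) >-> (pvec R d)} :=
  HB.pack (fun w : Env R d => w 0%R : pvec R d) (isMeasurableFun.Build _ _ _ _ _ (mev 0%R)).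
(* Weighted by [G], the law of [w x] is [c] times the law of [w 0]: on a set [B] this is the
   induction hypothesis with [x] added to the indicator sites. *)
pose nu : {measure set (pvec R d) -> \bar R} := mscale (NngNum fc0) (distribution P ev0).
have nuE (B : set (pvec R d)) : measurable B ->
    \int[P]_w (\esum_(t in [set: unit]) ((G w)%:E * (\1_B (w x))%:E)) = nu B.
  move=> mB; rewrite -[nu B]/((fine c)%:E * distribution P ev0 B) fineK//.
  pose A' y := if y == x then B else A y.
  have /= := IH (x :: F2) A'.
  rewrite big_cons /A' eqxx => E.
  have F2E : forall (T : Type) (idx : T) (op : Monoid.com_law idx) (f : site d -> set (pvec R d) -> T),
      \big[op/idx]_(y <- F2) f y (if y == x then B else A y) = \big[op/idx]_(y <- F2) f y (A y).
    move=> T idx op f; rewrite big_seq [RHS]big_seq; apply: eq_bigr => y yF.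
    by case: eqP => // yx; move: xF2; rewrite -yx yF.
  have -> : c * distribution P ev0 B = (\prod_(x <- F1) \int[P]_w (h x (w 0%R))%:E) *
      (P [set w : env R d | B (w 0%R)] * \prod_(x <- F2) P [set w : env R d | A x (w 0%R)]).
    by rewrite /c /distribution /pushforward/= -muleA [_ * P _]muleC.
  rewrite -(F2E _ _ _ (fun x A => P [set w : env R d | A (w 0%R)])) -E; last 2 first.
    by rewrite -(cat1s x F2) uniq_catCA.
    by move=> y; case: ifP.
  apply: eq_integral => w _.
  rewrite (_ : setT = [set tt]); last by apply/seteqP; split => // -[].
  rewrite esum_set1; last by rewrite mule_ge0// lee_fin.
  rewrite -EFinM big_cons eqxx (F2E _ _ _ (fun y A => \1_A (w y) : R)) /G; congr (_%:E); ring.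
have mhE : measurable_fun setT (EFin \o h x) by exact/measurable_EFinP.
have hE0 p : 0 <= (EFin \o h x) p by rewrite lee_fin.
have := integral_weighted P nu (fun=> G) (fun _ w => w x) (fun _ => G0) (fun _ => mG)
  (fun _ => mev x) nuE (EFin \o h x) mhE hE0.
rewrite /nu ge0_integral_mscale// ge0_integral_distribution//= fineK// => E.
rewrite big_cons -muleA -/c [RHS]muleC -E.
apply: eq_integral => w _.
rewrite (_ : setT = [set tt]); last by apply/seteqP; split => // -[].
rewrite esum_set1; last by rewrite mule_ge0// lee_fin.
by rewrite -EFinM big_cons /G; congr (_%:E); ring.
Qed.

End independence.

(** * Path weights and their annealed means *)

Section path_weights.
Context {R : realType} {d : nat} (u : 'rV[R]_d).
Implicit Types (z x : site d) (g : seq (site d)) (w : env R d) (p : pvec R d).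

Lemma dotuD x z : dotu (x + z) u = dotu x u + dotu z u.
Proof.
by rewrite /dotu -big_split/=; apply: eq_bigr => i _; rewrite mxE rmorphD mulrDl.
Qed.

Lemma dotu0 : dotu (0 : site d) u = 0.
Proof. by rewrite /dotu big1// => i _; rewrite mxE mul0r. Qed.

Lemma dotuN z : dotu (- z) u = - dotu z u.
Proof. by rewrite /dotu -sumrN; apply: eq_bigr => i _; rewrite mxE rmorphN mulNr. Qed.

(** A path from 0 is given by its list of increments: cutting it at a time is splitting a list, and
    the second piece starts again from 0. *)
Definition disp g : site d := \sum_(z <- g) z.

Definition level g : R := dotu (disp g) u.

Definition forward g : bool := all (fun z => 0 <= dotu z u) g.

Lemma disp_cons z g : disp (z :: g) = z + disp g.
Proof. by rewrite /disp big_cons. Qed.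

Lemma disp_cat g1 g2 : disp (g1 ++ g2) = disp g1 + disp g2.
Proof. by rewrite /disp big_cat. Qed.

Lemma disp_rcons g z : disp (rcons g z) = disp g + z.
Proof. by rewrite -cats1 disp_cat /disp big_seq1. Qed.

Lemma level_rcons g z : level (rcons g z) = level g + dotu z u.
Proof. by rewrite /level disp_rcons dotuD. Qed.

Lemma level_nil : level [::] = 0.
Proof. by rewrite /level /disp big_nil dotu0. Qed.

Lemma forward_rcons g z : forward (rcons g z) = (0 <= dotu z u) && forward g.
Proof. by rewrite /forward all_rcons. Qed.

Lemma forward_level g : forward g -> 0 <= level g.
Proof.
elim/last_ind: g => [|g z IH]; first by rewrite level_nil.
by rewrite forward_rcons => /andP[z0 /IH g0]; rewrite level_rcons addr_ge0.
Qed.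

(* The clipping to [0, 1] and to the half-space changes [p] only outside an
   almost sure event, and makes path weights bounded and dependent on forward
   sites only, for every environment. *)
Definition sprob z p : R := if 0 <= dotu z u then Num.min 1 (Num.max 0 (p z)) else 0.

Lemma sprob01 z p : 0 <= sprob z p <= 1.
Proof.
rewrite /sprob; case: ifP => _; last by rewrite lexx ler01.
by rewrite le_min ler01 le_max lexx /= ge_min lexx.
Qed.

Lemma sprob_ge0 z p : 0 <= sprob z p.
Proof. by have /andP[] := sprob01 z p. Qed.

Lemma measurable_sprob dY (Y : measurableType dY) (f : Y -> R) z : measurable_fun setT f ->
  measurable_fun setT (fun y => if 0 <= dotu z u then Num.min 1 (Num.max 0 (f y)) else 0).
Proof.
move=> mf; case: (0 <= dotu z u) => //.
apply: (@measurable_minr _ _ _ _ (cst 1) (fun y => Num.max 0 (f y))) => //.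
exact: (@measurable_maxr _ _ _ _ (cst 0) f).
Qed.

(** The quenched probability of the increments [g]. The environment is moved instead of the walker,
    which gives [weight_cat] its form. *)
Fixpoint weight g w : R :=
  if g is z :: g' then sprob z (w 0) * weight g' (Defs.shift z w) else 1.

Lemma weight01 g w : 0 <= weight g w <= 1.
Proof.
elim: g w => [|z g IH] w /=; first by rewrite ler01 lexx.
have /andP[a0 a1] := IH (Defs.shift z w); have /andP[b0 b1] := sprob01 z (w 0).
by rewrite mulr_ge0//= mulr_ile1.
Qed.

Lemma weight_ge0 g w : 0 <= weight g w.
Proof. by have /andP[] := weight01 g w. Qed.

Lemma env_shift0 w : Defs.shift 0 w = w.
Proof. by apply/funext => x; rewrite /Defs.shift addr0. Qed.

Lemma env_shiftD x z w : Defs.shift x (Defs.shift z w) = Defs.shift (x + z) w.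
Proof. by apply/funext => y; rewrite /Defs.shift addrA. Qed.

Lemma weight_cat g1 g2 w :
  weight (g1 ++ g2) w = weight g1 w * weight g2 (Defs.shift (disp g1) w).
Proof.
elim: g1 w => [|z g1 IH] w /=; first by rewrite /disp big_nil env_shift0 mul1r.
by rewrite IH mulrA env_shiftD disp_cons [z + _]addrC.
Qed.

Lemma weight_nforward g w : ~~ forward g -> weight g w = 0.
Proof.
elim: g w => [|z g IH] w //=; rewrite negb_and => /orP[z0|/IH ->]; last by rewrite mulr0.
by rewrite /sprob (negbTE z0) mul0r.
Qed.

Lemma measurable_weight g dY (Y : measurableType dY) (phi : Y -> env R d) :
  (forall x z, 0 <= dotu x u -> measurable_fun setT (fun y => phi y x z : R)) ->
  measurable_fun setT (fun y => weight g (phi y)).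
Proof.
elim: g phi => [|z g IH] phi mphi //=.
have [z0|z0] := boolP (0 <= dotu z u); last first.
  rewrite (_ : (fun y => _) = cst 0)//.
  by apply/funext => y; rewrite /sprob (negbTE z0) mul0r.
apply: measurable_funM.
  by apply: measurable_sprob; apply: mphi; rewrite dotu0.
by apply: IH => x y x0; apply: mphi; rewrite dotuD addr_ge0.
Qed.

(** The sites from which a step is taken; the endpoint is left out, because its transition vector
    has not been used. *)
Fixpoint visited g : seq (site d) :=
  if g is z :: g' then 0 :: [seq y + z | y <- visited g'] else [::].

(** All the transition probabilities that [g] uses at the site [x], so that [weight] splits into one
    factor per site even when sites are revisited. *)
Fixpoint site_factor g x p : R :=
  if g is z :: g' then (if x == 0 then sprob z p else 1) * site_factor g' (x - z) p else 1.

Lemma site_factor01 g x p : 0 <= site_factor g x p <= 1.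
Proof.
elim: g x => [|z g IH] x /=; first by rewrite ler01 lexx.
have /andP[a0 a1] := IH (x - z); have /andP[b0 b1] := sprob01 z p.
by case: ifP => _; rewrite ?mul1r ?a0// mulr_ge0//= mulr_ile1.
Qed.

Lemma measurable_site_factor g x : measurable_fun setT (fun p : pvec R d => site_factor g x p).
Proof.
elim: g x => [|z g IH] x //=.
apply: measurable_funM => //; case: (x == 0) => //.
by apply: measurable_sprob; exact: measurable_pvec_coord.
Qed.

Lemma site_factor_notin g x p : x \notin visited g -> site_factor g x p = 1.
Proof.
elim: g x => [|z g IH] x //=; rewrite inE negb_or => /andP[/negbTE -> xg].
rewrite mul1r IH//; apply: contra xg => xg; apply/mapP; exists (x - z) => //.
by rewrite subrK.
Qed.

Lemma site_factor_cat g1 g2 x p :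
  site_factor (g1 ++ g2) x p = site_factor g1 x p * site_factor g2 (x - disp g1) p.
Proof.
elim: g1 x => [|z g1 IH] x /=; first by rewrite /disp big_nil subr0 mul1r.
by rewrite IH mulrA disp_cons opprD addrA.
Qed.

(** [F] may be larger than the set of visited sites: the tail of a path need not return to its first
    site, and an unvisited site has factor 1. *)
Lemma weight_prod g (F : seq (site d)) w : uniq F -> {subset visited g <= F} ->
  weight g w = \prod_(x <- F) site_factor g x (w x).
Proof.
elim: g F w => [|z g IH] F w uF sF /=; first by rewrite big1.
rewrite big_split/=; congr (_ * _).
  rewrite (bigD1_seq 0)//=; last by apply: sF; rewrite inE eqxx.
  rewrite eqxx big1 ?mulr1// => x /negbTE ->//.
rewrite (IH [seq x - z | x <- F]); last 2 first.
- by rewrite map_inj_uniq//; exact: addIr.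
- move=> y yg; apply/mapP; exists (y + z); last by rewrite addrK.
  by apply: sF; rewrite inE; apply/orP; right; apply/mapP; exists y.
by rewrite big_map; apply: eq_bigr => x _; rewrite /Defs.shift subrK.
Qed.

Lemma visited_level g x : forward g -> x \in visited g -> 0 <= dotu x u <= level g.
Proof.
elim: g x => [|z g IH] x //= /andP[z0 fg]; rewrite inE /level disp_cons dotuD.
have g0 : 0 <= level g by exact: forward_level.
case/orP => [/eqP ->|/mapP[y /(IH _ fg)/andP[y0 yg] ->]].
  by rewrite dotu0 lexx addr_ge0.
by rewrite dotuD addr_ge0//= addrC lerD2l.
Qed.

Lemma visited_cat g1 g2 :
  visited (g1 ++ g2) = visited g1 ++ [seq y + disp g1 | y <- visited g2].
Proof.
elim: g1 => [|z g1 IH] /=.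
  by rewrite /disp big_nil -[LHS]map_id; apply: eq_map => y; rewrite addr0.
rewrite IH map_cat -map_comp; congr (_ :: _ ++ _); apply: eq_map => y /=.
by rewrite disp_cons -addrA [disp _ + _]addrC.
Qed.

(* The site reached by the last step lies strictly above all earlier ones, so
   the walk has only seen environment strictly below its current level. *)
Definition fresh g : Prop := forall x, x \in visited g -> dotu x u < level g.

Lemma fresh_rcons g z : forward g -> level g < level (rcons g z) -> fresh (rcons g z).
Proof.
move=> fg gz x; rewrite -cats1 visited_cat mem_cat /= inE add0r => /orP[xg|/eqP ->].
  by rewrite cats1; have /andP[_ /le_lt_trans] := visited_level _ _ fg xg; apply.
by rewrite cats1.
Qed.

Section annealed.
Context (P : probability (Env R d) R).

Definition pathw g : \bar R := (\int[P]_w (weight g w)%:E)%E.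

Lemma pathw_ge0 g : (0 <= pathw g)%E.
Proof. by apply: integral_ge0 => w _; rewrite lee_fin weight_ge0. Qed.

Hypothesis iidP : iid_product P.

Lemma pathw_prod g (F : seq (site d)) : uniq F -> {subset visited g <= F} ->
  pathw g = (\prod_(x <- F) \int[P]_w (site_factor g x (w 0%R))%:E)%E.
Proof.
move=> uF sF; rewrite /pathw; under eq_integral do rewrite (weight_prod _ F)//.
apply: (iid_integral_prod P iidP F (site_factor g)) => //.
- exact: measurable_site_factor.
- exact: site_factor01.
Qed.

(** The first path uses sites strictly below [level g1]; the second one, translated, uses sites at
    or above it. The site factors are then independent, and translation does not change the law of a
    site. When [g2] is not forward, both sides are 0. *)
Lemma pathw_cat g1 g2 : fresh g1 -> pathw (g1 ++ g2) = (pathw g1 * pathw g2)%E.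
Proof.
move=> fg1; have [fg2|nfg2] := boolP (forward g2); last first.
  have E g : ~~ forward g -> pathw g = 0%E.
    by move=> ng; rewrite /pathw; under eq_integral do rewrite weight_nforward//; rewrite integral0.
  by rewrite (E g2)// mule0 E// /forward all_cat negb_and nfg2 orbT.
pose F1 := undup (visited g1); pose F2 := undup (visited g2).
have F2_level x : x \in F2 -> level g1 <= dotu (x + disp g1) u.
  rewrite mem_undup => /(visited_level _ _ fg2)/andP[x0 _].
  by rewrite dotuD lerDr.
have uF2 : uniq [seq y + disp g1 | y <- F2].
  by rewrite map_inj_uniq ?undup_uniq//; exact: addIr.
rewrite (pathw_prod _ (F1 ++ [seq y + disp g1 | y <- F2])); last 2 first.
- rewrite cat_uniq undup_uniq uF2/= andbT; apply/hasPn => _ /mapP[y yF ->].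
  by rewrite mem_undup; apply/negP => /fg1; rewrite ltNge F2_level.
- move=> x; rewrite visited_cat !mem_cat => /orP[xg|/mapP[y yg ->]].
    by rewrite mem_undup xg.
  by apply/orP; right; apply/mapP; exists y; rewrite ?mem_undup.
rewrite big_cat/= big_map; congr (_ * _)%E.
  rewrite (pathw_prod g1 F1) ?undup_uniq//; last by move=> x; rewrite mem_undup.
  rewrite !big_seq; apply: eq_bigr => x; rewrite mem_undup => /fg1 xg.
  apply: eq_integral => w _; rewrite site_factor_cat (site_factor_notin g2) ?mulr1//.
  apply/negP => /(visited_level _ _ fg2)/andP[]; rewrite dotuD dotuN.
  by rewrite subr_ge0 leNgt xg.
rewrite (pathw_prod g2 F2) ?undup_uniq//; last by move=> x; rewrite mem_undup.
rewrite !big_seq; apply: eq_bigr => x /F2_level xg.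
apply: eq_integral => w _; rewrite site_factor_cat (site_factor_notin g1) ?mul1r ?addrK//.
by apply/negP => /fg1; rewrite ltNge xg.
Qed.

End annealed.
End path_weights.

Section countable_events.
Context {d0 : measure_display} {Y : measurableType d0} {T : countType}.

Lemma measurable_forall (A : T -> set Y) : (forall t, measurable (A t)) ->
  measurable [set y | forall t, A t y].
Proof.
move=> mA; pose B k := if unpickle k is Some t then A t else setT.
have -> : [set y | forall t, A t y] = \bigcap_k B k.
  apply/seteqP; split=> y /=.
    by move=> Ay k _; rewrite /B; case: unpickle.
  by move=> By t; have := By (pickle t) Logic.I; rewrite /B pickleK.
by apply: bigcapT_measurable => k; rewrite /B; case: unpickle.
Qed.

Lemma ae_forall_countable {R : realType} (mu : {measure set Y -> \bar R}) (A : T -> Y -> Prop) :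
  (forall t, {ae mu, forall y, A t y}) -> {ae mu, forall y, forall t, A t y}.
Proof.
move=> mA.
have : {ae mu, forall y, forall k : nat, if unpickle k is Some t then A t y else True}.
  apply: ae_foralln => k; case: (unpickle k) => [t|]; first exact: mA.
  exact: aeW.
by apply: filterS => y H t; have := H (pickle t); rewrite pickleK.
Qed.

Lemma ae_probability1 {R : realType} (mu : probability Y R) (A : set Y) : measurable A ->
  mu A = 1%E -> {ae mu, forall y, A y}.
Proof.
move=> mA A1; exists (~` A); split => //; first exact: measurableC.
by rewrite probability_setC// A1 subee.
Qed.

Lemma probability1_ae {R : realType} (mu : probability Y R) (A : set Y) : measurable A ->
  {ae mu, forall y, A y} -> mu A = 1%E.
Proof.
move=> mA [N [mN N0 AN]].
have : mu (~` A) = 0%E.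
  by apply: (subset_measure0 _ _ AN N0) => //; exact: measurableC.
rewrite probability_setC// -(@fineK _ (mu A)) ?fin_num_measure// -EFinB => -[/eqP].
by rewrite subr_eq0 => /eqP <-.
Qed.

End countable_events.

(** * Transition vectors that satisfy the almost sure assumptions *)

Section good_environments.
Context {R : realType} {d : nat} (u : 'rV[R]_d) (delta M p : R).
Implicit Types (q : site d -> R) (z : site d) (w : env R d).
Local Open Scope ereal_scope.

(** The assumptions at one site, rewritten with the clipped entries: all the sums then have
    nonnegative terms in every environment, so each condition is measurable without regard to null
    sets. *)
Definition good q : Prop :=
  [/\ forall z, q z = sprob u z q,
      \esum_(z in [set: site d]) (sprob u z q)%:E = 1,
      delta%:E <= \esum_(z in [set: site d]) (dotu z u * sprob u z q)%:E &
      \esum_(z in [set: site d]) (l1 z `^ p * sprob u z q)%:E <= (M `^ p)%:E].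

Lemma dotu_sprob_ge0 z q : (0 <= dotu z u * sprob u z q)%R.
Proof.
rewrite /sprob; case: ifP => z0; last by rewrite mulr0.
by rewrite mulr_ge0// le_min ler01 le_max lexx.
Qed.

(** Total mass 1 and mass 1 on the forward half-space leave nothing for backward steps, so clipping
    changes nothing and the negative part of the drift sum vanishes. *)
Lemma raw_good q : is_probvec q ->
  \esum_(z in [set z : site d | (0 <= dotu z u)%R]) (q z)%:E = 1 ->
  delta%:E <= ssum (fun z => (dotu z u * q z)%R) ->
  \esum_(z in [set: site d]) ((l1 z `^ p * q z)%R)%:E <= (M `^ p)%:E -> good q.
Proof.
move=> [q0 q1] qH qd qM.
have qle1 z : (q z <= 1)%R.
  rewrite -lee_fin -q1; apply: esum_ge; exists [set z]; first by split.
  by rewrite fsbig_set1.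
have qback z : ~~ (0 <= dotu z u)%R -> q z = 0%R.
  move=> z0; apply/eqP; rewrite eq_le q0 andbT -lee_fin.
  have : 1 + \esum_(z in [set z : site d | ~ (0 <= dotu z u)%R]) (q z)%:E = 1 :> \bar R.
    rewrite -[RHS]q1 [RHS](esumID [set z : site d | (0 <= dotu z u)%R])//; last first.
      by move=> ? _; rewrite lee_fin.
    by rewrite !setTI -{1}qH; congr (_ + _).
  move=> H; have e0 : \esum_(z in [set z : site d | ~ (0 <= dotu z u)%R]) (q z)%:E <= 0.
    by rewrite -(@leeD2lE _ 1)// adde0 H.
  apply: le_trans e0; apply: esum_ge; exists [set z]; first by split => // _ ->; apply/negP.
  by rewrite fsbig_set1.
have qs z : q z = sprob u z q.
  rewrite /sprob; case: ifPn => [_|/qback//].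
  by rewrite (max_idPr (q0 z)) (min_idPr (qle1 z)).
split => //.
- by under eq_esum do rewrite -qs.
- apply: (le_trans qd); rewrite /ssum [X in _ - X]esum1; last first.
    move=> z _; congr (_%:E); apply/max_idPr; rewrite oppr_le0 qs; exact: dotu_sprob_ge0.
  rewrite sube0; apply: le_esum => z _; rewrite qs lee_fin.
  by rewrite (max_idPl (dotu_sprob_ge0 _ _)).
- by under eq_esum do rewrite -qs.
Qed.

Lemma measurable_good dY (Y : measurableType dY) (phi : Y -> site d -> R) :
  (forall z, measurable_fun setT (fun y => phi y z)) ->
  measurable [set y | good (phi y)].
Proof.
move=> mphi.
have ms z : measurable_fun setT (fun y => sprob u z (phi y)) by exact: measurable_sprob.
have m1 : measurable [set y | forall z, phi y z = sprob u z (phi y)].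
  apply: (@measurable_forall _ _ _ (fun z => [set y | phi y z = sprob u z (phi y)])) => z.
  rewrite -[X in measurable X]setTI.
  have := @measurable_eqe _ Y R setT measurableT (EFin \o (fun y => phi y z))
     (EFin \o (fun y => sprob u z (phi y))).
  rewrite (_ : [set y | _ = _] = [set y | phi y z = sprob u z (phi y)]); last first.
    by apply/seteqP; split => y /= => [[]|->].
  by apply; exact/measurable_EFinP.
have mE (c : site d -> R) : (forall z y, 0 <= c z * sprob u z (phi y))%R ->
    measurable_fun setT (fun y => \esum_(z in [set: site d]) (c z * sprob u z (phi y))%:E).
  move=> c0; apply: measurable_esum => [z y|z]; first by rewrite lee_fin.
  by apply/measurable_EFinP; exact: measurable_funM.
have m2 : measurable [set y | \esum_(z in [set: site d]) (sprob u z (phi y))%:E = 1].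
  rewrite -[X in measurable X]setTI; apply: measurable_eqe => //.
  have := mE (fun=> 1%R); under eq_fun do under eq_esum do rewrite mul1r.
  by apply => z y; rewrite mul1r sprob_ge0.
have m3 : measurable [set y | delta%:E <= \esum_(z in [set: site d]) (dotu z u * sprob u z (phi y))%:E].
  rewrite -[X in measurable X]setTI; apply: measurable_lee => //.
  by apply: mE => z y; exact: dotu_sprob_ge0.
have m4 : measurable [set y |
    \esum_(z in [set: site d]) (l1 z `^ p * sprob u z (phi y))%:E <= (M `^ p)%:E].
  rewrite -[X in measurable X]setTI; apply: measurable_lee => //.
  by apply: mE => z y; rewrite mulr_ge0// ?powR_ge0// sprob_ge0.
rewrite (_ : [set y | good (phi y)] =
  [set y | forall z, phi y z = sprob u z (phi y)] `&`
  [set y | \esum_(z in [set: site d]) (sprob u z (phi y))%:E = 1] `&`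
  [set y | delta%:E <= \esum_(z in [set: site d]) (dotu z u * sprob u z (phi y))%:E] `&`
  [set y | \esum_(z in [set: site d]) (l1 z `^ p * sprob u z (phi y))%:E <= (M `^ p)%:E]).
  by do 3 apply: measurableI => //.
by apply/seteqP; split => y /= [] => [? ? ? ?|[[? ?] ?] ?]; do ?split.
Qed.

(** Only sites of nonnegative level are constrained: this puts the event in [S_k u 0], where null
    sets of [P] are null for the stationary measure, and forward shifts preserve it. *)
Definition good_env : set (env R d) :=
  [set w | forall x : site d, (0 <= dotu x u)%R -> good (w x)].

Lemma good_env_S_0 : S_k u 0 good_env.
Proof.
pose G0 : set (set (env R d)) := [set A | exists (x y : site d) (B : set R),
        [/\ measurable B, 0%:~R <= dotu x u & A = [set w | B (w x y)]]]%R.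
rewrite -[S_k u 0]/(@measurable _ (g_sigma_algebraType G0)).
apply: (@measurable_forall _ (g_sigma_algebraType G0) (site d)
  (fun x => [set w : env R d | (0 <= dotu x u)%R -> good (w x)])) => x.
have [x0|x0] := boolP (0 <= dotu x u)%R; last first.
  by rewrite (_ : [set w | _] = setT)//; apply/seteqP; split.
rewrite (_ : [set w | _] = [set w : env R d | good (w x)]); last first.
  by apply/seteqP; split => w /=; [exact|].
apply: (@measurable_good _ (g_sigma_algebraType G0) (fun w => w x)) => z _ B mB.
rewrite setTI; apply: sub_sigma_algebra; exists x, z, B; split => //.
Qed.

Section almost_surely.
Context (P : probability (Env R d) R).
Hypothesis iidP : iid_product P.
Hypothesis P_probvec : P [set w : env R d | is_probvec (w 0%R)] = 1.
Hypothesis P_forward : P [set w : env R d |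
  \esum_(z in [set z : site d | (0 <= dotu z u)%R]) (pitr 0 z w)%:E = 1] = 1.
Hypothesis P_drift : P [set w : env R d |
  delta%:E <= ssum (fun z => (dotu z u * pitr 0 z w)%R)] = 1.
Hypothesis P_moment : P [set w : env R d |
  \esum_(z in [set: site d]) ((l1 z `^ p * pitr 0 z w)%R)%:E <= (M `^ p)%:E] = 1.

Let mpos (f : Env R d -> site d -> R) (D : set (site d)) :
  (forall z, measurable_fun setT (fun w : Env R d => f w z)) ->
  measurable_fun setT (fun w : Env R d => \esum_(z in D) (f w z)%:E).
Proof.
move=> mf; rewrite (_ : (fun w => _) =
   (fun w => \esum_(z in [set: site d]) (if z \in D then maxe (f w z)%:E 0 else 0))); last first.
  by apply/funext => w; rewrite esum_max0 esum_mkcond.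
apply: measurable_esum => [z w|z]; first by case: ifP => // _; rewrite le_max lexx orbT.
case: (z \in D) => //; apply: measurable_maxe => //; exact/measurable_EFinP.
Qed.

Lemma good_site0 : P [set w : env R d | good (w 0%R)] = 1.
Proof.
have mw z : measurable_fun setT (fun w : Env R d => w 0%R z) by exact: measurable_Env_coord.
have mpi z : measurable_fun setT (fun w : Env R d => pitr 0%R z w) by exact: measurable_Env_coord.
apply: probability1_ae; first exact: measurable_good.
have a1 : {ae P, forall w : Env R d, is_probvec (w 0%R : site d -> R)}.
  apply: ae_probability1 P_probvec.
  rewrite (_ : [set w | _] = [set w : Env R d | forall z : site d, (0 <= w 0 z)%R] `&`
     [set w : Env R d | \esum_(z in [set: site d]) (w 0%R z)%:E = 1]); last first.
    by apply/seteqP; split => w [].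
  apply: measurableI.
    apply: (@measurable_forall _ _ _ (fun z => [set w : Env R d | (0 <= w 0 z)%R])) => z.
    rewrite -[X in measurable X]setTI; exact: measurable_fun_le.
  rewrite -[X in measurable X]setTI; apply: measurable_eqe => //; exact: mpos.
have a2 := ae_probability1 P _ _ P_forward.
have a3 := ae_probability1 P _ _ P_drift.
have a4 := ae_probability1 P _ _ P_moment.
have {}a2 := a2 _.
have {a2 a3 a4} [a2 a3 a4] : [/\
  {ae P, forall w : Env R d, \esum_(z in [set z : site d | (0 <= dotu z u)%R]) (pitr 0 z w)%:E = 1},
  {ae P, forall w : Env R d, delta%:E <= ssum (fun z => (dotu z u * pitr 0 z w)%R)} &
  {ae P, forall w : Env R d,
    \esum_(z in [set: site d]) ((l1 z `^ p * pitr 0 z w)%R)%:E <= (M `^ p)%:E}].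
  split.
  - apply: a2; rewrite -[X in measurable X]setTI; apply: measurable_eqe => //; exact: mpos.
  - apply: a3; rewrite -[X in measurable X]setTI; apply: measurable_lee => //.
    apply: emeasurable_funB; apply: mpos => z.
      by apply: measurable_maxr => //; exact: measurable_funM.
    by apply: measurable_maxr => //; apply: measurable_funN; exact: measurable_funM.
  - apply: a4; rewrite -[X in measurable X]setTI; apply: measurable_lee => //.
    by apply: mpos => z; exact: measurable_funM.
have FP : Filter (nbhs (almost_everywhere P)) by exact: (@ae_filter_ringOfSetsType _ (Env R d) R P).
near=> w.
have E z : pitr 0%R z w = w 0%R z by rewrite /pitr subr0.
apply: raw_good.
- by near: w.
- by under eq_esum do rewrite -E; near: w.
- rewrite (_ : (fun z => _) = (fun z => (dotu z u * pitr 0 z w)%R)); first by near: w.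
  by apply/funext => z; rewrite E.
- by under eq_esum do rewrite -E; near: w.
Unshelve. all: by end_near. Qed.

Lemma good_sites : {ae P, forall w : Env R d, forall x : site d, good (w x)}.
Proof.
apply: ae_forall_countable => x.
apply: ae_probability1; first by apply: measurable_good => z; exact: measurable_Env_coord.
have := iidP [:: x] (fun=> [set q | good q]) isT _.
rewrite big_seq1 good_site0 => <-.
  by congr (P _); apply/seteqP; split => w /= => [gw y|]; [rewrite inE => /eqP ->|apply; rewrite inE].
move=> _; apply: (@measurable_good _ (pvec R d) id) => z; exact: measurable_pvec_coord.
Qed.

End almost_surely.
End good_environments.

(** * Moment and drift bounds at a good site *)

Section moments.
Context {R : realType} {d : nat} (u : 'rV[R]_d) (delta M p : R).
Hypotheses (delta0 : 0 < delta) (p1 : 1 < p).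
Implicit Types (q : site d -> R) (z : site d).

Let B : R := M `^ p.

Lemma l1_ge0 z : 0 <= l1 z :> R.
Proof. by apply: sumr_ge0 => i _. Qed.

Lemma coord_le_l1 z (i : 'I_d) : `|(z ord0 i)%:~R| <= l1 z :> R.
Proof. by rewrite /l1 (bigD1 i)//= lerDl sumr_ge0. Qed.

(** The norm of a lattice point is a natural number, hence 0 or at least 1. *)
Lemma l1_le_powR z : l1 z <= l1 z `^ p :> R.
Proof.
have [z0|z1] : l1 z = 0 :> R \/ 1 <= l1 z :> R.
  have -> : l1 z = (\sum_(i < d) `|z ord0 i|%N)%:R :> R.
    rewrite /l1 natr_sum; apply: eq_bigr => i _.
    by rewrite natr_absz intr_norm.
  case: (\sum_(i < d) `|z ord0 i|%N)%N => [|n]; [by left|by right; rewrite ler1n].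
- by rewrite z0 powR0// gt_eqF// (lt_trans ltr01).
- by apply: le1r_powR => //; exact: ltW.
Qed.

Definition unorm : R := \sum_(i < d) `|u ord0 i|.

Lemma dotu_le_l1 z : dotu z u <= unorm * l1 z.
Proof.
rewrite /dotu /unorm /l1 mulr_sumr; apply: ler_sum => i _.
rewrite (le_trans (ler_norm _))// normrM mulrC ler_wpM2r// (bigD1 i)//=.
by rewrite lerDl sumr_ge0.
Qed.

(** Where [a] exceeds [K], the excess is at most a <= a^p / K^(p-1). *)
Lemma tail_le (a b K : R) : 0 <= a <= b -> 0 < K ->
  0 <= a - Num.min a K <= b `^ p / K `^ (p - 1).
Proof.
move=> /andP[a0 ab] K0; have Kp : 0 < K `^ (p - 1) by exact: powR_gt0.
have [aK|Ka] := leP a K.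
  by rewrite subrr lexx divr_ge0// ?powR_ge0// ltW.
rewrite subr_ge0 (ltW Ka)/=; apply: (@le_trans _ _ a); first by rewrite gerBl ltW.
rewrite ler_pdivlMr//; apply: (@le_trans _ _ (a * a `^ (p - 1))).
  by rewrite ler_wpM2l// ge0_ler_powR ?nnegrE ?(ltW K0) ?(ltW Ka)// subr_ge0 ltW.
rewrite mulr_powRB1// ?(lt_trans ltr01)//.
by rewrite ge0_ler_powR ?nnegrE// ?(le_trans a0 ab)// ltW// (lt_trans ltr01).
Qed.

Local Open Scope ereal_scope.

Notation good := (good u delta M p).

Lemma good_le (f : site d -> R) (c : R) q : good q -> (0 <= c)%R ->
  (forall z, (0 <= dotu z u)%R -> (f z <= c * l1 z `^ p)%R) ->
  \esum_(z in [set: site d]) (f z * sprob u z q)%:E <= (c * B)%:E.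
Proof.
move=> [_ _ _ qB] c0 fc.
apply: (@le_trans _ _ (\esum_(z in [set: site d]) (c%:E * (l1 z `^ p * sprob u z q)%:E))).
  apply: le_esum => z _; rewrite -EFinM lee_fin mulrA.
  have [z0|z0] := boolP (0 <= dotu z u)%R.
    by rewrite ler_wpM2r ?sprob_ge0// fc.
  by rewrite /sprob (negbTE z0) !mulr0.
rewrite esumZl//; last by move=> z; rewrite lee_fin mulr_ge0// ?powR_ge0 ?sprob_ge0.
by rewrite EFinM; apply: lee_wpmul2l => //; rewrite lee_fin.
Qed.

Lemma good_mean (f : site d -> R) q : good q -> (forall z, (f z <= l1 z)%R) ->
  \esum_(z in [set: site d]) (f z * sprob u z q)%:E <= B%:E.
Proof.
move=> gq fl; rewrite -[B]mul1r; apply: good_le => // z _.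
by rewrite mul1r (le_trans (fl z))// l1_le_powR.
Qed.

Lemma good_tail (f : site d -> R) (K : R) q : good q -> (0 < K)%R ->
  (forall z, (0 <= f z <= l1 z)%R) ->
  \esum_(z in [set: site d]) ((f z - Num.min (f z) K) * sprob u z q)%:E
  <= (B / K `^ (p - 1))%:E.
Proof.
move=> gq K0 fl; rewrite mulrC; apply: good_le => // [|z _].
  by rewrite invr_ge0 powR_ge0.
by have /andP[_] := tail_le _ _ _ (fl z) K0; rewrite [X in (_ <= X)%R]mulrC.
Qed.

(** By the moment bound, truncation at a large height loses little drift, uniformly over good
    vectors. *)
Lemma good_drift : exists2 K : R, (0 < K)%R & forall q, good q ->
  (delta / 2)%:E <= \esum_(z in [set: site d]) (Num.min (dotu z u) K * sprob u z q)%:E.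
Proof.
pose c : R := (unorm `^ p * B)%R.
have c0 : (0 <= c)%R by rewrite mulr_ge0 ?powR_ge0.
have p10 : (0 < p - 1)%R by rewrite subr_gt0.
(* Thus K^(p-1) = 2 c / delta + 1, which makes the bound c / K^(p-1) on the lost drift at most delta
   / 2; the summand 1 keeps [K] positive even when [c] is 0. *)
pose K : R := ((2 * c / delta + 1) `^ (p - 1)^-1)%R.
have cd0 : (0 <= 2 * c / delta)%R by apply: divr_ge0; [exact: mulr_ge0|exact: ltW].
have b0 : (0 < 2 * c / delta + 1)%R by lra.
have K0 : (0 < K)%R by rewrite powR_gt0.
exists K => // q gq; have [_ _ qd qB] := gq.
have s0 z : (0 <= sprob u z q)%R by exact: sprob_ge0.
have min0 z : (0 <= Num.min (dotu z u) K * sprob u z q)%R.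
  have [z0|z0] := boolP (0 <= dotu z u)%R; last by rewrite /sprob (negbTE z0) mulr0.
  by rewrite mulr_ge0// le_min z0 ltW.
have tail0 z : (0 <= (dotu z u - Num.min (dotu z u) K) * sprob u z q)%R.
  by rewrite mulr_ge0// subr_ge0 ge_min lexx.
have tail : \esum_(z in [set: site d]) ((dotu z u - Num.min (dotu z u) K) * sprob u z q)%:E
    <= (delta / 2)%:E.
  apply: (@le_trans _ _ ((unorm `^ p / K `^ (p - 1)) * B)%:E).
    apply: good_le => // [|z z0]; first by rewrite divr_ge0 ?powR_ge0.
    have zl : (0 <= dotu z u <= unorm * l1 z)%R by rewrite z0 dotu_le_l1.
    have /andP[_] := tail_le _ _ _ zl K0.
    rewrite powRM ?l1_ge0//; last by apply: sumr_ge0.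
    by rewrite mulrAC.
  have -> : (K `^ (p - 1) = 2 * c / delta + 1)%R.
    by rewrite /K -powRrM mulVf ?gt_eqF// powRr1// ltW.
  rewrite lee_fin mulrAC -/c ler_pdivrMr// mulrDr mulr1.
  have -> : (delta / 2 * (2 * c / delta) = c)%R by field; rewrite gt_eqF.
  by rewrite lerDl divr_ge0// ltW.
have : delta%:E <= \esum_(z in [set: site d]) (Num.min (dotu z u) K * sprob u z q)%:E
    + (delta / 2)%:E.
  apply: (le_trans qd); apply: (@le_trans _ _
    (\esum_(z in [set: site d]) (Num.min (dotu z u) K * sprob u z q)%:E +
     \esum_(z in [set: site d]) ((dotu z u - Num.min (dotu z u) K) * sprob u z q)%:E)); last exact: leeD2l.
  rewrite -esumD => [|z _|z _]; rewrite ?lee_fin//.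
  by apply: le_esum => z _; rewrite -EFinD -mulrDl addrC subrK.
rewrite -leeBlDr// -EFinB; apply: le_trans; rewrite lee_fin; lra.
Qed.

End moments.

Lemma esum_pair {R : realType} {T1 T2 : choiceType} (f : T1 * T2 -> \bar R) :
  (forall t, 0 <= f t)%E ->
  (\esum_(t in [set: T1 * T2]) f t = \esum_(y in [set: T1]) \esum_(z in [set: T2]) f (y, z))%E.
Proof.
move=> f0; rewrite (@esum_esum _ _ _ _ (fun=> setT) (fun y z => f (y, z)))//.
rewrite (_ : setT `*`` _ = setT); last by apply/seteqP; split.
by apply: eq_esum => -[].
Qed.

Section discrete_maps.
Context {R : realType} {d0 : measure_display} {S : measurableType d0} {T : countType}.
Context (Y : S -> T).
Hypothesis mY : forall t, measurable (Y @^-1` [set t]).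

(** Sites and lists of steps are given no sigma-algebra; measurable fibres suffice for every
    function of a countable-valued map. *)
Lemma measurable_discrete d1 (U : measurableType d1) (Phi : T -> U) :
  measurable_fun setT (fun s => Phi (Y s)).
Proof.
move=> _ B mB; rewrite setTI.
rewrite (_ : _ @^-1` B = [set s | forall t, (~` (Y @^-1` [set t]) `|` [set _ | B (Phi t)]) s]).
  apply: (@measurable_forall _ _ T (fun t => ~` (Y @^-1` [set t]) `|` [set _ | B (Phi t)])) => t.
  apply: measurableU; first exact: measurableC.
  have [Bt|Bt] := pselect (B (Phi t)).
    by rewrite (_ : [set _ | _] = setT)//; apply/seteqP; split.
  by rewrite (_ : [set _ | _] = set0)//; apply/seteqP; split.
apply/seteqP; split => s /=; last by case/(_ (Y s)).
by move=> Bs t; have [<-|] := pselect (Y s = t); [right|left].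
Qed.

Lemma integral_discrete (mu : {measure set S -> \bar R}) (Phi : T -> R) :
  (forall t, 0 <= Phi t) ->
  (\int[mu]_s (Phi (Y s))%:E = \esum_(t in [set: T]) ((Phi t)%:E * mu (Y @^-1` [set t])))%E.
Proof.
move=> Phi0.
have mi t : measurable_fun setT (fun s => (\1_(Y @^-1` [set t]) s)%:E : \bar R).
  by apply/measurable_EFinP; exact: measurable_indic.
transitivity (\int[mu]_s (\esum_(t in [set: T]) ((Phi t)%:E * (\1_(Y @^-1` [set t]) s)%:E)))%E.
  apply: eq_integral => s _.
  rewrite (esumID [set Y s]); last by move=> t _; rewrite mule_ge0 ?lee_fin.
  rewrite setTI esum_set1 ?mule_ge0 ?lee_fin// indicE mem_set// mule1.
  rewrite esum1 ?adde0// => t [_ /= tY]; rewrite indicE memNset ?mule0//=.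
  by move=> Yt; apply: tY; rewrite -Yt.
rewrite integral_esum//.
- apply: eq_esum => t _; rewrite ge0_integralZl ?lee_fin//.
  by rewrite integral_indic// setIT.
- by move=> t s; rewrite mule_ge0 ?lee_fin.
- by move=> t; exact: emeasurable_funM.
Qed.

End discrete_maps.

(** * The annealed walk *)

Section annealed_paths.
Context {R : realType} {d : nat} (u : 'rV[R]_d) (delta M p : R).
Context (P : probability (Env R d) R).
Context {dS : measure_display} {S : measurableType dS} (Pr : probability S R).
Context (W : S -> Env R d) (X : nat -> S -> site d).
Hypothesis walkX : annealed_walk P Pr W X.
Hypothesis goodP : {ae P, forall w : Env R d, forall x : site d, good u delta M p (w x)}.

Definition step n s : site d := X n.+1 s - X n s.

Definition steps n s : seq (site d) := mkseq (step^~ s) n.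

Lemma size_steps n s : size (steps n s) = n.
Proof. exact: size_mkseq. Qed.

Lemma steps_rcons n s : steps n.+1 s = rcons (steps n s) (step n s).
Proof. by rewrite /steps /mkseq -addn1 iotaD map_cat /= cats1. Qed.

Lemma walk_steps n s : X n s = X 0%N s + disp (steps n s).
Proof.
elim: n => [|n IH]; first by rewrite /disp big_nil addr0.
by rewrite steps_rcons disp_rcons addrA -IH addrC subrK.
Qed.

Lemma measurable_walk n x : measurable (X n @^-1` [set x]).
Proof. by case: walkX. Qed.

Lemma measurable_step n z : measurable (step n @^-1` [set z]).
Proof.
(* A countable intersection of implications: if the walk is at [x], it moves to [x + z]. *)
rewrite (_ : _ @^-1` _ = [set s | forall x, (~` (X n @^-1` [set x]) `|` (X n.+1 @^-1` [set x + z])) s]).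
  apply: (@measurable_forall _ _ (site d)
    (fun x => ~` (X n @^-1` [set x]) `|` (X n.+1 @^-1` [set x + z]))) => x.
  by apply: measurableU; [apply: measurableC|]; exact: measurable_walk.
apply/seteqP; split => s /=; rewrite /step.
  by move=> <- x; have [<-|] := pselect (X n s = x); [right; rewrite addrC subrK|left].
by move=> /(_ (X n s))[//|->]; rewrite addrC addKr.
Qed.

Lemma measurable_seg k m (g : seq (site d)) :
  measurable ((fun s => mkseq (fun i => step (k + i)%N s) m) @^-1` [set g]).
Proof.
elim: m g => [|m IH] g.
  have [->|g0] := pselect (g = [::]).
    by rewrite (_ : _ @^-1` _ = setT)//; apply/seteqP; split.
  by rewrite (_ : _ @^-1` _ = set0)//; apply/seteqP; split => // s /= E; apply: g0.
rewrite (_ : _ @^-1` _ = [set s | forall z, (~` (step (k + m) @^-1` [set z]) `|`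
  [set s | rcons (mkseq (fun i => step (k + i)%N s) m) z = g]) s]).
  apply: (@measurable_forall _ _ (site d) (fun z => ~` (step (k + m) @^-1` [set z]) `|`
    [set s | rcons (mkseq (fun i => step (k + i)%N s) m) z = g])) => z.
  apply: measurableU; first by apply: measurableC; exact: measurable_step.
  have := @measurable_discrete _ _ _ _ IH _ bool (fun g' => rcons g' z == g) measurableT [set true] I.
  rewrite setTI (_ : _ @^-1` _ = [set s | rcons (mkseq (fun i => step (k + i)%N s) m) z = g])//.
  by apply/seteqP; split => s /=; [move=> /eqP|move=> /eqP].
have E s : mkseq (fun i => step (k + i)%N s) m.+1 =
    rcons (mkseq (fun i => step (k + i)%N s) m) (step (k + m) s).
  by rewrite /mkseq -addn1 iotaD map_cat /= cats1.
apply/seteqP; split => s /=; rewrite E.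
  by move=> <- z; have [<-|] := pselect (step (k + m) s = z); [right|left].
by move=> /(_ (step (k + m) s))[].
Qed.

Lemma measurable_steps n g : measurable (steps n @^-1` [set g]).
Proof. exact: (measurable_seg 0 n g). Qed.

Lemma walk_start : {ae Pr, forall s, X 0%N s = 0}.
Proof.
apply: ae_probability1; first exact: (measurable_walk 0%N 0).
have [_ _ /(_ setT 0%N (fun=> 0) measurableT)] := walkX.
under eq_integral do rewrite eqxx big_ord0 mulr1.
rewrite (@integral_cst _ (Env R d) R P setT measurableT 1%E) mul1e.
move=> E; apply: etrans (@probability_setT _ (Env R d) R P); rewrite -E; congr (Pr _).
apply/seteqP; split => s /= => [X0|[_ /(_ 0%N isT)//]].
by split => // i; rewrite leqn0 => /eqP ->.
Qed.

Let weight_pitr g x (w : env R d) : (forall y, good u delta M p (w y)) ->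
  \prod_(i < size g) pitr (x + disp (take i g)) (x + disp (take i.+1 g)) w
  = weight u g (Defs.shift x w).
Proof.
move=> gw; elim: g x => [|z g IH] x; first by rewrite big_ord0.
rewrite /= big_ord_recl /= env_shiftD -IH; congr (_ * _).
  have [gE _ _ _] := gw x.
  rewrite take0 /Defs.shift add0r /disp big_nil addr0 big_seq1 -gE /pitr.
  by rewrite [x + z - x]addrAC addrN add0r.
apply: eq_bigr => i _; rewrite /bump /= add1n.
by rewrite !disp_cons !addrA [x + z]addrC.
Qed.

(** [annealed_walk] prescribes positions together with the starting point. The start is almost
    surely 0, and on good environments [pitr] agrees with the clipped probabilities in the path
    weight. *)
Lemma steps_law g : Pr (steps (size g) @^-1` [set g]) = pathw u P g.
Proof.
have [mW _ law] := walkX.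
pose xs i := disp (take i g).
pose n := size g.
have mX0 : measurable (X 0%N @^-1` [set 0]) by exact: measurable_walk.
have cyl : steps n @^-1` [set g] `&` X 0%N @^-1` [set 0] =
    W @^-1` setT `&` [set s | forall i, (i <= n)%N -> X i s = xs i].
  apply/seteqP; split => s /=.
    move=> [sg X0]; split => // i iN.
    rewrite walk_steps X0 add0r /xs -sg; congr disp.
    apply: (@eq_from_nth _ 0); rewrite size_steps ?size_takel// ?size_steps// => j ji.
    by rewrite nth_take// !nth_mkseq// (leq_trans ji).
  move=> [_ H]; have X0 : X 0%N s = 0 by rewrite H// /xs take0 /disp big_nil.
  split => //; apply: (@eq_from_nth _ 0); rewrite size_steps// => i ig.
  rewrite nth_mkseq// /step !H//; last exact: ltnW.
  by rewrite /xs (take_nth 0)// disp_rcons addrAC addrN add0r.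
have -> : Pr (steps n @^-1` [set g]) = Pr (steps n @^-1` [set g] `&` X 0%N @^-1` [set 0]).
  have mg : measurable (steps n @^-1` [set g]) by exact: measurable_steps.
  rewrite [LHS](@measureDI _ _ _ Pr _ _ mg mX0) [X in (X + _)%E](_ : _ = 0%E) ?add0e//.
  have [N [mN N0 XN]] := walk_start.
  apply: (subset_measure0 _ mN _ N0); first exact: measurableD.
  by apply: subset_trans XN => s [].
rewrite cyl law// /pathw; apply: ae_eq_integral => //.
- apply/measurable_EFinP; apply: measurable_funM => //.
  by apply: measurable_prod => i _; exact: measurable_Env_coord.
- by apply/measurable_EFinP; apply: measurable_weight => x z _; exact: measurable_Env_coord.
have FP : Filter (nbhs (almost_everywhere P)) by exact: (@ae_filter_ringOfSetsType _ (Env R d) R P).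
apply: filterS goodP => w gw _; congr (_%:E).
rewrite /xs take0 /disp big_nil eqxx mul1r -(env_shift0 w) -(weight_pitr g 0 w gw) env_shift0.
by apply: eq_bigr => i _; rewrite !add0r.
Qed.

End annealed_paths.

(** * The Markov property and independence after a fresh path *)

Section markov.
Context {R : realType} {d : nat} (u : 'rV[R]_d) (delta M p : R).
Context (P : probability (Env R d) R).
Context {dS : measure_display} {S : measurableType dS} (Pr : probability S R).
Context (W : S -> Env R d) (X : nat -> S -> site d).
Hypothesis iidP : iid_product P.
Hypothesis walkX : annealed_walk P Pr W X.
Hypothesis goodP : {ae P, forall w : Env R d, forall x : site d, good u delta M p (w x)}.
Local Open Scope ereal_scope.

Notation xi := (step X).
Notation steps := (steps X).
Notation q := (pathw u P).

Definition seg k m s : seq (site d) := mkseq (fun i => xi (k + i)%N s) m.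

Lemma steps_cat k m s : steps (k + m) s = steps k s ++ seg k m s.
Proof.
rewrite /steps /seg /mkseq iotaD map_cat add0n; congr (_ ++ _).
by rewrite -[k in iota k]addn0 iotaDl -map_comp.
Qed.

Let Ystep n s := (steps n s, xi n s).

Let mYstep n y : measurable (Ystep n @^-1` [set y]).
Proof.
rewrite (_ : _ @^-1` _ = steps n @^-1` [set y.1] `&` xi n @^-1` [set y.2]).
  by apply: measurableI; [exact: measurable_steps walkX _ _|exact: measurable_step walkX _ _].
by case: y => g z; apply/seteqP; rewrite /Ystep; split => s /= [] -> ->.
Qed.

Let lawYstep n g z : Pr (Ystep n @^-1` [set (g, z)]) = if size g == n then q (rcons g z) else 0.
Proof.
case: eqP => gn; last first.
  rewrite (_ : _ @^-1` _ = set0) ?measure0//; apply/seteqP; split => // s [sg _]; apply: gn.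
  by rewrite -sg size_steps.
rewrite -(steps_law u delta M p P Pr W X walkX goodP (rcons g z)) size_rcons gn; congr (Pr _).
apply/seteqP; split => s; rewrite /Ystep /= steps_rcons; first by case=> -> ->.
by move=> /rcons_inj[-> ->].
Qed.

Let law n g : Pr (steps n @^-1` [set g]) = if size g == n then q g else 0.
Proof.
case: eqP => [<-|gn]; first exact: steps_law walkX goodP _.
rewrite (_ : _ @^-1` _ = set0) ?measure0//; apply/seteqP; split => // s sg; apply: gn.
by rewrite -sg size_steps.
Qed.

(** Markov property in summed form: [y] runs over the possible first [n] increments, and the inner
    sum is the quenched mean of [phi] at the site [disp y] reached by them. *)
Let expand_step n (g : seq (site d) -> R) (phi : site d -> R) :
  (forall y, (0 <= g y)%R) -> (forall z, (0 <= phi z)%R) ->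
  \int[Pr]_s (g (steps n s) * phi (xi n s))%:E =
  \esum_(y in [set: seq (site d)]) ((if size y == n then (g y)%:E else 0) *
    \int[P]_w ((weight u y w)%:E * \esum_(z in [set: site d]) (phi z * sprob u z (w (disp y)))%:E)).
Proof.
move=> g0 phi0.
have := integral_discrete (Ystep n) (mYstep n) Pr (fun y => g y.1 * phi y.2)%R.
rewrite /= => ->; last by move=> y; rewrite mulr_ge0.
rewrite esum_pair; last by move=> y; rewrite mule_ge0 ?lee_fin ?mulr_ge0.
have mw y : measurable_fun setT (fun w : Env R d => weight u y w).
  by apply: measurable_weight => x z _; exact: measurable_Env_coord.
have ms x z : measurable_fun setT (fun w : Env R d => sprob u z (w x)).
  by apply: measurable_sprob; exact: measurable_Env_coord.
apply: eq_esum => y _.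
case: ifP => yn; last first.
  by rewrite mul0e esum1// => z _; rewrite lawYstep yn mule0.
under eq_esum do rewrite lawYstep yn EFinM -muleA /=.
rewrite esumZl//; last by move=> z; rewrite mule_ge0 ?lee_fin// pathw_ge0.
congr (_ * _).
transitivity (\esum_(z in [set: site d]) \int[P]_w
    ((weight u y w)%:E * (phi z * sprob u z (w (disp y)))%:E)).
  apply: eq_esum => z _; rewrite /pathw -ge0_integralZl//; last 3 first.
  - by apply/measurable_EFinP; exact: mw.
  - by move=> w _; rewrite lee_fin weight_ge0.
  - by rewrite lee_fin.
  apply: eq_integral => w _; rewrite -!EFinM -cats1 weight_cat /= mulr1 /Defs.shift add0r.
  by congr (_%:E); ring.
rewrite -integral_esum//.
- apply: eq_integral => w _; rewrite esumZl ?weight_ge0// => z.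
  by rewrite lee_fin mulr_ge0 ?sprob_ge0.
- by move=> z w; rewrite mule_ge0// lee_fin ?weight_ge0// mulr_ge0 ?sprob_ge0.
- move=> z; apply/measurable_EFinP; apply: measurable_funM => //.
  exact: measurable_funM.
Qed.

Let expand n (g : seq (site d) -> R) : (forall y, (0 <= g y)%R) ->
  \int[Pr]_s (g (steps n s))%:E =
  \esum_(y in [set: seq (site d)]) ((if size y == n then (g y)%:E else 0) * q y).
Proof.
move=> g0; rewrite (integral_discrete (steps n) (measurable_steps _ _ _ _ walkX n) Pr g)//.
apply: eq_esum => y _; apply: (@etrans _ _ ((g y)%:E * (if size y == n then q y else 0))).
  by congr (_ * _); exact: law.
by case: ifP; rewrite ?mule0 ?mul0e.
Qed.

Let mmean y (phi : site d -> R) : (forall z, (0 <= phi z)%R) -> measurable_fun setT (fun w : Env R d =>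
  (weight u y w)%:E * \esum_(z in [set: site d]) (phi z * sprob u z (w (disp y)))%:E).
Proof.
move=> phi0; apply: emeasurable_funM.
  by apply/measurable_EFinP; apply: measurable_weight => x z _; exact: measurable_Env_coord.
apply: measurable_esum => [z w|z]; first by rewrite lee_fin mulr_ge0 ?sprob_ge0.
apply/measurable_EFinP; apply: measurable_funM => //.
by apply: measurable_sprob; exact: measurable_Env_coord.
Qed.

(** The inner sum in [expand_step] is at most [c] at every good site, whatever the past; the past
    stays as a weight. *)
Lemma step_mean_le n (g : seq (site d) -> R) (phi : site d -> R) (c : R) :
  (forall y, (0 <= g y)%R) -> (forall z, (0 <= phi z)%R) -> (0 <= c)%R ->
  (forall r, good u delta M p r ->
    \esum_(z in [set: site d]) (phi z * sprob u z r)%:E <= c%:E) ->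
  \int[Pr]_s (g (steps n s) * phi (xi n s))%:E <= c%:E * \int[Pr]_s (g (steps n s))%:E.
Proof.
move=> g0 phi0 c0 phic; rewrite expand_step// expand//.
rewrite -esumZl//; last by move=> y; rewrite mule_ge0 ?pathw_ge0//; case: ifP => // _; rewrite lee_fin.
apply: le_esum => y _; rewrite muleCA; apply: lee_wpmul2l; first by case: ifP => // _; rewrite lee_fin.
rewrite /pathw -ge0_integralZl//; last 2 first.
- by apply/measurable_EFinP; apply: measurable_weight => x z _; exact: measurable_Env_coord.
- by move=> w _; rewrite lee_fin weight_ge0.
apply: ae_ge0_le_integral => //.
- move=> w _; rewrite mule_ge0 ?lee_fin ?weight_ge0//; apply: esum_ge0 => z _.
  by rewrite lee_fin mulr_ge0 ?sprob_ge0.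
- exact: mmean.
- by move=> w _; rewrite mule_ge0 ?lee_fin ?weight_ge0.
- apply: emeasurable_funM => //; apply/measurable_EFinP.
  by apply: measurable_weight => x z _; exact: measurable_Env_coord.
apply: filterS goodP => w gw _; rewrite [leRHS]muleC.
by apply: lee_wpmul2l; rewrite ?lee_fin ?weight_ge0//; exact: phic.
Qed.

Lemma step_mean_ge n (g : seq (site d) -> R) (phi : site d -> R) (c : R) :
  (forall y, (0 <= g y)%R) -> (forall z, (0 <= phi z)%R) -> (0 <= c)%R ->
  (forall r, good u delta M p r ->
    c%:E <= \esum_(z in [set: site d]) (phi z * sprob u z r)%:E) ->
  c%:E * \int[Pr]_s (g (steps n s))%:E <= \int[Pr]_s (g (steps n s) * phi (xi n s))%:E.
Proof.
move=> g0 phi0 c0 phic; rewrite expand_step// expand//.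
rewrite -esumZl//; last by move=> y; rewrite mule_ge0 ?pathw_ge0//; case: ifP => // _; rewrite lee_fin.
apply: le_esum => y _; rewrite muleCA; apply: lee_wpmul2l; first by case: ifP => // _; rewrite lee_fin.
rewrite /pathw -ge0_integralZl//; last 2 first.
- by apply/measurable_EFinP; apply: measurable_weight => x z _; exact: measurable_Env_coord.
- by move=> w _; rewrite lee_fin weight_ge0.
apply: ae_ge0_le_integral => //.
- by move=> w _; rewrite mule_ge0 ?lee_fin ?weight_ge0.
- apply: emeasurable_funM => //; apply/measurable_EFinP.
  by apply: measurable_weight => x z _; exact: measurable_Env_coord.
- move=> w _; rewrite mule_ge0 ?lee_fin ?weight_ge0//; apply: esum_ge0 => z _.
  by rewrite lee_fin mulr_ge0 ?sprob_ge0.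
- exact: mmean.
apply: filterS goodP => w gw _; rewrite [leLHS]muleC.
by apply: lee_wpmul2l; rewrite ?lee_fin ?weight_ge0//; exact: phic.
Qed.

Let Yseg k m s := (steps k s, seg k m s).

Let mYseg k m y : measurable (Yseg k m @^-1` [set y]).
Proof.
rewrite (_ : _ @^-1` _ = steps k @^-1` [set y.1] `&` seg k m @^-1` [set y.2]).
  by apply: measurableI; [exact: measurable_steps walkX _ _|exact: measurable_seg walkX _ _ _].
by case: y => g z; apply/seteqP; rewrite /Yseg; split => s /= [] -> ->.
Qed.

Let lawYseg k m g h : fresh u g -> Pr (Yseg k m @^-1` [set (g, h)]) =
  Pr (steps k @^-1` [set g]) * Pr (steps m @^-1` [set h]).
Proof.
move=> fg; rewrite !law; case: eqP => gk; last first.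
  rewrite mul0e (_ : _ @^-1` _ = set0) ?measure0//; apply/seteqP; split => // s [sg _].
  by apply: gk; rewrite -sg size_steps.
case: eqP => hm; last first.
  rewrite mule0 (_ : _ @^-1` _ = set0) ?measure0//; apply/seteqP; split => // s [_ sh].
  by apply: hm; rewrite -sh size_mkseq.
rewrite -pathw_cat// -(steps_law u delta M p P Pr W X walkX goodP (g ++ h)) size_cat gk hm.
congr (Pr _); apply/seteqP; split => s; rewrite /Yseg /= steps_cat; first by case=> -> ->.
move=> /eqP; rewrite eqseq_cat ?size_steps// => /andP[/eqP -> /eqP ->] //.
Qed.

(** Summing [pathw_cat] over pairs of lists turns the factorisation of path weights into
    independence: after a fresh path, the next [m] increments are independent of it and distributed
    as the first [m]. *)
Lemma regeneration k m (g h : seq (site d) -> R) :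
  (forall y, (0 <= g y)%R) -> (forall y, (0 <= h y)%R) ->
  (forall y, g y != 0%R -> fresh u y) ->
  \int[Pr]_s (h (steps m s))%:E \is a fin_num ->
  \int[Pr]_s (g (steps k s) * h (seg k m s))%:E =
  \int[Pr]_s (g (steps k s))%:E * \int[Pr]_s (h (steps m s))%:E.
Proof.
move=> g0 h0 gfresh hfin.
have := integral_discrete (Yseg k m) (mYseg k m) Pr (fun y => g y.1 * h y.2)%R.
rewrite /= => ->; last by move=> y; rewrite mulr_ge0.
rewrite esum_pair; last by move=> y; rewrite mule_ge0 ?lee_fin ?mulr_ge0.
have mst n y : measurable (steps n @^-1` [set y]) by exact: measurable_steps walkX _ _.
have hE : \int[Pr]_s (h (steps m s))%:E =
    \esum_(z in [set: seq (site d)]) ((h z)%:E * Pr (steps m @^-1` [set z])).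
  by rewrite (integral_discrete (steps m) (mst m) Pr h).
transitivity (\esum_(y in [set: seq (site d)]) (\int[Pr]_s (h (steps m s))%:E *
    ((g y)%:E * Pr (steps k @^-1` [set y])))).
  apply: eq_esum => y _; have [gy0|gy0] := eqVneq (g y) 0%R.
    by rewrite gy0 mul0e mule0 esum1// => z _; rewrite mul0r mul0e.
  have fin_k : Pr (steps k @^-1` [set y]) \is a fin_num by rewrite fin_num_measure.
  rewrite [RHS]muleC hE -(fineK fin_k) -EFinM -esumZl//; last 2 first.
  - by rewrite mulr_ge0// fine_ge0.
  - by move=> z; rewrite mule_ge0 ?lee_fin.
  apply: eq_esum => z _; rewrite lawYseg; last exact: gfresh.
  by rewrite -{1}(fineK fin_k) !EFinM muleACA.
(* Finiteness makes the mean of [h] a real factor, which can be taken out of the countable sum. *)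
rewrite -(fineK hfin) esumZl//; last 2 first.
- by rewrite fine_ge0// integral_ge0// => s _; rewrite lee_fin.
- by move=> y; rewrite mule_ge0 ?lee_fin.
by rewrite muleC (integral_discrete (steps k) (mst k) Pr g).
Qed.

End markov.

(** * Real expectations and criteria for almost sure convergence *)

Section expectation.
Context {R : realType} {d0 : measure_display} {S : measurableType d0} (Pr : probability S R).
Implicit Types F G : S -> R.

Definition itg F : Prop := Pr.-integrable setT (EFin \o F).

Definition mean F : R := \int[Pr]_s F s.

Lemma meanE F : itg F -> (\int[Pr]_s (F s)%:E = (mean F)%:E)%E.
Proof. by move=> iF; rewrite /mean /Rintegral fineK//; exact: integrable_fin_num. Qed.

Lemma itg_measurable F : itg F -> measurable_fun setT F.
Proof. by move=> /measurable_int /measurable_EFinP. Qed.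

Lemma itg_le F G : measurable_fun setT F -> (forall s, `|F s| <= G s) -> itg G -> itg F.
Proof.
move=> mF FG iG; apply: le_integrable iG => //; first exact/measurable_EFinP.
by move=> s _ /=; rewrite lee_fin (le_trans (FG s))// ler_norm.
Qed.

Lemma itg_cst c : itg (cst c).
Proof. by apply: finite_measure_integrable_cst. Qed.

Lemma itg_bounded F c : measurable_fun setT F -> (forall s, `|F s| <= c) -> itg F.
Proof. by move=> mF Fc; apply: itg_le (itg_cst c). Qed.

Lemma itgD F G : itg F -> itg G -> itg (fun s => F s + G s).
Proof. by move=> iF iG; apply: eq_integrable (integrableD _ iF iG). Qed.

Lemma itgZ c F : itg F -> itg (fun s => c * F s).
Proof. by move=> iF; apply: eq_integrable (integrableZl _ c iF). Qed.

Lemma itgN F : itg F -> itg (fun s => - F s).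
Proof. by move=> /(itgZ (-1)); under eq_fun do rewrite mulN1r. Qed.

Lemma itgB F G : itg F -> itg G -> itg (fun s => F s - G s).
Proof. by move=> iF iG; apply: itgD => //; exact: itgN. Qed.

Lemma itg_sum I (r : seq I) (F : I -> S -> R) : (forall i, itg (F i)) ->
  itg (fun s => \sum_(i <- r) F i s).
Proof.
move=> iF; elim: r => [|i r IH].
  by under eq_fun do rewrite big_nil; exact: itg_cst.
by under eq_fun do rewrite big_cons; apply: itgD.
Qed.

Lemma itgM F G c : measurable_fun setT F -> (forall s, `|F s| <= c) -> itg G ->
  itg (fun s => F s * G s).
Proof.
move=> mF Fc iG.
apply: (itg_le _ (fun s => c * `|G s|)).
- by apply: measurable_funM => //; exact: itg_measurable.
- by move=> s; rewrite normrM ler_wpM2r.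
- apply: itgZ; have := integrable_abse iG.
  by apply: eq_integrable => // s _.
Qed.

Lemma itg_abs F : itg F -> itg (fun s => `|F s|).
Proof. by move=> iF; have := integrable_abse iF; apply: eq_integrable => // s _. Qed.

Lemma eq_mean F G : (forall s, F s = G s) -> mean F = mean G.
Proof. by move=> FG; congr mean; exact/funext. Qed.

Lemma mean_cst c : mean (cst c) = c.
Proof. by rewrite /mean Rintegral_cst//= probability_setT mulr1. Qed.

Lemma meanD F G : itg F -> itg G -> mean (fun s => F s + G s) = mean F + mean G.
Proof. by move=> iF iG; exact: RintegralD. Qed.

Lemma meanZ c F : itg F -> mean (fun s => c * F s) = c * mean F.
Proof. by move=> iF; exact: RintegralZl. Qed.

Lemma meanB F G : itg F -> itg G -> mean (fun s => F s - G s) = mean F - mean G.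
Proof. by move=> iF iG; exact: RintegralB. Qed.

Lemma mean_sum I (r : seq I) (F : I -> S -> R) : (forall i, itg (F i)) ->
  mean (fun s => \sum_(i <- r) F i s) = \sum_(i <- r) mean (F i).
Proof.
move=> iF; elim: r => [|i r IH].
  by under eq_fun do rewrite big_nil; rewrite big_nil; exact: mean_cst.
by under eq_fun do rewrite big_cons; rewrite big_cons meanD ?IH//; exact: itg_sum.
Qed.

Lemma mean_ge0 F : (forall s, 0 <= F s) -> 0 <= mean F.
Proof. by move=> F0; exact: Rintegral_ge0. Qed.

Lemma mean_ae_le F G : itg F -> itg G -> {ae Pr, forall s, F s <= G s} -> mean F <= mean G.
Proof.
move=> iF iG FG.
have mG := itg_measurable _ iG; have mF := itg_measurable _ iF.
rewrite -subr_ge0 -meanB// /mean /Rintegral.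
rewrite (@ae_eq_integral _ _ _ Pr setT (fun s => (Num.max (G s - F s) 0)%:E))//.
- by apply/fine_ge0/integral_ge0 => s _; rewrite lee_fin le_max lexx orbT.
- by apply/measurable_EFinP; exact: measurable_funB.
- by apply/measurable_EFinP; apply: measurable_maxr => //; exact: measurable_funB.
- by apply: filterS FG => s FG _; rewrite (max_idPl _)// subr_ge0.
Qed.

Lemma mean_le F G : itg F -> itg G -> (forall s, F s <= G s) -> mean F <= mean G.
Proof. by move=> iF iG FG; apply: mean_ae_le => //; exact: aeW. Qed.

Lemma mean_ae_eq F G : itg F -> itg G -> {ae Pr, forall s, F s = G s} -> mean F = mean G.
Proof.
by move=> iF iG FG; apply/eqP; rewrite eq_le; apply/andP; split; apply: mean_ae_le => //;
  apply: filterS FG => s ->.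
Qed.

Lemma mean_abs_le F : itg F -> `|mean F| <= mean (fun s => `|F s|).
Proof. by move=> iF; exact: le_normr_Rintegral. Qed.

Lemma mean_norm_sqr F (c : R) : itg F -> itg (fun s => F s ^+ 2) -> 0 < c ->
  mean (fun s => `|F s|) <= c + mean (fun s => F s ^+ 2) / c.
Proof.
move=> iF iF2 c0; rewrite -[X in X + _]mean_cst mulrC -meanZ// -meanD//; last 2 first.
- exact: itg_cst.
- exact: itgZ.
apply: mean_le; [exact: itg_abs|apply: itgD; [exact: itg_cst|exact: itgZ]|move=> s /=].
(* AM-GM: [2 * c * `|F s| <= c ^+ 2 + F s ^+ 2] *)
rewrite -(ler_pM2l c0) mulrDr mulrA mulfV ?gt_eqF// mul1r -[F s ^+ 2]real_normK ?num_real//.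
nra.
Qed.

End expectation.

(** The sum of all the [F k] has a finite integral, so it is finite almost everywhere, and its terms
    tend to 0. *)
Lemma ae_cvg0 {R : realType} {d0 : measure_display} {Y : measurableType d0}
    (mu : {measure set Y -> \bar R}) (F : nat -> Y -> R) (c : nat -> R) (B : R) :
  (forall k, measurable_fun setT (F k)) -> (forall k y, 0 <= F k y) ->
  (forall k, (\int[mu]_y (F k y)%:E <= (c k)%:E)%E) ->
  (forall n, \sum_(k < n) c k <= B) ->
  {ae mu, forall y, F k y @[k --> \oo] --> 0}.
Proof.
move=> mF F0 Fc cB.
have F0' k y : (0 <= (F k y)%:E)%E by rewrite lee_fin.
have mF' k : measurable_fun setT (EFin \o F k) by exact/measurable_EFinP.
have s0 y : (0 <= \sum_(k <oo) (F k y)%:E)%E by apply: nneseries_ge0.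
have ms : measurable_fun setT (fun y => \sum_(k <oo) (F k y)%:E)%E.
  by apply: (@ge0_emeasurable_sum _ _ _ setT (fun k y => (F k y)%:E) xpredT) => // k _; exact: mF'.
have is_int : mu.-integrable setT (fun y => \sum_(k <oo) (F k y)%:E)%E.
  apply/integrableP; split => //.
  under eq_integral do rewrite gee0_abs//.
  rewrite integral_nneseries//.
  apply: (@le_lt_trans _ _ B%:E); last by rewrite ltry.
  apply: lime_le; first by apply: is_cvg_nneseries => k _ _; exact: integral_ge0.
  apply: nearW => n; apply: (@le_trans _ _ (\sum_(0 <= k < n) (c k)%:E)%E).
    by apply: lee_sum => k _; exact: Fc.
  by rewrite sumEFin lee_fin big_mkord.
have := integrable_ae measurableT is_int.
apply: filterS => y /(_ Logic.I) fin.
apply: cvg_series_cvg_0; apply: nondecreasing_is_cvgn.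
  by apply/nondecreasing_seqP => n; rewrite /series/= big_nat_recr//= lerDl.
exists (fine (\sum_(k <oo) (F k y)%:E)%E) => _ [n _ <-].
rewrite -lee_fin fineK// /series/= -sumEFin.
by apply: nneseries_lim_ge => k _.
Qed.

Lemma sum_inv_sq {R : realType} n : \sum_(k < n) (k.+1%:R ^+ 2)^-1 <= 2 :> R.
Proof.
case: n => [|n]; first by rewrite big_ord0.
(* Strengthened for the induction: 1 / (a + 1)^2 is at most 1 / a - 1 / (a + 1). *)
suff : \sum_(k < n.+1) (k.+1%:R ^+ 2)^-1 <= 2 - n.+1%:R^-1 :> R.
  by move/le_trans; apply; rewrite gerBl.
elim: n => [|n IH]; first by rewrite big_ord1 expr1n invr1; lra.
rewrite big_ord_recr/= (le_trans (lerD IH (lexx _)))//.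
have a0 : 0 < n.+1%:R :> R by rewrite ltr0n.
have -> : n.+2%:R = n.+1%:R + 1 :> R by rewrite natr1.
move: a0; set a := n.+1%:R => a0.
suff : (a + 1) ^- 2 <= a^-1 - (a + 1)^-1 by move: ((a + 1) ^- 2) (a^-1) ((a + 1)^-1) => x y z; lra.
have -> : a^-1 - (a + 1)^-1 = (a * (a + 1))^-1.
  by field; rewrite !gt_eqF// addr_gt0.
rewrite lef_pV2 ?posrE ?exprn_gt0 ?mulr_gt0 ?addr_gt0// expr2 ler_wpM2r ?lerDl//.
by rewrite addr_ge0 ?ltW.
Qed.

Lemma bracket (nu : nat -> nat) (n k0 : nat) : (forall k, nu k < nu k.+1)%N -> (nu k0 <= n)%N ->
  exists2 k, (k0 <= k)%N & (nu k <= n < nu k.+1)%N.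
Proof.
move=> incr; elim: n => [|n IH] nk0.
  by exists k0 => //; rewrite nk0 (leq_trans _ (incr k0)).
move: nk0; rewrite leq_eqVlt => /orP[/eqP nk|]; first by exists k0; rewrite // nk leqnn -nk incr.
rewrite ltnS => /IH[k k0k /andP[a b]].
have [c|c] := leqP (nu k.+1) n.+1.
  exists k.+1; first exact: leq_trans k0k _.
  by rewrite c (leq_trans _ (incr k.+1))// ltnS.
by exists k => //; rewrite c leqW.
Qed.

(* A monotone sequence is controlled between consecutive times of a subsequence
   whose successive ratios tend to 1. *)
Lemma cvg_ratio_subseq {R : realType} (A : nat -> R) (v : R) (m : nat) :
  (0 < m)%N -> (forall n, 0 <= A n) -> nondecreasing_seq A -> 0 <= v ->
  A (k.+1 ^ m)%N / (k.+1 ^ m)%N%:R @[k --> \oo] --> v ->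
  A n / n%:R @[n --> \oo] --> v.
Proof.
move=> m0 A0 ndA v0 Av.
pose nu k := (k.+1 ^ m)%N.
have nu0 k : 0 < (nu k)%:R :> R by rewrite ltr0n expn_gt0.
have ratio : (nu k.+1)%:R / (nu k)%:R @[k --> \oo] --> (1 : R).
  rewrite (_ : (fun k => _) = (fun k => (1 + harmonic k) ^+ m)); last first.
    apply/funext => k; rewrite /nu !natrX -exprVn -exprMn /harmonic/=; congr (_ ^+ _).
    by rewrite -[k.+2%:R]natr1 mulrDl divff// mul1r.
  have H1 : 1 + harmonic k @[k --> \oo] --> (1 + 0 : R).
    by apply: cvgD; [exact: cvg_cst|exact: cvg_harmonic].
  have := cvg_comp _ _ H1 (@exprn_continuous R m (1 + 0)).
  by rewrite addr0 expr1n.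
apply/cvgrPdist_le => e e0.
(* Both errors fit in [e]: (v + e') (1 + e') <= v + e' (v + 2) because e' <= 1, and v (1 - e') - e'
   = v - e' (v + 1). *)
pose e' := Num.min 1 (e / (v + 2)).
have v2 : 0 < v + 2 by lra.
have e'0 : 0 < e' by rewrite lt_min ltr01 divr_gt0.
have e'1 : e' <= 1 by rewrite /e' ge_min lexx.
have e'e : e' * (v + 2) <= e by rewrite -ler_pdivlMr// /e' ge_min lexx orbT.
have [k1 _ H1] : \forall k \near \oo, `|v - A (nu k) / (nu k)%:R| <= e'.
  by move/cvgrPdist_le : Av; apply.
have [k2 _ H2] : \forall k \near \oo, `|1 - (nu k.+1)%:R / (nu k)%:R| <= e' :> R.
  by move/cvgrPdist_le : ratio; apply.
pose k0 := maxn k1 k2.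
exists (nu k0) => // n /= nk0.
have nu_incr k : (nu k < nu k.+1)%N by rewrite ltn_exp2r.
have [k k0k /andP[kn nk]] := bracket nu n k0 nu_incr nk0.
have a1 : `|v - A (nu k) / (nu k)%:R| <= e' by apply: H1 => /=; rewrite (leq_trans _ k0k)// leq_maxl.
have a2 : `|v - A (nu k.+1) / (nu k.+1)%:R| <= e'.
  by apply: H1 => /=; rewrite (leq_trans _ (leqW k0k))// leq_maxl.
have a3 : `|1 - (nu k.+1)%:R / (nu k)%:R| <= e' :> R.
  by apply: H2 => /=; rewrite (leq_trans _ k0k)// leq_maxr.
have n0 : 0 < n%:R :> R by rewrite ltr0n (leq_trans _ kn)// expn_gt0.
have b1 : (v - e') * (nu k)%:R <= A n.
  apply: (@le_trans _ _ (A (nu k))); last exact: ndA.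
  by rewrite -ler_pdivlMr//; move: a1; rewrite ler_norml => /andP[? ?]; lra.
have b2 : A n <= (v + e') * (nu k.+1)%:R.
  apply: (@le_trans _ _ (A (nu k.+1))); first by apply: ndA; exact: ltnW.
  by rewrite -ler_pdivrMr//; move: a2; rewrite ler_norml => /andP[? ?]; lra.
have b3 : (nu k.+1)%:R <= (1 + e') * (nu k)%:R :> R.
  by rewrite -ler_pdivrMr//; move: a3; rewrite ler_norml => /andP[? ?]; lra.
have c1 : (nu k)%:R <= n%:R :> R by rewrite ler_nat.
have c2 : n%:R <= (nu k.+1)%:R :> R by rewrite ler_nat ltnW.
have ve : 0 <= v + e' by lra.
have up : A n <= (v + e') * (1 + e') * n%:R.
  apply: (le_trans b2); rewrite -mulrA ler_wpM2l// (le_trans b3)// ler_wpM2l//; lra.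
have lo : (v * (1 - e') - e') * n%:R <= A n.
  apply: le_trans b1; rewrite !mulrBl.
  have d1 : e' * (nu k)%:R <= e' * n%:R by rewrite ler_wpM2l// ltW.
  (* From n <= (1 + e') nu(k), since (1 - e') (1 + e') <= 1. *)
  have d2 : (1 - e') * n%:R <= (nu k)%:R.
    apply: (@le_trans _ _ ((1 - e') * ((1 + e') * (nu k)%:R))).
      by rewrite ler_wpM2l ?subr_ge0// (le_trans c2).
    rewrite mulrA -[leRHS]mul1r ler_wpM2r ?ltW//; nra.
  have d3 : v * ((1 - e') * n%:R) <= v * (nu k)%:R by rewrite ler_wpM2l.
  rewrite mulrA in d3; lra.
rewrite ler_norml; apply/andP; split.
  rewrite lerBrDl -lerBrDr; apply: (@le_trans _ _ ((v + e') * (1 + e'))); last by nra.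
  by rewrite ler_pdivrMr.
rewrite lerBlDl -lerBlDr; apply: (@le_trans _ _ (v * (1 - e') - e')); first by nra.
by rewrite ler_pdivlMr.
Qed.

(** * Renewal at the passage time *)

Section renewal.
Context {R : realType} {d : nat} (u : 'rV[R]_d) (delta M p : R).
Hypotheses (delta0 : 0 < delta) (p1 : 1 < p).
Context (P : probability (Env R d) R).
Context {dS : measure_display} {S : measurableType dS} (Pr : probability S R).
Context (W : S -> Env R d) (X : nat -> S -> site d).
Hypothesis iidP : iid_product P.
Hypothesis walkX : annealed_walk P Pr W X.
Hypothesis goodP : {ae P, forall w : Env R d, forall x : site d, good u delta M p (w x)}.
Implicit Types (y : seq (site d)) (z : site d) (f : site d -> R) (g h : seq (site d) -> R).

Notation xi := (step X).
Notation steps := (steps X).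
Notation seg := (seg X).
Notation good := (good u delta M p).
Notation mean := (mean Pr).
Notation itg := (itg Pr).

Lemma measurable_of_steps n g : measurable_fun setT (fun s => g (steps n s)).
Proof. exact: (measurable_discrete (steps n) (measurable_steps _ _ _ _ walkX n)). Qed.

Lemma measurable_of_step n f : measurable_fun setT (fun s => f (xi n s)).
Proof. exact: (measurable_discrete (xi n) (measurable_step _ _ _ _ walkX n)). Qed.

Lemma measurable_of_seg k m g : measurable_fun setT (fun s => g (seg k m s)).
Proof. exact: (measurable_discrete (seg k m) (measurable_seg _ _ _ _ walkX k m)). Qed.

(** Each of the countably many lists that are not forward has path weight 0, so almost surely none
    of them occurs. *)
Lemma steps_forward : {ae Pr, forall s, forall n, forward u (steps n s)}.
Proof.
have : {ae Pr, forall s, forall y, steps (size y) s = y -> forward u y}.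
  apply: ae_forall_countable => y.
  have [fy|fy] := boolP (forward u y); first exact: aeW.
  have my : measurable (steps (size y) @^-1` [set y]) by exact: measurable_steps walkX _ _.
  exists (steps (size y) @^-1` [set y]); split => //.
    apply: (etrans (steps_law u delta M p P Pr W X walkX goodP y)); rewrite /pathw.
    by under eq_integral do rewrite weight_nforward//; rewrite integral0.
  by move=> s /= H; apply: contrapT => sy; apply: H.
by apply: filterS => s H n; apply: H; rewrite size_steps.
Qed.

Let itg_nonneg (F : S -> R) : measurable_fun setT F -> (forall s, 0 <= F s) ->
  (\int[Pr]_s (F s)%:E < +oo)%E -> itg F.
Proof.
move=> mF F0 Ffin; apply/integrableP; split; first exact/measurable_EFinP.
by under eq_integral do rewrite /= ger0_norm//.
Qed.

Let regeneration_ge0 k m g h : (forall y, 0 <= g y) -> (forall y, 0 <= h y) ->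
  (forall y, g y != 0 -> fresh u y) ->
  itg (fun s => g (steps k s)) -> itg (fun s => h (steps m s)) ->
  itg (fun s => g (steps k s) * h (seg k m s)) /\
  mean (fun s => g (steps k s) * h (seg k m s)) =
  mean (fun s => g (steps k s)) * mean (fun s => h (steps m s)).
Proof.
move=> g0 h0 gfresh ig ih.
have hfin : (\int[Pr]_s (h (steps m s))%:E)%E \is a fin_num by exact: integrable_fin_num.
have E := regeneration u delta M p P Pr W X iidP walkX goodP k m g h g0 h0 gfresh hfin.
have igh : itg (fun s => g (steps k s) * h (seg k m s)).
  apply: itg_nonneg.
  - by apply: measurable_funM; [exact: measurable_of_steps|exact: measurable_of_seg].
  - by move=> s; rewrite mulr_ge0.
  - by rewrite E !meanE// -EFinM ltry.
split => //; apply: EFin_inj.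
by rewrite -meanE// E !meanE.
Qed.

(** Obtained by splitting into positive and negative parts; the signed form serves the centred sums
    of the second moment. *)
Lemma regeneration_mean k m g h : (forall y, g y != 0 -> fresh u y) ->
  itg (fun s => g (steps k s)) -> itg (fun s => h (steps m s)) ->
  itg (fun s => g (steps k s) * h (seg k m s)) /\
  mean (fun s => g (steps k s) * h (seg k m s)) =
  mean (fun s => g (steps k s)) * mean (fun s => h (steps m s)).
Proof.
move=> gfresh ig ih.
pose pos (k0 : seq (site d) -> R) y := Num.max (k0 y) 0.
pose neg (k0 : seq (site d) -> R) y := Num.max (- k0 y) 0.
have pos0 k0 y : 0 <= pos k0 y by rewrite le_max lexx orbT.
have neg0 k0 y : 0 <= neg k0 y by rewrite le_max lexx orbT.
have posneg k0 y : k0 y = pos k0 y - neg k0 y.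
  by rewrite /pos /neg; have [?|?] := leP (k0 y) 0; have [?|?] := leP (- k0 y) 0; lra.
have pos_le k0 y : `|pos k0 y| <= `|k0 y|.
  by rewrite ger0_norm// ge_max ler_norm normr_ge0.
have neg_le k0 y : `|neg k0 y| <= `|k0 y|.
  by rewrite ger0_norm// ge_max -normrN ler_norm normr_ge0.
have ipos n k0 : itg (fun s => k0 (steps n s)) -> itg (fun s => pos k0 (steps n s)).
  move=> ik0; apply: (itg_le _ _ (fun s => `|k0 (steps n s)|)) => //.
    exact: measurable_of_steps.
  exact: itg_abs.
have ineg n k0 : itg (fun s => k0 (steps n s)) -> itg (fun s => neg k0 (steps n s)).
  move=> ik0; apply: (itg_le _ _ (fun s => `|k0 (steps n s)|)) => //.
    exact: measurable_of_steps.
  exact: itg_abs.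
have fpos y : pos g y != 0 -> fresh u y.
  by move=> gy; apply: gfresh; apply: contra_neq gy => gy; rewrite /pos gy maxxx.
have fneg y : neg g y != 0 -> fresh u y.
  by move=> gy; apply: gfresh; apply: contra_neq gy => gy; rewrite /neg gy oppr0 maxxx.
have [i1 e1] := regeneration_ge0 k m _ _ (pos0 g) (pos0 h) fpos (ipos _ _ ig) (ipos _ _ ih).
have [i2 e2] := regeneration_ge0 k m _ _ (pos0 g) (neg0 h) fpos (ipos _ _ ig) (ineg _ _ ih).
have [i3 e3] := regeneration_ge0 k m _ _ (neg0 g) (pos0 h) fneg (ineg _ _ ig) (ipos _ _ ih).
have [i4 e4] := regeneration_ge0 k m _ _ (neg0 g) (neg0 h) fneg (ineg _ _ ig) (ineg _ _ ih).
have E : (fun s => g (steps k s) * h (seg k m s)) = (fun s =>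
    (pos g (steps k s) * pos h (seg k m s) - pos g (steps k s) * neg h (seg k m s)) -
    (neg g (steps k s) * pos h (seg k m s) - neg g (steps k s) * neg h (seg k m s))).
  by apply/funext => s; rewrite (posneg g) (posneg h); ring.
rewrite E; split; first by do 2 ?apply: itgB.
rewrite meanB ?meanB//; try exact: itgB.
rewrite e1 e2 e3 e4.
have -> : mean (fun s => g (steps k s)) =
    mean (fun s => pos g (steps k s)) - mean (fun s => neg g (steps k s)).
  by rewrite -meanB; [apply: eq_mean => s; exact: posneg|exact: ipos|exact: ineg].
have -> : mean (fun s => h (steps m s)) =
    mean (fun s => pos h (steps m s)) - mean (fun s => neg h (steps m s)).
  by rewrite -meanB; [apply: eq_mean => s; exact: posneg|exact: ipos|exact: ineg].
by ring.
Qed.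

(* Up to null events, [alive (steps n s)] means sigma_1 > n and
   [stop (steps n s)] means sigma_1 = n. *)
Definition alive y : bool := forward u y && (level u y < 1).

Definition stop y : bool :=
  [&& forward u y, 1 <= level u y & level u (take (size y).-1 y) < 1].

Lemma stop_rcons y z : stop (rcons y z) =
  [&& 0 <= dotu z u, forward u y, 1 <= level u (rcons y z) & level u y < 1].
Proof.
by rewrite /stop forward_rcons size_rcons /= -cats1 take_size_cat// -andbA.
Qed.

(** The last step goes from below 1 to at least 1, so the level increases strictly, as [fresh_rcons]
    asks. *)
Lemma stop_fresh y : stop y -> fresh u y.
Proof.
case/lastP: y => [|y z]; first by rewrite /stop level_nil leNgt ltr01 andbF.
rewrite stop_rcons => /and4P[_ fy l1 l2]; apply: fresh_rcons => //.
exact: lt_le_trans l1.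
Qed.

Lemma alive_stop y z : forward u (rcons y z) ->
  (alive y)%:R = (alive (rcons y z))%:R + (stop (rcons y z))%:R :> R.
Proof.
rewrite stop_rcons /alive forward_rcons => /andP[z0 fy]; rewrite z0 fy /=.
have le_yz : level u y <= level u (rcons y z) by rewrite level_rcons lerDl.
have [l1|l1] := ltP (level u (rcons y z)) 1; last by rewrite add0r.
by rewrite (le_lt_trans le_yz l1) addr0.
Qed.

(* [surv n] is P(sigma_1 > n) and [renew n] is P(sigma_1 = n + 1). *)
Definition surv n : R := mean (fun s => (alive (steps n s))%:R).

Definition renew n : R := mean (fun s => (stop (steps n.+1 s))%:R).

Lemma itg_bool n (b : seq (site d) -> bool) : itg (fun s => (b (steps n s))%:R).
Proof.
apply: (itg_bounded _ _ 1); first exact: (measurable_of_steps n (fun y => (b y)%:R)).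
by move=> s; rewrite ger0_norm// lern1 leq_b1.
Qed.

Lemma surv_ge0 n : 0 <= surv n.
Proof. exact: mean_ge0. Qed.

Lemma renew_ge0 n : 0 <= renew n.
Proof. exact: mean_ge0. Qed.

Lemma surv0 : surv 0 = 1.
Proof.
rewrite /surv -[RHS](mean_cst Pr); apply: eq_mean => s.
by rewrite /alive /steps /= level_nil ltr01.
Qed.

Lemma renewE n : renew n = surv n - surv n.+1.
Proof.
rewrite /renew /surv -meanB; [|exact: itg_bool|exact: itg_bool].
apply: mean_ae_eq; first exact: itg_bool.
  by apply: itgB; exact: itg_bool.
apply: filterS steps_forward => s /(_ n.+1); rewrite steps_rcons => /alive_stop ->.
by rewrite addrAC subrr add0r.
Qed.

Lemma sum_renew n : \sum_(k < n) renew k = 1 - surv n.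
Proof.
elim: n => [|n IH]; first by rewrite big_ord0 surv0 subrr.
by rewrite big_ord_recr/= IH renewE; ring.
Qed.

Lemma sum_renew_le1 n : \sum_(k < n) renew k <= 1.
Proof. by rewrite sum_renew gerBl surv_ge0. Qed.

(* Between time n and sigma_1 the steps truncated at K climb at most 1 + K, but
   each of them has conditional mean at least delta / 2. *)
Lemma surv_tail : exists2 C : R, 0 <= C &
  forall n N, \sum_(n <= m < N) surv m <= C * surv n.
Proof.
have [K K0 drK] := good_drift u delta M p delta0 p1.
(* The largest total climb divided by the least mean climb per step. *)
exists ((1 + K) / (delta / 2)); first by rewrite divr_ge0// ?addr_ge0// ltW// ?divr_gt0.
move=> n N.
(* The truncated climb, set to 0 on backward steps so that it is nonnegative for every [z]. *)
pose t z : R := if 0 <= dotu z u then Num.min (dotu z u) K else 0.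
have t0 z : 0 <= t z by rewrite /t; case: ifP => // z0; rewrite le_min z0 ltW.
have tK z : t z <= K by rewrite /t; case: ifP => _; [rewrite ge_min lexx orbT|exact: ltW].
have it m : itg (fun s => (alive (steps m s))%:R * t (xi m s)).
  apply: (itg_bounded _ _ K).
    apply: measurable_funM; last exact: measurable_of_step.
    exact: (measurable_of_steps m (fun y => (alive y)%:R)).
  by move=> s; rewrite ger0_norm ?mulr_ge0// -[K]mul1r ler_pM// lern1 leq_b1.
have step1 m : delta / 2 * surv m <= mean (fun s => (alive (steps m s))%:R * t (xi m s)).
  rewrite -lee_fin EFinM -!meanE//; last exact: itg_bool.
  have := step_mean_ge u delta M p P Pr W X walkX goodP m (fun y => (alive y)%:R) t (delta / 2).
  apply => //; first by rewrite divr_ge0// ltW.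
  move=> r gr; apply: (le_trans (drK r gr)); apply: le_esum => z _; rewrite lee_fin.
  by rewrite /t /sprob; case: ifP => _ //; rewrite !mulr0.
have pointwise : {ae Pr, forall s, \sum_(n <= m < N) (alive (steps m s))%:R * t (xi m s)
    <= (1 + K) * (alive (steps n s))%:R}.
  apply: filterS steps_forward => s fs.
  have [nN|Nn] := leqP n N; last first.
    by rewrite big_geq 1?ltnW// mulr_ge0// addr_ge0// ltW.
  (* While the walk is alive, the truncated climb since time [n] is at most its level, which is
     below 1. The passage step adds at most [K], and nothing is counted afterwards. *)
  have : \sum_(n <= m < N) (alive (steps m s))%:R * t (xi m s) <=
      if alive (steps n s) then (if alive (steps N s) then level u (steps N s) else 1 + K) else 0.
    have K1 : 0 <= 1 + K by rewrite addr_ge0// ltW.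
    elim: N nN => [|N IH].
      rewrite leqn0 => /eqP ->; rewrite big_geq//; case: ifP => // _; case: ifP => // _.
      exact: forward_level.
    rewrite leq_eqVlt => /orP[/eqP <-|]; last rewrite ltnS => nN.
      by rewrite big_geq//; case: ifP => // _; case: ifP => // _; exact: forward_level.
    rewrite big_nat_recr//=; have := fs N.+1; rewrite steps_rcons => fN.
    move: (IH nN); have := alive_stop _ _ fN.
    case an : (alive (steps n s)); last first.
      have -> : alive (steps N s) = false.
        apply/negbTE; apply: contraFN an => /andP[_ lN].
        rewrite /alive fs/=; apply: le_lt_trans lN.
        rewrite -(subnKC nN) steps_cat /level disp_cat dotuD lerDl.
        rewrite -/(level u _); apply: forward_level.
        by have := fs (n + (N - n))%N; rewrite steps_cat /forward all_cat => /andP[].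
      by rewrite mul0r addr0.
    case aN : (alive (steps N s)); last first.
      rewrite mul0r addr0 => /eqP; rewrite eq_sym paddr_eq0// pnatr_eq0 => /andP[+ _].
      by case: (alive (rcons _ _)).
    move=> _ IHN; rewrite mul1r.
    have ts : t (xi N s) <= dotu (xi N s) u.
      by move: fN; rewrite forward_rcons /t => /andP[-> _]; rewrite ge_min lexx.
    have lN : level u (steps N s) < 1 by move: aN => /andP[].
    case: ifP => _; first by rewrite level_rcons lerD.
    by rewrite lerD ?tK// (le_trans IHN)// ltW.
  move=> /le_trans; apply; case: ifP => an; last by rewrite mulr0.
  rewrite mulr1; case: ifP => aN; last by [].
  have : level u (steps N s) < 1 by move: aN => /andP[].
  by move=> /ltW /le_trans; apply; rewrite lerDl ltW.
have : \sum_(n <= m < N) delta / 2 * surv m <= (1 + K) * surv n.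
  apply: (@le_trans _ _ (\sum_(n <= m < N) mean (fun s => (alive (steps m s))%:R * t (xi m s)))).
    exact: ler_sum.
  rewrite -mean_sum// -meanZ; last exact: itg_bool.
  apply: mean_ae_le => //; first exact: itg_sum.
  by apply: itgZ; exact: itg_bool.
rewrite -mulr_sumr => H.
by rewrite mulrAC ler_pdivlMr ?divr_gt0// mulrC.
Qed.

Lemma series_tail (a b : nat -> R) : (forall n, 0 <= a n) ->
  (forall n N, \sum_(n <= m < N) a m <= b n) ->
  cvgn (series a) /\ forall n, 0 <= limn (series a) - series a n <= b n.
Proof.
move=> a0 ab.
have nd : nondecreasing_seq (series a).
  by apply/nondecreasing_seqP => n; rewrite /series/= big_nat_recr//= lerDl.
have ca : cvgn (series a).
  apply: nondecreasing_is_cvgn => //; exists (b 0%N) => _ [n _ <-]; exact: ab.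
split => // n; rewrite subr_ge0 nondecreasing_cvgn_le//= lerBlDr.
apply: limr_le => //; near=> N.
have nN : (n <= N)%N by near: N; exact: nbhs_infty_ge.
by rewrite /series/= (big_cat_nat (leq0n n) nN)/= addrC lerD2r.
Unshelve. all: by end_near. Qed.

(** The renewal weights have total mass at most 1, so averaging earlier values does not exceed the
    bound already reached before time [n], and time [n] adds only [rho n]. *)
Lemma renewal_bound (e r rho : nat -> R) :
  (forall n, e n = r n + \sum_(k < n) renew k * e (n - k.+1)%N) ->
  (forall n, `|r n| <= rho n) -> forall n, `|e n| <= \sum_(j < n.+1) rho j.
Proof.
move=> eE rrho n.
have rho0 j : 0 <= rho j by exact: le_trans (rrho j).
elim/ltn_ind: n => n IH.
rewrite eE (le_trans (ler_normD _ _))// big_ord_recr/= addrC lerD//.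
apply: (@le_trans _ _ (\sum_(k < n) renew k * \sum_(j < n) rho j)).
  rewrite (le_trans (ler_norm_sum _ _ _))//; apply: ler_sum => k _.
  rewrite normrM ger0_norm ?renew_ge0// ler_wpM2l ?renew_ge0//.
  have kn : (n - k.+1 < n)%N by rewrite ltn_subrL/=; exact: leq_trans (ltn_ord k).
  rewrite (le_trans (IH _ kn))//.
  rewrite -(big_mkord xpredT) -[leRHS](big_mkord xpredT) [leRHS](big_cat_nat (leq0n _) kn)/=.
  by rewrite lerDl sumr_ge0.
by rewrite -mulr_suml -[leRHS]mul1r ler_wpM2r ?sum_renew_le1// sumr_ge0.
Qed.

(** By [alive_stop] each step only moves mass from alive to stopped. This partition decomposes the
    sums over [n] steps at the passage time. *)
Lemma alive_total : {ae Pr, forall s, forall n,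
  (alive (steps n s))%:R + \sum_(k < n) (stop (steps k.+1 s))%:R = 1 :> R}.
Proof.
apply: filterS steps_forward => s fs; elim => [|n IH].
  by rewrite big_ord0 addr0 /alive /steps /= level_nil ltr01.
rewrite big_ord_recr/= -[RHS]IH; have := fs n.+1; rewrite steps_rcons => /alive_stop ->.
by ring.
Qed.

Variable C : R.
Hypothesis C0 : 0 <= C.
Hypothesis survC : forall n N, \sum_(n <= m < N) surv m <= C * surv n.

Lemma sum_surv_le n : \sum_(m < n) surv m <= C.
Proof. by rewrite -(big_mkord xpredT) (le_trans (survC 0 n))// surv0 mulr1. Qed.

(** The double sum of [surv m] over j <= m < n, taken in the other order, is a sum of tails. Each is
    at most [C * surv j], and summing once more gives another factor [C]. It stands in for a second
    moment of sigma_1. *)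
Lemma sum_surv_moment n : \sum_(m < n) m.+1%:R * surv m <= C ^+ 2.
Proof.
have -> : \sum_(m < n) m.+1%:R * surv m = \sum_(j < n) \sum_(j <= m < n) surv m.
  elim: n => [|n IH]; first by rewrite !big_ord0.
  rewrite big_ord_recr/= IH.
  rewrite [RHS](eq_bigr (fun j : 'I_n.+1 => \sum_(j <= m < n) surv m + surv n)); last first.
    by move=> j _; rewrite big_nat_recr//= -ltnS.
  rewrite big_split/= sumr_const card_ord mulr_natl; congr (_ + _).
  by rewrite big_ord_recr/= big_geq// addr0.
apply: (@le_trans _ _ (\sum_(j < n) C * surv j)); first by apply: ler_sum => j _.
by rewrite -mulr_sumr expr2 ler_wpM2l// sum_surv_le.
Qed.

(** E[sigma_1], as the sum over m of P(sigma_1 > m). *)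
Definition mean_duration : R := limn (series surv).

Lemma duration_tail n : 0 <= mean_duration - \sum_(m < n) surv m <= C * surv n.
Proof.
have [_ /(_ n)] := series_tail surv (fun n => C * surv n) surv_ge0 survC.
by rewrite /series/= -(big_mkord xpredT).
Qed.

Lemma mean_duration_ge1 : 1 <= mean_duration.
Proof.
have /andP[+ _] := duration_tail 1%N.
by rewrite big_ord1 surv0 subr_ge0.
Qed.

Definition asum f y : R := \sum_(z <- y) f z.

Lemma asum_cat f y1 y2 : asum f (y1 ++ y2) = asum f y1 + asum f y2.
Proof. by rewrite /asum big_cat. Qed.

Lemma asum_rcons f y z : asum f (rcons y z) = asum f y + f z.
Proof. by rewrite -cats1 asum_cat /asum big_seq1. Qed.

Lemma asum_ge0 f y : (forall z, 0 <= f z) -> 0 <= asum f y.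
Proof. by move=> f0; exact: sumr_ge0. Qed.

Lemma asum_steps f n s : asum f (steps n s) = \sum_(m < n) f (xi m s).
Proof.
elim: n => [|n IH]; first by rewrite big_ord0 /asum big_nil.
by rewrite steps_rcons asum_rcons big_ord_recr IH.
Qed.

(* The sum over m of the [cycle_term f m] is the mean of the sum of f over the
   first sigma_1 steps. *)
Definition cycle_term f m : R := mean (fun s => (alive (steps m s))%:R * f (xi m s)).

Definition speed f : R := limn (series (cycle_term f)) / mean_duration.

Definition avg f n : R := mean (fun s => asum f (steps n s)).

Section additive.
Variables (f : site d -> R) (L : R).
Hypothesis f0 : forall z, 0 <= f z.
Hypothesis fL : forall r, good r -> (\esum_(z in [set: site d]) (f z * sprob u z r)%:E <= L%:E)%E.
Hypothesis L0 : 0 <= L.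

Lemma itg_fstep n : itg (fun s => f (xi n s)).
Proof.
apply: itg_nonneg => //; first exact: measurable_of_step.
have := step_mean_le u delta M p P Pr W X walkX goodP n (fun=> 1) f L (fun=> ler01) f0 L0 fL.
under eq_integral do rewrite mul1r.
move=> /le_lt_trans; apply.
by rewrite (meanE Pr (fun=> 1) (itg_cst Pr 1)) -EFinM ltry.
Qed.

Lemma itg_weighted n g : (forall y, 0 <= g y <= 1) ->
  itg (fun s => g (steps n s) * f (xi n s)).
Proof.
move=> g01; apply: (itgM _ _ _ 1); [exact: measurable_of_steps| |exact: itg_fstep].
by move=> s; have /andP[a b] := g01 (steps n s); rewrite ger0_norm.
Qed.

Lemma mean_weighted n g : (forall y, 0 <= g y <= 1) ->
  mean (fun s => g (steps n s) * f (xi n s)) <= L * mean (fun s => g (steps n s)).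
Proof.
move=> g01.
have g0 y : 0 <= g y by have /andP[] := g01 y.
have ig : itg (fun s => g (steps n s)).
  apply: (itg_bounded _ _ 1); first exact: measurable_of_steps.
  by move=> s; have /andP[a b] := g01 (steps n s); rewrite ger0_norm.
rewrite -lee_fin EFinM -!meanE//; last exact: itg_weighted.
exact: (step_mean_le u delta M p P Pr W X walkX goodP).
Qed.

Lemma itg_asum n : itg (fun s => asum f (steps n s)).
Proof.
under eq_fun do rewrite asum_steps.
by apply: itg_sum => i; exact: itg_fstep.
Qed.

Let alive01 y : 0 <= ((alive y)%:R : R) <= 1.
Proof. by rewrite ler0n lern1 leq_b1. Qed.

Lemma cycle_term_ge0 m : 0 <= cycle_term f m.
Proof. by apply: mean_ge0 => s; rewrite mulr_ge0. Qed.

Lemma cycle_term_le m : cycle_term f m <= L * surv m.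
Proof. exact: (mean_weighted m (fun y => (alive y)%:R)). Qed.

Lemma cycle_tail n :
  0 <= limn (series (cycle_term f)) - \sum_(m < n) cycle_term f m <= L * C * surv n.
Proof.
have H m N : \sum_(m <= j < N) cycle_term f j <= L * C * surv m.
  apply: (@le_trans _ _ (\sum_(m <= j < N) L * surv j)).
    by apply: ler_sum => j _; exact: cycle_term_le.
  by rewrite -mulr_sumr -mulrA ler_wpM2l.
have [_ /(_ n)] := series_tail (cycle_term f) (fun n => L * C * surv n) cycle_term_ge0 H.
by rewrite /series/= -(big_mkord xpredT).
Qed.

Lemma cvg_cycle : cvgn (series (cycle_term f)).
Proof.
have H m N : \sum_(m <= j < N) cycle_term f j <= L * C * surv m.
  apply: (@le_trans _ _ (\sum_(m <= j < N) L * surv j)).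
    by apply: ler_sum => j _; exact: cycle_term_le.
  by rewrite -mulr_sumr -mulrA ler_wpM2l.
by have [] := series_tail (cycle_term f) (fun n => L * C * surv n) cycle_term_ge0 H.
Qed.

Lemma speed_ge0 : 0 <= speed f.
Proof.
rewrite divr_ge0//; last by rewrite (le_trans ler01)// mean_duration_ge1.
by have /andP[+ _] := cycle_tail 0; rewrite big_ord0 subr0.
Qed.

Lemma speed_le : speed f <= L.
Proof.
have t1 := mean_duration_ge1.
rewrite ler_pdivrMr ?(lt_le_trans ltr01)//.
apply: limr_le; first exact: cvg_cycle.
apply: nearW => n; apply: (@le_trans _ _ (L * \sum_(m < n) surv m)).
  rewrite /series/= big_mkord mulr_sumr; apply: ler_sum => j _; exact: cycle_term_le.
by rewrite ler_wpM2l//; have /andP[+ _] := duration_tail n; rewrite subr_ge0.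
Qed.

(** If sigma_1 = k + 1 <= n, the sum over the remaining n - k - 1 steps is independent of the past
    and distributed like a sum from time 0. The steps taken before sigma_1 give the cycle terms. *)
Lemma renewal_eq n : avg f n =
  \sum_(m < n) cycle_term f m + \sum_(k < n) renew k * avg f (n - k.+1).
Proof.
pose F s := \sum_(m < n) ((alive (steps m s))%:R * f (xi m s)) +
   \sum_(k < n) ((stop (steps k.+1 s))%:R * asum f (seg k.+1 (n - k.+1) s)).
have ia (m : 'I_n) : itg (fun s => (alive (steps m s))%:R * f (xi m s)).
  exact: (itg_weighted m (fun y => (alive y)%:R)).
have stopf y : (stop y)%:R != 0 :> R -> fresh u y.
  by rewrite pnatr_eq0 eqb0 negbK => /stop_fresh.
have reg (k : 'I_n) := regeneration_mean k.+1 (n - k.+1) (fun y => (stop y)%:R) (asum f) stopf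
  (itg_bool k.+1 stop) (itg_asum (n - k.+1)).
have ib (k : 'I_n) : itg (fun s => (stop (steps k.+1 s))%:R * asum f (seg k.+1 (n - k.+1) s)).
  by have [] := reg k.
have -> : avg f n = mean F.
  apply: mean_ae_eq; [exact: itg_asum|by apply: itgD; exact: itg_sum|].
  apply: filterS alive_total => s at1; rewrite /F.
  have -> : \sum_(k < n) ((stop (steps k.+1 s))%:R * asum f (seg k.+1 (n - k.+1) s)) =
     \sum_(k < n) ((stop (steps k.+1 s))%:R * (asum f (steps n s) - asum f (steps k.+1 s))).
    apply: eq_bigr => k _; congr (_ * _).
    have := steps_cat X k.+1 (n - k.+1) s; rewrite subnKC// => ->.
    by rewrite asum_cat addrAC subrr add0r.
  (* Pathwise identity: the step at time [n] is counted in the first sum if the walk is alive,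
     otherwise through the single [k] at which it stopped. The new summand [k = n] is an empty
     difference. *)
  elim: n {F ia reg ib} => [|n IH]; first by rewrite !big_ord0 addr0 /asum big_nil.
  rewrite big_ord_recr/= [X in _ = _ + X]big_ord_recr/= subrr mulr0 addr0.
  have {2}-> : asum f (steps n.+1 s) = asum f (steps n s) + f (xi n s).
    by rewrite steps_rcons asum_rcons.
  rewrite -addrA [X in _ = _ + X](_ : _ = f (xi n s) +
    \sum_(k < n) (stop (steps k.+1 s))%:R * (asum f (steps n s) - asum f (steps k.+1 s))).
    by rewrite addrCA -IH addrC steps_rcons asum_rcons.
  have fE : f (xi n s) = (alive (steps n s))%:R * f (xi n s) +
      \sum_(k < n) (stop (steps k.+1 s))%:R * f (xi n s).
    by rewrite -mulr_suml -mulrDl at1 mul1r.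
  rewrite [X in _ = X + _]fE -addrA; congr (_ + _).
  rewrite -big_split/=; apply: eq_bigr => k _.
  by rewrite steps_rcons asum_rcons; ring.
rewrite /F meanD; [|exact: itg_sum|exact: itg_sum].
rewrite !mean_sum//; congr (_ + _); apply: eq_bigr => k _.
by have [_ ->] := reg k.
Qed.

End additive.

(** This is [renewal_eq] for the constant function 1, whose sum counts the steps and whose
    [cycle_term] is [surv]. *)
Lemma duration_renewal n : n%:R = \sum_(m < n) surv m + \sum_(k < n) renew k * (n - k.+1)%:R.
Proof.
have f1 r : good r -> (\esum_(z in [set: site d]) (1 * sprob u z r)%:E <= 1%:E)%E.
  by case=> _ r1 _ _; under eq_esum do rewrite mul1r; rewrite r1.
have avg1 m : avg (fun=> 1) m = m%:R.
  rewrite /avg -[RHS](mean_cst Pr); apply: eq_mean => s.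
  by rewrite asum_steps sumr_const card_ord.
have := renewal_eq (fun=> 1) 1 (fun=> ler01) f1 ler01 n.
rewrite avg1 => ->; congr (_ + _); last by apply: eq_bigr => k _; rewrite avg1.
by apply: eq_bigr => m _; apply: eq_mean => s; rewrite mulr1.
Qed.

(** Subtracting [speed f] times [duration_renewal] from [renewal_eq] leaves a renewal equation with
    forcing [r]. By the choice of the speed the complete sums cancel, so [r m] is a difference of
    two tails, both between 0 and [L * C * surv m], which is summable. *)
Lemma avg_speed f L : (forall z, 0 <= f z) ->
  (forall r, good r -> (\esum_(z in [set: site d]) (f z * sprob u z r)%:E <= L%:E)%E) ->
  0 <= L -> forall n, `|avg f n - n%:R * speed f| <= L * C ^+ 2.
Proof.
move=> f0 fL L0 n.
pose r m := \sum_(j < m) cycle_term f j - speed f * \sum_(j < m) surv j.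
have v0 := speed_ge0 f L f0 fL L0; have vL := speed_le f L f0 fL L0.
have t0 : mean_duration != 0 by rewrite gt_eqF// (lt_le_trans ltr01)// mean_duration_ge1.
have rE m : `|r m| <= L * C * surv m.
  have /andP[a0 a1] := cycle_tail f L f0 fL L0 m.
  have /andP[b0 b1] := duration_tail m.
  have E : r m = speed f * (mean_duration - \sum_(j < m) surv j) -
     (limn (series (cycle_term f)) - \sum_(j < m) cycle_term f j).
    by rewrite mulrBr {1}/speed divfK// /r; ring.
  have c1 : speed f * (mean_duration - \sum_(j < m) surv j) <= L * C * surv m.
    by rewrite -mulrA ler_pM.
  have c0 : 0 <= speed f * (mean_duration - \sum_(j < m) surv j) by rewrite mulr_ge0.
  by rewrite E ler_norml; apply/andP; split; lra.
have eE m : avg f m - m%:R * speed f = r m +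
    \sum_(k < m) renew k * (avg f (m - k.+1) - (m - k.+1)%:R * speed f).
  have -> : \sum_(k < m) renew k * (avg f (m - k.+1) - (m - k.+1)%:R * speed f) =
      \sum_(k < m) renew k * avg f (m - k.+1) - (\sum_(k < m) renew k * (m - k.+1)%:R) * speed f.
    by rewrite mulr_suml -sumrB; apply: eq_bigr => k _; ring.
  by rewrite (renewal_eq f L f0 fL L0 m) [in LHS](duration_renewal m) /r; ring.
have := renewal_bound (fun m => avg f m - m%:R * speed f) r (fun m => L * C * surv m) eE rE n.
move=> /le_trans; apply; rewrite -mulr_sumr expr2 mulrA ler_wpM2l ?mulr_ge0//.
exact: sum_surv_le.
Qed.

(** Summation by parts, [renew] being the decrement of [surv]. *)
Lemma sum_renew_sq n :
  n%:R ^+ 2 * surv n + \sum_(k < n) k.+1%:R ^+ 2 * renew k = \sum_(m < n) (2 * m%:R + 1) * surv m.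
Proof.
elim: n => [|n IH]; first by rewrite !big_ord0 addr0 expr0n mul0r.
rewrite !big_ord_recr/= -IH renewE -[n.+1%:R]natr1; ring.
Qed.

(** * Second moments for bounded functions of the step *)

Section second_moment.
Variables (f : site d -> R) (K : R).
Hypothesis fK : forall z, 0 <= f z <= K.

Let f0 z : 0 <= f z. Proof. by have /andP[] := fK z. Qed.

Let K0 : 0 <= K. Proof. by have /andP[a b] := fK 0; exact: le_trans b. Qed.

Let fmean r : good r -> (\esum_(z in [set: site d]) (f z * sprob u z r)%:E <= K%:E)%E.
Proof.
move=> [_ r1 _ _].
apply: (@le_trans _ _ (\esum_(z in [set: site d]) (K%:E * (sprob u z r)%:E))%E).
  apply: le_esum => z _; rewrite -EFinM lee_fin ler_wpM2r ?sprob_ge0//.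
  by have /andP[] := fK z.
by rewrite esumZl// ?r1 ?mule1// => z; rewrite lee_fin sprob_ge0.
Qed.

Let v := speed f.

Let dev y : R := asum f y - (size y)%:R * v.

Let dev_cat y1 y2 : dev (y1 ++ y2) = dev y1 + dev y2.
Proof. by rewrite /dev asum_cat size_cat natrD; ring. Qed.

Let asum_le y : 0 <= asum f y <= (size y)%:R * K.
Proof.
rewrite asum_ge0//=; elim: y => [|z y IH]; first by rewrite /asum big_nil mul0r.
rewrite /asum big_cons /= -natr1 mulrDl mul1r addrC lerD//.
by have /andP[] := fK z.
Qed.

Let dev_le y : `|dev y| <= (size y)%:R * K.
Proof.
have /andP[a0 a1] := asum_le y.
have v0 : 0 <= v by exact: (speed_ge0 f K f0 fmean K0).
have vK : v <= K by exact: (speed_le f K f0 fmean K0).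
have b0 : 0 <= (size y)%:R * v by rewrite mulr_ge0.
have b1 : (size y)%:R * v <= (size y)%:R * K by rewrite ler_wpM2l.
rewrite /dev ler_norml; apply/andP; split; lra.
Qed.

Let itg_path n g c : (forall y, size y = n -> `|g y| <= c) -> itg (fun s => g (steps n s)).
Proof.
move=> gc; apply: (itg_bounded _ _ c); first exact: measurable_of_steps.
by move=> s; rewrite gc// size_steps.
Qed.

Let itg_dev n : itg (fun s => dev (steps n s)).
Proof. by apply: (itg_path n dev (n%:R * K)) => y <-; exact: dev_le. Qed.

Let itg_dev2 n : itg (fun s => dev (steps n s) ^+ 2).
Proof.
apply: (itg_path n (fun y => dev y ^+ 2) ((n%:R * K) ^+ 2)) => y yn.
rewrite normrX ler_pXn2r ?nnegrE ?mulr_ge0//.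
by rewrite -yn; exact: dev_le.
Qed.

Let mean_dev n : mean (fun s => dev (steps n s)) = avg f n - n%:R * v.
Proof.
rewrite -[n%:R * v](mean_cst Pr) -meanB; last 2 first.
- exact: (itg_asum f K f0 fmean K0).
- exact: itg_cst.
by apply: eq_mean => s; rewrite /dev size_steps.
Qed.

Let V n := mean (fun s => dev (steps n s) ^+ 2).

(** [2 * C ^+ 2] bounds the squared durations; [2 * C ^+ 3] comes from the cross terms, twice a mean
    deviation of at most [K * C ^+ 2] times a mean duration of at most [C]. *)
Let D := 2 * C ^+ 2 + 2 * C ^+ 3.

(** At the passage time the deviation splits into a past part and a fresh part. The square is
    expanded, and regeneration factorises the cross term and the square of the fresh part. *)
Let V_eq n : V n = mean (fun s => (alive (steps n s))%:R * dev (steps n s) ^+ 2) +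
  \sum_(k < n) (mean (fun s => (stop (steps k.+1 s))%:R * dev (steps k.+1 s) ^+ 2) +
    2 * (mean (fun s => (stop (steps k.+1 s))%:R * dev (steps k.+1 s)) *
      mean (fun s => dev (steps (n - k.+1) s))) +
    renew k * V (n - k.+1)).
Proof.
have bool_le y (b : bool) (x c : R) : `|x| <= c -> `|b%:R * x| <= c.
  by case: b => xc; rewrite ?mul1r// mul0r normr0 (le_trans _ xc).
have i0 : itg (fun s => (alive (steps n s))%:R * dev (steps n s) ^+ 2).
  apply: (itg_path n (fun y => (alive y)%:R * dev y ^+ 2) ((n%:R * K) ^+ 2)) => y yn.
  apply: bool_le => //; rewrite normrX ler_pXn2r ?nnegrE ?mulr_ge0//.
  by rewrite -yn; exact: dev_le.
have i1 k : itg (fun s => (stop (steps k s))%:R * dev (steps k s)).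
  apply: (itg_path k (fun y => (stop y)%:R * dev y) (k%:R * K)) => y yn.
  by apply: bool_le => //; rewrite -yn; exact: dev_le.
have i2 k : itg (fun s => (stop (steps k s))%:R * dev (steps k s) ^+ 2).
  apply: (itg_path k (fun y => (stop y)%:R * dev y ^+ 2) ((k%:R * K) ^+ 2)) => y yn.
  apply: bool_le => //; rewrite normrX ler_pXn2r ?nnegrE ?mulr_ge0//.
  by rewrite -yn; exact: dev_le.
have fr1 y : (stop y)%:R != 0 :> R -> fresh u y.
  by rewrite pnatr_eq0 eqb0 negbK => /stop_fresh.
have fr2 y : (stop y)%:R * dev y != 0 :> R -> fresh u y.
  by rewrite mulf_eq0 negb_or => /andP[/fr1].
have reg1 (k : 'I_n) := regeneration_mean k.+1 (n - k.+1) (fun y => (stop y)%:R * dev y) dev fr2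
  (i1 k.+1) (itg_dev (n - k.+1)).
have reg2 (k : 'I_n) := regeneration_mean k.+1 (n - k.+1) (fun y => (stop y)%:R)
  (fun y => dev y ^+ 2) fr1 (itg_bool k.+1 stop) (itg_dev2 (n - k.+1)).
pose T (k : 'I_n) s := (stop (steps k.+1 s))%:R * dev (steps k.+1 s) ^+ 2 +
   2 * ((stop (steps k.+1 s))%:R * dev (steps k.+1 s) * dev (seg k.+1 (n - k.+1) s)) +
   (stop (steps k.+1 s))%:R * dev (seg k.+1 (n - k.+1) s) ^+ 2.
have j1 (k : 'I_n) : itg (fun s =>
    (stop (steps k.+1 s))%:R * dev (steps k.+1 s) * dev (seg k.+1 (n - k.+1) s)).
  by have [] := reg1 k.
have j2 (k : 'I_n) : itg (fun s => (stop (steps k.+1 s))%:R * dev (seg k.+1 (n - k.+1) s) ^+ 2).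
  by have [] := reg2 k.
have iT k : itg (T k) by apply: itgD => //; apply: itgD => //; exact: itgZ.
transitivity (mean (fun s => (alive (steps n s))%:R * dev (steps n s) ^+ 2 + \sum_(k < n) T k s)).
  apply: mean_ae_eq => //; first by apply: itgD => //; exact: itg_sum.
  apply: filterS alive_total => s /(_ n) at1.
  rewrite -[LHS]mul1r -[X in X * _]at1 mulrDl mulr_suml; congr (_ + _).
  apply: eq_bigr => k _; rewrite /T.
  have := steps_cat X k.+1 (n - k.+1) s; rewrite subnKC// => ->.
  by rewrite dev_cat; ring.
rewrite meanD//; last exact: itg_sum.
rewrite mean_sum//; congr (_ + _); apply: eq_bigr => k _.
rewrite meanD//; last by apply: itgD => //; exact: itgZ.
rewrite meanD//; last exact: itgZ.
rewrite meanZ//.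
by have [_ ->] := reg1 k; have [_ ->] := reg2 k.
Qed.

(** Induction on [n]: the first cycle and the cross terms contribute at most [D * K ^+ 2], and the
    fresh part gives earlier values with weights of total mass at most 1. Growth is therefore
    linear. *)
Lemma second_moment n : mean (fun s => (asum f (steps n s) - n%:R * speed f) ^+ 2) <=
  D * K ^+ 2 * n.+1%:R.
Proof.
have -> : mean (fun s => (asum f (steps n s) - n%:R * speed f) ^+ 2) = V n.
  by apply: eq_mean => s; rewrite /dev size_steps.
have sq y : dev y ^+ 2 <= ((size y)%:R * K) ^+ 2.
  rewrite -[leLHS]real_normK ?num_real// ler_pXn2r ?nnegrE ?mulr_ge0//; exact: dev_le.
have avgK m : `|mean (fun s => dev (steps m s))| <= K * C ^+ 2.
  by rewrite mean_dev; exact: (avg_speed f K f0 fmean K0).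
have D0 : 0 <= D by rewrite addr_ge0// mulr_ge0// exprn_ge0.
elim/ltn_ind: n => n IH; rewrite V_eq.
have alive_le : mean (fun s => (alive (steps n s))%:R * dev (steps n s) ^+ 2) <=
    K ^+ 2 * (n%:R ^+ 2 * surv n).
  rewrite mulrA -exprMn [K * _]mulrC -meanZ; last exact: itg_bool.
  apply: mean_le.
  - apply: (itg_path n (fun y => (alive y)%:R * dev y ^+ 2) ((n%:R * K) ^+ 2)) => y yn.
    case: (alive y); rewrite ?mul1r ?mul0r ?normr0 ?sqr_ge0//.
    by rewrite ger0_norm ?sqr_ge0// -yn.
  - by apply: itgZ; exact: itg_bool.
  - by move=> s /=; rewrite mulrC ler_wpM2r//; have := sq (steps n s); rewrite size_steps.
have stop2_le k : mean (fun s => (stop (steps k.+1 s))%:R * dev (steps k.+1 s) ^+ 2) <=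
    K ^+ 2 * (k.+1%:R ^+ 2 * renew k).
  rewrite mulrA -exprMn [K * _]mulrC -meanZ; last exact: (itg_bool k.+1).
  apply: mean_le.
  - apply: (itg_path k.+1 (fun y => (stop y)%:R * dev y ^+ 2) ((k.+1%:R * K) ^+ 2)) => y yn.
    case: (stop y); rewrite ?mul1r ?mul0r ?normr0 ?sqr_ge0//.
    by rewrite ger0_norm ?sqr_ge0// -yn.
  - by apply: itgZ; exact: (itg_bool k.+1).
  - by move=> s /=; rewrite mulrC ler_wpM2r//; have := sq (steps k.+1 s); rewrite size_steps.
have stop1_le k : `|mean (fun s => (stop (steps k.+1 s))%:R * dev (steps k.+1 s))| <=
    K * (k.+1%:R * renew k).
  have i1 : itg (fun s => (stop (steps k.+1 s))%:R * dev (steps k.+1 s)).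
    apply: (itg_path k.+1 (fun y => (stop y)%:R * dev y) (k.+1%:R * K)) => y yn.
    case: (stop y); rewrite ?mul1r ?mul0r ?normr0 ?mulr_ge0//.
    by rewrite -yn.
  rewrite (le_trans (mean_abs_le _ _ i1))// mulrA [K * _]mulrC -meanZ; last exact: (itg_bool k.+1).
  apply: mean_le => [| |s]; [exact: itg_abs|by apply: itgZ; exact: (itg_bool k.+1)|].
  rewrite /= normrM normr_nat mulrC ler_wpM2r//.
  by have := dev_le (steps k.+1 s); rewrite size_steps.
have cross k : 2 * (mean (fun s => (stop (steps k.+1 s))%:R * dev (steps k.+1 s)) *
      mean (fun s => dev (steps (n - k.+1) s))) <= 2 * K ^+ 2 * C ^+ 2 * (k.+1%:R * renew k).
  have -> : 2 * K ^+ 2 * C ^+ 2 * (k.+1%:R * renew k) =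
      2 * ((K * (k.+1%:R * renew k)) * (K * C ^+ 2)) by ring.
  rewrite ler_wpM2l// (le_trans (ler_norm _))// normrM ler_pM//.
have Vk (k : 'I_n) : renew k * V (n - k.+1) <= renew k * (D * K ^+ 2 * n%:R).
  rewrite ler_wpM2l ?renew_ge0//; apply: (le_trans (IH _ _)).
    by rewrite ltn_subrL/=; exact: leq_trans (ltn_ord k).
  rewrite ler_wpM2l ?mulr_ge0 ?exprn_ge0// ler_nat.
  by rewrite ltn_subrL/=; exact: leq_trans (ltn_ord k).
apply: (@le_trans _ _ (K ^+ 2 * (n%:R ^+ 2 * surv n) + \sum_(k < n)
   (K ^+ 2 * (k.+1%:R ^+ 2 * renew k) + 2 * K ^+ 2 * C ^+ 2 * (k.+1%:R * renew k) +
    renew k * (D * K ^+ 2 * n%:R)))).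
  by apply: lerD => //; apply: ler_sum => k _; apply: lerD => //; exact: lerD.
rewrite !big_split/= -!mulr_sumr -mulr_suml !addrA -mulrDr sum_renew_sq.
have b1 : \sum_(m < n) (2 * m%:R + 1) * surv m <= 2 * C ^+ 2.
  apply: (@le_trans _ _ (\sum_(m < n) 2 * (m.+1%:R * surv m))).
    apply: ler_sum => m _; rewrite mulrA ler_wpM2r ?surv_ge0// -natr1; lra.
  by rewrite -mulr_sumr ler_wpM2l// sum_surv_moment.
(* E[sigma_1; sigma_1 <= n] is at most [C], because [duration_renewal] expresses it through sums of
   [surv]. *)
have b2 : \sum_(k < n) k.+1%:R * renew k <= C.
  have := duration_renewal n.
  have -> : \sum_(k < n) renew k * (n - k.+1)%:R =
      n%:R * \sum_(k < n) renew k - \sum_(k < n) k.+1%:R * renew k.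
    rewrite mulr_sumr -sumrB; apply: eq_bigr => k _.
    by rewrite natrB//; ring.
  rewrite sum_renew => E.
  have := sum_surv_le n; have : 0 <= n%:R * surv n by rewrite mulr_ge0 ?surv_ge0.
  lra.
have b3 := sum_renew_le1 n.
have K20 : 0 <= K ^+ 2 by rewrite exprn_ge0.
have C20 : 0 <= 2 * K ^+ 2 * C ^+ 2 by rewrite !mulr_ge0// exprn_ge0.
have c1 : K ^+ 2 * (\sum_(m < n) (2 * m%:R + 1) * surv m) <= K ^+ 2 * (2 * C ^+ 2) by rewrite ler_wpM2l.
have c2 : 2 * K ^+ 2 * C ^+ 2 * (\sum_(k < n) k.+1%:R * renew k) <=
    2 * K ^+ 2 * C ^+ 2 * C by rewrite ler_wpM2l.
have c3 : (\sum_(k < n) renew k) * (D * K ^+ 2 * n%:R) <= 1 * (D * K ^+ 2 * n%:R).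
  by rewrite ler_wpM2r// !mulr_ge0.
rewrite (le_trans (lerD (lerD c1 c2) c3))// -natr1 mul1r.
by rewrite /D le_eqVlt; apply/orP; left; apply/eqP; ring.
Qed.

End second_moment.

(** * Mean convergence by truncation *)

Section mean_convergence.
Variable f : site d -> R.
Hypothesis f_le_l1 : forall z, 0 <= f z <= l1 z.

Let B := M `^ p.

Let B0 : 0 <= B. Proof. exact: powR_ge0. Qed.

Let f0 z : 0 <= f z. Proof. by have /andP[] := f_le_l1 z. Qed.

Lemma mean_le_l1 r : good r -> (\esum_(z in [set: site d]) (f z * sprob u z r)%:E <= B%:E)%E.
Proof. by move=> gr; apply: (good_mean u delta M p p1 f r gr) => z; have /andP[] := f_le_l1 z. Qed.

Let fmin K z := Num.min (f z) K.
Let frest K z := f z - fmin K z.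

(** The truncated part is handled by its second moment, with [c] free to be optimised in
    [mean_norm_sqr]. The rest has one-step mean at most M^p K^(1-p), which is paid twice per step:
    for its sum and for its speed. *)
Lemma mean_deviation (K c : R) n : 0 < K -> 0 < c ->
  mean (fun s => `|asum f (steps n s) - n%:R * speed f|) <=
  c + (2 * C ^+ 2 + 2 * C ^+ 3) * K ^+ 2 * n.+1%:R / c + 2 * n%:R * (B / K `^ (p - 1)).
Proof.
move=> K0 c0.
have min0 z : 0 <= fmin K z <= K by rewrite /fmin le_min f0 ltW//= ge_min lexx orbT.
have minf0 z : 0 <= fmin K z by have /andP[] := min0 z.
have rest0 z : 0 <= frest K z by rewrite subr_ge0 /fmin ge_min lexx.
have fE z : f z = fmin K z + frest K z by rewrite /frest addrC subrK.
pose L := B / K `^ (p - 1).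
have L0 : 0 <= L by rewrite divr_ge0 ?powR_ge0.
have restL r : good r -> (\esum_(z in [set: site d]) (frest K z * sprob u z r)%:E <= L%:E)%E.
  by move=> gr; exact: (good_tail u delta M p p1 f K r gr K0 f_le_l1).
have minB r : good r -> (\esum_(z in [set: site d]) (fmin K z * sprob u z r)%:E <= B%:E)%E.
  move=> gr; apply: (good_mean u delta M p p1 _ r gr) => z.
  by have /andP[_] := f_le_l1 z; apply: le_trans; rewrite /fmin ge_min lexx.
have alive01 y : 0 <= ((alive y)%:R : R) <= 1 by rewrite ler0n lern1 leq_b1.
have speedD : speed f = speed (fmin K) + speed (frest K).
  rewrite /speed -mulrDl; congr (_ / _).
  have c1 := cvg_cycle (fmin K) B minf0 minB B0.
  have c2 := cvg_cycle (frest K) L rest0 restL L0.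
  have -> : series (cycle_term f) =
      (fun m => series (cycle_term (fmin K)) m + series (cycle_term (frest K)) m).
    apply/funext => m; rewrite /series/= -big_split/=.
    apply: eq_bigr => j _; rewrite /cycle_term -meanD.
    - by apply: eq_mean => s; rewrite fE mulrDr.
    - exact: (itg_weighted (fmin K) B minf0 minB B0 j (fun y => (alive y)%:R) alive01).
    - exact: (itg_weighted (frest K) L rest0 restL L0 j (fun y => (alive y)%:R) alive01).
  exact: limD.
have sumc x : \sum_(i < n) x = n%:R * x :> R by rewrite sumr_const card_ord mulr_natl.
have i1 : itg (fun s => asum (fmin K) (steps n s) - n%:R * speed (fmin K)).
  by apply: itgB; [exact: (itg_asum _ B minf0 minB B0)|exact: itg_cst].
have i2 := itg_asum (frest K) L rest0 restL L0 n.
have i3 : itg (fun s => (asum (fmin K) (steps n s) - n%:R * speed (fmin K)) ^+ 2).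
  apply: (itg_bounded _ _ ((n%:R * K + n%:R * `|speed (fmin K)|) ^+ 2)).
    exact: (measurable_of_steps n (fun y => (asum (fmin K) y - n%:R * speed (fmin K)) ^+ 2)).
  move=> s; rewrite normrX ler_pXn2r ?nnegrE ?addr_ge0 ?mulr_ge0 ?(ltW K0)//.
  rewrite (le_trans (ler_normB _ _))// normrM normr_nat lerD2r asum_steps.
  rewrite ger0_norm ?sumr_ge0// -sumc.
  by apply: ler_sum => i _; have /andP[] := min0 (xi i s).
have one01 (y : seq (site d)) : 0 <= (1 : R) <= 1 by rewrite ler01 lexx.
have tail_avg : mean (fun s => asum (frest K) (steps n s)) <= n%:R * L.
  under [leLHS]eq_mean do rewrite asum_steps.
  rewrite mean_sum; last by move=> i; exact: (itg_fstep _ L rest0 restL L0).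
  rewrite -sumc; apply: ler_sum => i _.
  have := mean_weighted _ L rest0 restL L0 i (fun=> 1) one01.
  rewrite (mean_cst Pr 1) mulr1; apply: le_trans.
  by under [leRHS]eq_mean do rewrite mul1r.
have v0 := speed_ge0 _ L rest0 restL L0; have vL := speed_le _ L rest0 restL L0.
apply: (@le_trans _ _ (mean (fun s => `|asum (fmin K) (steps n s) - n%:R * speed (fmin K)|
    + (asum (frest K) (steps n s) + n%:R * speed (frest K))))).
  apply: mean_le.
  - apply: itg_abs; apply: itgB; last exact: itg_cst.
    exact: (itg_asum _ B f0 mean_le_l1 B0).
  - by apply: itgD; [exact: itg_abs|apply: itgD => //; exact: itg_cst].
  - move=> s.
    have -> : asum f (steps n s) = asum (fmin K) (steps n s) + asum (frest K) (steps n s).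
      by rewrite /asum -big_split/=; apply: eq_bigr => z _.
    have a0 : 0 <= asum (frest K) (steps n s) by exact: asum_ge0.
    have b0 : 0 <= n%:R * speed (frest K) by rewrite mulr_ge0.
    rewrite speedD mulrDr opprD addrACA (le_trans (ler_normD _ _))// lerD2l.
    by rewrite (le_trans (ler_normB _ _))// !ger0_norm.
rewrite meanD; [|exact: itg_abs|by apply: itgD => //; exact: itg_cst].
rewrite meanD//; last exact: itg_cst.
rewrite (mean_cst Pr) -/L; apply: lerD.
  apply: (le_trans (mean_norm_sqr _ _ c i1 i3 c0)).
  rewrite lerD2l ler_pM2r ?invr_gt0//; exact: (second_moment (fmin K) K min0).
have -> : 2 * n%:R * L = n%:R * L + n%:R * L by ring.
by rewrite lerD// ler_wpM2l.
Qed.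

End mean_convergence.

(* Chosen so that [a ^+ 2 <= (a ^+ rate) `^ (p - 1)] for [1 <= a]: the truncation
   height K = a ^+ rate is used at time K ^+ 4, with threshold K ^+ 3 in
   [mean_deviation]. *)
Definition rate : nat := (Num.bound (2 / (p - 1))).+2.

Lemma deviation_rate : exists2 B' : R, 0 <= B' &
  forall f, (forall z, 0 <= f z <= l1 z) -> forall k,
  mean (fun s => `|asum f (steps (k.+1 ^ (rate * 4)) s) / (k.+1 ^ (rate * 4))%:R - speed f|)
  <= B' / k.+1%:R ^+ 2.
Proof.
pose D := 2 * C ^+ 2 + 2 * C ^+ 3.
have D0 : 0 <= D by rewrite addr_ge0// mulr_ge0// exprn_ge0.
have B0 : 0 <= M `^ p by exact: powR_ge0.
(* With x = a^rate, dividing by the time x^4 turns the three terms of [mean_deviation] into 1 / x, D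
   (1 + x^-4) / x and 2 M^p x^(1-p), and a^2 is at most both x and x^(p-1). *)
exists (1 + 2 * D + 2 * M `^ p); first by rewrite !addr_ge0// mulr_ge0.
move=> f fl k; pose a : R := k.+1%:R.
have a1 : 1 <= a by rewrite ler1n.
have a0 : 0 < a by rewrite ltr0n.
pose x := a ^+ rate.
have x0 : 0 < x by rewrite exprn_gt0.
have ax : a ^+ 2 <= x by rewrite /x ler_weXn2l.
have xp : a ^+ 2 <= x `^ (p - 1).
  have -> : x `^ (p - 1) = a `^ (rate%:R * (p - 1)).
    by rewrite /x -(powR_mulrn rate (ltW a0)) -powRrM.
  rewrite -(powR_mulrn 2 (ltW a0)) ler_powR//.
  rewrite -ler_pdivrMr ?subr_gt0// (le_trans (ltW (archi_boundP _)))//.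
    by rewrite divr_ge0// subr_ge0 ltW.
  by rewrite ler_nat /rate; apply: leqW; apply: leqW.
set n := (k.+1 ^ (rate * 4))%N.
have nE : n%:R = x ^+ 4 :> R by rewrite /n natrX exprM.
have n0 : 0 < n%:R :> R by rewrite nE exprn_gt0.
have x30 : 0 < x ^+ 3 by rewrite exprn_gt0.
have f0 z : 0 <= f z by have /andP[] := fl z.
have idev : itg (fun s => `|asum f (steps n s) - n%:R * speed f|).
  apply: itg_abs; apply: itgB; last exact: itg_cst.
  exact: (itg_asum f (M `^ p) f0 (mean_le_l1 f fl) B0).
have -> : mean (fun s => `|asum f (steps n s) / n%:R - speed f|) =
    n%:R^-1 * mean (fun s => `|asum f (steps n s) - n%:R * speed f|).
  rewrite -meanZ//; apply: eq_mean => s.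
  have nV : `|n%:R^-1| = n%:R^-1 :> R by rewrite ger0_norm ?invr_ge0// ltW.
  rewrite -{2}nV -normrM; congr (`|_|).
  by rewrite mulrBr mulrA mulVf ?gt_eqF// mul1r mulrC.
have H := mean_deviation f fl x (x ^+ 3) n x0 x30.
apply: (@le_trans _ _ (n%:R^-1 * (x ^+ 3 + D * x ^+ 2 * n.+1%:R / x ^+ 3 +
  2 * n%:R * (M `^ p / x `^ (p - 1))))).
  by rewrite ler_wpM2l// invr_ge0 ltW.
have xp0 : 0 < x `^ (p - 1) by rewrite powR_gt0.
have i1 : x^-1 <= (a ^+ 2)^-1 by rewrite lef_pV2 ?posrE// exprn_gt0.
have i2 : (x `^ (p - 1))^-1 <= (a ^+ 2)^-1 by rewrite lef_pV2 ?posrE// exprn_gt0.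
have E : n%:R^-1 * (x ^+ 3 + D * x ^+ 2 * n.+1%:R / x ^+ 3 +
    2 * n%:R * (M `^ p / x `^ (p - 1))) =
    x^-1 + D * (1 + (x ^+ 4)^-1) * x^-1 + 2 * M `^ p * (x `^ (p - 1))^-1.
  by rewrite -natr1 nE; field; rewrite !gt_eqF.
have i3 : (x ^+ 4)^-1 <= 1.
  by rewrite invf_le1 ?exprn_gt0// exprn_ege1// exprn_ege1.
have j1 : D * (1 + (x ^+ 4)^-1) * x^-1 <= D * 2 * (a ^+ 2)^-1.
  rewrite ler_pM ?invr_ge0 ?(ltW x0)//; first by rewrite mulr_ge0// addr_ge0// invr_ge0 exprn_ge0// ltW.
  by rewrite ler_wpM2l//; lra.
have j2 : 2 * M `^ p * (x `^ (p - 1))^-1 <= 2 * M `^ p * (a ^+ 2)^-1.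
  by rewrite ler_wpM2l// mulr_ge0.
have -> : (1 + 2 * D + 2 * M `^ p) / k.+1%:R ^+ 2 =
    (a ^+ 2)^-1 + D * 2 * (a ^+ 2)^-1 + 2 * M `^ p * (a ^+ 2)^-1.
  by rewrite -/a; field; rewrite gt_eqF.
by rewrite E; exact: lerD (lerD i1 j1) j2.
Qed.

Lemma asum_lln f : (forall z, 0 <= f z <= l1 z) ->
  {ae Pr, forall s, asum f (steps n s) / n%:R @[n --> \oo] --> speed f}.
Proof.
move=> fl; have [B' B'0 HB] := deviation_rate.
have f0 z : 0 <= f z by have /andP[] := fl z.
have B0 : 0 <= M `^ p by exact: powR_ge0.
pose nu k := (k.+1 ^ (rate * 4))%N.
pose F k s := `|asum f (steps (nu k) s) / (nu k)%:R - speed f|.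
have mF k : measurable_fun setT (F k).
  exact: (measurable_of_steps (nu k) (fun y => `|asum f y / (nu k)%:R - speed f|)).
have iF k : itg (F k).
  apply: itg_abs; apply: itgB; last exact: itg_cst.
  have := itgZ Pr (nu k)%:R^-1 _ (itg_asum f (M `^ p) f0 (mean_le_l1 f fl) B0 (nu k)).
  by under eq_fun do rewrite mulrC.
have : {ae Pr, forall s, F k s @[k --> \oo] --> 0}.
  apply: (ae_cvg0 Pr F (fun k => B' / k.+1%:R ^+ 2) (B' * 2)) => //.
  - by move=> k s; exact: normr_ge0.
  - by move=> k; rewrite (meanE Pr (F k) (iF k)) lee_fin; exact: HB.
  - by move=> n; rewrite -mulr_sumr ler_wpM2l// sum_inv_sq.
apply: filterS => s Fs.
apply: (@cvg_ratio_subseq _ _ _ (rate * 4)) => //.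
- by move=> n; exact: asum_ge0.
- by apply/nondecreasing_seqP => n; rewrite steps_rcons asum_rcons lerDl.
- exact: (speed_ge0 f _ f0 (mean_le_l1 f fl) B0).
apply/cvgrPdist_le => e e0; move/cvgrPdist_le : Fs => /(_ e e0).
by apply: filterS => k; rewrite sub0r normrN normr_id distrC.
Qed.

End renewal.

(** * The stationary measure *)

Section quenched.
Context {R : realType} {d : nat} (u : 'rV[R]_d) (delta M p : R).
Local Open Scope ereal_scope.
Implicit Types (w : env R d) (Phi : seq (site d) -> R).

Notation good_env := (good_env u delta M p).

(** The quenched mean of [Phi] over the first [n] increments, without a space of trajectories.
    Through [weight] it reads the environment at sites of nonnegative level only. *)
Definition qmean (n : nat) Phi w : \bar R :=
  \esum_(y in [set: seq (site d)]) (if size y == n then (weight u y w * Phi y)%:E else 0).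

Let term_ge0 (n : nat) Phi w y : (forall y, (0 <= Phi y)%R) ->
  0 <= (if size y == n then (weight u y w * Phi y)%:E else 0).
Proof. by move=> Phi0; case: ifP => // _; rewrite lee_fin mulr_ge0// weight_ge0. Qed.

Lemma qmean_ge0 n Phi w : (forall y, (0 <= Phi y)%R) -> 0 <= qmean n Phi w.
Proof. by move=> Phi0; apply: esum_ge0 => y _; exact: term_ge0. Qed.

Lemma measurable_qmean n Phi dY (Y : measurableType dY) (phi : Y -> env R d) :
  (forall y, (0 <= Phi y)%R) ->
  (forall x z, (0 <= dotu x u)%R -> measurable_fun setT (fun y => phi y x z : R)) ->
  measurable_fun setT (fun y => qmean n Phi (phi y)).
Proof.
move=> Phi0 mphi; apply: measurable_esum => [y t|y]; first exact: term_ge0.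
case: (size y == n) => //; apply/measurable_EFinP; apply: measurable_funM => //.
exact: measurable_weight.
Qed.

Lemma qmean_nil Phi w : (forall y, (0 <= Phi y)%R) -> qmean 0%N Phi w = (Phi [::])%:E.
Proof.
move=> Phi0; rewrite /qmean (esumID [set [::]])//; last by move=> y _; exact: term_ge0.
rewrite setTI esum_set1/= ?mul1r ?lee_fin// esum1 ?adde0//.
by move=> y [_ /= y0]; rewrite size_eq0; case: eqP.
Qed.

Lemma qmean_step n Phi w : (forall y, (0 <= Phi y)%R) ->
  qmean n.+1 Phi w = \esum_(z in [set: site d])
    ((sprob u z (w 0%R))%:E * qmean n (fun y => Phi (z :: y)) (Defs.shift z w)).
Proof.
move=> Phi0.
transitivity (\esum_(z in [set: site d]) \esum_(y in [set: seq (site d)])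
    (if size y == n then (weight u (z :: y) w * Phi (z :: y))%:E else 0)).
  rewrite -(@esum_pair _ _ _ (fun t => if size t.2 == n then
     (weight u (t.1 :: t.2) w * Phi (t.1 :: t.2))%:E else 0)); last first.
    by case=> z y; case: ifP => // _; rewrite lee_fin mulr_ge0// weight_ge0.
  rewrite /qmean (esumID [set y | y <> [::]])//; last by move=> y _; exact: term_ge0.
  rewrite [X in _ + X]esum1 ?adde0; last by move=> y [_ /=]; case: y => // z y /(_ _) H; case: H.
  rewrite (reindex_esum setT _ (fun t : site d * seq (site d) => t.1 :: t.2)).
    by apply: eq_esum => -[z y] _ /=; rewrite eqSS.
  split => //=.
  - by move=> [z1 y1] [z2 y2] _ _ /= [-> ->].
  - by move=> [|z y] [_ /=] // _; exists (z, y).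
apply: eq_esum => z _; rewrite -esumZl ?sprob_ge0//.
  by apply: eq_esum => y _; case: ifP; rewrite ?mule0// -EFinM /= mulrA.
by move=> y; apply: (term_ge0 n (fun y => Phi (z :: y))).
Qed.

Lemma qmean_le n Phi Psi w : (forall y, size y = n -> (Phi y <= Psi y)%R) ->
  qmean n Phi w <= qmean n Psi w.
Proof.
move=> H; apply: le_esum => y _; case: eqP => // yn.
by rewrite lee_fin ler_wpM2l ?weight_ge0// H.
Qed.

Lemma qmeanD n Phi Psi w : (forall y, (0 <= Phi y)%R) -> (forall y, (0 <= Psi y)%R) ->
  qmean n (fun y => Phi y + Psi y)%R w = qmean n Phi w + qmean n Psi w.
Proof.
move=> H1 H2; rewrite /qmean -esumD => [|y _|y _]; try exact: term_ge0.
by apply: eq_esum => y _; case: ifP; rewrite ?adde0// mulrDr.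
Qed.

Lemma qmeanZ n (c : R) Phi w : (0 <= c)%R -> (forall y, (0 <= Phi y)%R) ->
  qmean n (fun y => c * Phi y)%R w = c%:E * qmean n Phi w.
Proof.
move=> c0 H; rewrite /qmean -esumZl//; last by move=> y; exact: term_ge0.
by apply: eq_esum => y _; case: ifP; rewrite ?mule0// mulrCA.
Qed.

Lemma good_env_shift w z : good_env w -> (0 <= dotu z u)%R -> good_env (Defs.shift z w).
Proof. by move=> gw z0 x x0; apply: gw; rewrite dotuD addr_ge0. Qed.

Lemma good_env0 w : good_env w -> good u delta M p (w 0%R).
Proof. by apply; rewrite dotu0. Qed.

Let eq_forward_esum w (F G : site d -> \bar R) :
  (forall z, (0 <= dotu z u)%R -> F z = G z) ->
  \esum_(z in [set: site d]) ((sprob u z (w 0%R))%:E * F z) =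
  \esum_(z in [set: site d]) ((sprob u z (w 0%R))%:E * G z).
Proof.
move=> FG; apply: eq_esum => z _; have [z0|z0] := boolP (0 <= dotu z u)%R; first by rewrite FG.
by rewrite /sprob (negbTE z0) !mul0e.
Qed.

(** On [good_env] the path weights of each length have total mass 1: forward shifts preserve
    [good_env], and backward steps have weight 0. *)
Lemma qmean_cst n (c : R) w : (0 <= c)%R -> good_env w -> qmean n (fun=> c) w = c%:E.
Proof.
move=> c0; elim: n w => [|n IH] w gw; first by rewrite qmean_nil.
rewrite qmean_step// (eq_forward_esum w _ (fun=> c%:E)); last first.
  by move=> z z0; apply: IH; exact: good_env_shift.
have [_ w1 _ _] := good_env0 w gw.
under eq_esum do rewrite muleC.
by rewrite esumZl ?w1 ?mule1// => z; rewrite lee_fin sprob_ge0.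
Qed.

Section additive_functional.
Variables (f : site d -> R) (L : R).
Hypothesis f0 : forall z, (0 <= f z)%R.
Hypothesis L0 : (0 <= L)%R.
Hypothesis fL : forall r, good u delta M p r ->
  \esum_(z in [set: site d]) (f z * sprob u z r)%:E <= L%:E.

Definition local_drift w : \bar R := \esum_(z in [set: site d]) (f z * sprob u z (w 0%R))%:E.

Lemma measurable_local_drift : measurable_fun setT (local_drift : Env R d -> \bar R).
Proof.
apply: measurable_esum => [z w|z]; first by rewrite lee_fin mulr_ge0 ?sprob_ge0.
apply/measurable_EFinP; apply: measurable_funM => //.
by apply: measurable_sprob; exact: measurable_Env_coord.
Qed.

Lemma local_drift_ge0 w : 0 <= local_drift w.
Proof. by apply: esum_ge0 => z _; rewrite lee_fin mulr_ge0 ?sprob_ge0. Qed.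

Lemma qmean_asum_step n w : good_env w -> qmean n.+1 (asum f) w = local_drift w +
  \esum_(z in [set: site d]) ((sprob u z (w 0%R))%:E * qmean n (asum f) (Defs.shift z w)).
Proof.
move=> gw; rewrite qmean_step; last by move=> y; exact: asum_ge0.
rewrite (eq_forward_esum w _ (fun z => (f z)%:E + qmean n (asum f) (Defs.shift z w))); last first.
  move=> z z0; rewrite -(qmean_cst n (f z) (Defs.shift z w))//; last exact: good_env_shift.
  rewrite -qmeanD//; last by move=> y; exact: asum_ge0.
  by apply: eq_esum => y _; rewrite /asum big_cons.
rewrite /local_drift -esumD//.
- apply: eq_esum => z _; rewrite ge0_muleDr ?lee_fin//; last first.
    by apply: qmean_ge0 => y; exact: asum_ge0.
  by rewrite -EFinM [(sprob _ _ _ * _)%R]mulrC.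
- by move=> z _; rewrite lee_fin mulr_ge0 ?sprob_ge0.
- move=> z _; rewrite mule_ge0 ?lee_fin ?sprob_ge0//.
  by apply: qmean_ge0 => y; exact: asum_ge0.
Qed.

Lemma qmean_asum_le n w : good_env w -> qmean n (asum f) w <= (n%:R * L)%:E.
Proof.
elim: n w => [|n IH] w gw.
  by rewrite qmean_nil ?mul0r ?/asum ?big_nil// => y; exact: asum_ge0.
have -> : (n.+1%:R * L)%:E = L%:E + (n%:R * L)%:E.
  by rewrite -EFinD -natr1; congr (_%:E); ring.
rewrite qmean_asum_step//; apply: leeD.
  exact: (fL _ (good_env0 w gw)).
rewrite -(qmean_cst n.+1 (n%:R * L) w) ?mulr_ge0// qmean_step ?mulr_ge0//.
apply: le_esum => z _; have [z0|z0] := boolP (0 <= dotu z u)%R; last first.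
  by rewrite /sprob (negbTE z0) !mul0e.
apply: lee_wpmul2l; first by rewrite lee_fin sprob_ge0.
have gz := good_env_shift w z gw z0.
by rewrite qmean_cst ?mulr_ge0//; exact: IH.
Qed.

(** * Transfer to the stationary measure *)

Section stationary.
Variables (P Q : probability (Env R d) R).
Hypothesis PQ : Pinfty_spec u P Q.
Hypothesis goodP : {ae P, forall w : Env R d, forall x : site d, good u delta M p (w x)}.

Let G0 : set (set (env R d)) := [set A | exists (x y : site d) (B : set R),
  [/\ measurable B, (0%:~R <= dotu x u)%R & A = [set w | B (w x y)]]].

Let coord_S0 x z : (0 <= dotu x u)%R ->
  measurable_fun setT (fun w : g_sigma_algebraType G0 => w x z : R).
Proof.
move=> x0 _ B mB; rewrite setTI; apply: sub_sigma_algebra; exists x, z, B; split => //.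
Qed.

Let S0_Env (A : set (env R d)) : S_k u 0 A -> measurable (A : set (Env R d)).
Proof.
apply: smallest_sub; first exact: sigma_algebra_measurable.
move=> _ [x [y [B [mB _ ->]]]]; rewrite -[X in measurable X]setTI.
exact: (measurable_Env_coord x y).
Qed.

(** Absolute continuity on the half-space, applied to the complement of [A]. *)
Lemma ae_stationary (A : set (env R d)) : S_k u 0 A ->
  {ae P, forall w : Env R d, A w} -> {ae Q, forall w : Env R d, A w}.
Proof.
move=> SA PA; have [_ ac _] := PQ.
have mA := S0_Env A SA.
have SCA : S_k u 0 (~` A).
  exact: (@measurableC _ (g_sigma_algebraType G0) A SA).
exists (~` A); split => //; first exact: measurableC.
apply: (ac 0%R) => //.
have [N [mN N0 AN]] := PA.
by apply: (subset_measure0 _ mN AN N0); exact: measurableC.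
Qed.

Lemma good_env_stationary : {ae Q, forall w : Env R d, good_env w}.
Proof.
apply: ae_stationary; first exact: good_env_S_0.
have FP : Filter (nbhs (almost_everywhere P)) by exact: (@ae_filter_ringOfSetsType _ (Env R d) R P).
by apply: filterS goodP => w gw x _.
Qed.

Let filterQ : Filter (nbhs (almost_everywhere Q)).
Proof. exact: (@ae_filter_ringOfSetsType _ (Env R d) R Q). Qed.

Let msprob z : measurable_fun setT (fun w : Env R d => sprob u z (w 0%R)).
Proof. by apply: measurable_sprob; exact: measurable_Env_coord. Qed.

(** Invariance is given on indicators and with the raw entries of the environment. These agree with
    [sprob] almost everywhere for [Q], and [integral_weighted] extends the identity to functions. *)
Lemma stationary_integral (F : Env R d -> \bar R) : measurable_fun setT F ->
  (forall w, 0 <= F w) ->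
  \int[Q]_w (\esum_(z in [set: site d]) ((sprob u z (w 0%R))%:E * F (Defs.shift z w))) =
  \int[Q]_w F w.
Proof.
move=> mF F0.
apply: (integral_weighted Q Q (fun z (w : Env R d) => sprob u z (w 0%R))
  (fun z w => Defs.shift z w)) => //.
- by move=> z w; exact: sprob_ge0.
- by move=> z; exact: measurable_shift.
have FQ := filterQ; move=> A mA; have [inv _ _] := PQ; apply: (etrans _ (esym (inv A mA))).
have m1 z : measurable_fun setT (fun w : Env R d => (\1_A (Defs.shift z w))%:E : \bar R).
  apply/measurable_EFinP.
  exact: (measurableT_comp (measurable_indic mA) (measurable_shift z)).
apply: ae_eq_integral => //.
- apply: measurable_esum => [z w|z]; first by rewrite mule_ge0 ?lee_fin ?sprob_ge0.
  by apply: emeasurable_funM => //; exact/measurable_EFinP.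
(* Off the good environments raw terms may be negative; the sum is replaced by that of their
   positive parts. *)
- rewrite (_ : (fun w => pihat w A) = (fun w => \esum_(z in [set: site d])
      maxe ((pitr 0%R z w)%:E * (\1_A (Defs.shift z w))%:E) 0)); last first.
    by apply/funext => w; exact: esum_max0.
  apply: measurable_esum => [z w|z]; first by rewrite le_max lexx orbT.
  apply: measurable_maxe => //; apply: emeasurable_funM => //.
  by apply/measurable_EFinP; exact: measurable_Env_coord.
apply: filterS good_env_stationary => w gw _; apply: eq_esum => z _.
by have [E _ _ _] := good_env0 w gw; rewrite -E /pitr subr0.
Qed.

Let mq n : measurable_fun setT (fun w : Env R d => qmean n (asum f) w).
Proof.
by apply: measurable_qmean => [y|x z _]; [exact: asum_ge0|exact: measurable_Env_coord].
Qed.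

(** Peeling off the first step leaves [local_drift] plus the quenched mean seen after one step, and
    invariance removes that step. *)
Lemma integral_qmean n : \int[Q]_w qmean n (asum f) w = n%:R%:E * \int[Q]_w local_drift w.
Proof.
have FQ := filterQ.
have q0 m w : 0 <= qmean m (asum f) w by apply: qmean_ge0 => y; exact: asum_ge0.
elim: n => [|n IH].
  rewrite mul0e; under eq_integral.
    move=> w _; rewrite qmean_nil; last by move=> y; exact: asum_ge0.
    by rewrite /asum big_nil; over.
  by rewrite integral0.
have mS : measurable_fun setT (fun w : Env R d =>
    \esum_(z in [set: site d]) ((sprob u z (w 0%R))%:E * qmean n (asum f) (Defs.shift z w))).
  apply: measurable_esum => [z w|z]; first by rewrite mule_ge0 ?lee_fin ?sprob_ge0.
  apply: emeasurable_funM; first exact/measurable_EFinP.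
  exact: (measurableT_comp (mq n) (measurable_shift z)).
have S0' w : 0 <= \esum_(z in [set: site d])
    ((sprob u z (w 0%R))%:E * qmean n (asum f) (Defs.shift z w)).
  by apply: esum_ge0 => z _; rewrite mule_ge0 ?lee_fin ?sprob_ge0.
transitivity (\int[Q]_w (local_drift w +
  \esum_(z in [set: site d]) ((sprob u z (w 0%R))%:E * qmean n (asum f) (Defs.shift z w)))).
  apply: ae_eq_integral => //.
  - by apply: emeasurable_funD => //; exact: measurable_local_drift.
  - by apply: filterS good_env_stationary => w gw _; exact: qmean_asum_step.
rewrite ge0_integralD//; last 2 first.
- by move=> w _; exact: local_drift_ge0.
- exact: measurable_local_drift.
rewrite (stationary_integral (fun w => qmean n (asum f) w))// IH.
have I0 : 0 <= \int[Q]_w local_drift w by apply: integral_ge0 => w _; exact: local_drift_ge0.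
rewrite -natr1 EFinD ge0_muleDl ?lee_fin// mul1e addeC//.
Qed.

Variables (v : R) (nu : nat -> nat) (c : nat -> R) (B : R).
Hypothesis v0 : (0 <= v)%R.
Hypothesis nu0 : forall k, (0 < nu k)%N.
Hypothesis cB : forall n, (\sum_(k < n) c k <= B)%R.
Hypothesis rateP : forall k,
  \int[P]_w qmean (nu k) (fun y => `|asum f y / (nu k)%:R - v|)%R w <= (c k)%:E.

Let e k (w : env R d) := qmean (nu k) (fun y => `|asum f y / (nu k)%:R - v|)%R w.

Let e0 k w : 0 <= e k w.
Proof. by apply: qmean_ge0 => y; exact: normr_ge0. Qed.

Let se0 w : 0 <= \sum_(k <oo) e k w. Proof. exact: nneseries_ge0. Qed.

(** Summability is the finiteness of one measurable series, hence an event of [S_k u 0], and it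
    forces the errors to tend to 0. *)
Let cvg_event : set (env R d) := [set w | \sum_(k <oo) e k w < +oo].

Let measurable_se dY (Y : measurableType dY) (phi : Y -> env R d) :
  (forall x z, (0 <= dotu x u)%R -> measurable_fun setT (fun y => phi y x z : R)) ->
  measurable_fun setT (fun y => \sum_(k <oo) e k (phi y)).
Proof.
move=> mphi.
apply: (@ge0_emeasurable_sum _ _ _ setT (fun k y => e k (phi y)) xpredT) => // k _.
by apply: measurable_qmean => // y; exact: normr_ge0.
Qed.

Let cvg_event_stationary : {ae Q, forall w : Env R d, cvg_event w}.
Proof.
apply: ae_stationary.
  have := @measurable_lte _ (g_sigma_algebraType G0) R setT measurableT
    (fun w => \sum_(k <oo) e k w) (cst +oo) (measurable_se _ _ _ coord_S0) (measurable_cst _).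
  by rewrite setTI.
have mse : measurable_fun setT (fun w : Env R d => \sum_(k <oo) e k w).
  by apply: measurable_se => x z _; exact: measurable_Env_coord.
have is_int : P.-integrable setT (fun w : Env R d => \sum_(k <oo) e k w).
  apply/integrableP; split => //.
  under eq_integral do rewrite gee0_abs//.
  rewrite integral_nneseries//; last first.
    move=> k; apply: measurable_qmean => [y|x z _]; first exact: normr_ge0.
    exact: measurable_Env_coord.
  apply: (@le_lt_trans _ _ B%:E); last by rewrite ltry.
  apply: lime_le; first by apply: is_cvg_nneseries => k _ _; exact: integral_ge0.
  apply: nearW => n; apply: (@le_trans _ _ (\sum_(0 <= k < n) (c k)%:E)).
    by apply: lee_sum => k _; exact: rateP.
  by rewrite sumEFin lee_fin big_mkord.
have FP : Filter (nbhs (almost_everywhere P)) by exact: (@ae_filter_ringOfSetsType _ (Env R d) R P).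
have := integrable_ae measurableT is_int.
by apply: filterS => w /(_ Logic.I); rewrite ge0_fin_numE.
Qed.

Let ratio k w : \bar R := ((nu k)%:R^-1)%:E * qmean (nu k) (asum f) w.

(** The constant [v] is its own quenched mean, so the average differs from it by at most [e k], the
    term of a convergent series. *)
Let ratio_cvg w : good_env w -> cvg_event w -> ratio k w @[k --> \oo] --> v%:E.
Proof.
move=> gw cw.
have nuR k : (0 < (nu k)%:R :> R)%R by rewrite ltr0n.
have a0 k y : (0 <= asum f y / (nu k)%:R)%R by rewrite divr_ge0// asum_ge0.
have ratioE k : ratio k w = qmean (nu k) (fun y => asum f y / (nu k)%:R)%R w.
  rewrite /ratio -qmeanZ ?invr_ge0//; last by move=> y; exact: asum_ge0.
  rewrite (_ : (fun y => (nu k)%:R^-1 * asum f y)%R = (fun y => asum f y / (nu k)%:R)%R)//.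
  by apply/funext => y; exact: mulrC.
have up k : ratio k w <= v%:E + e k w.
  rewrite ratioE -(qmean_cst (nu k) v w)// /e -qmeanD//.
  apply: qmean_le => y _; rewrite -lerBlDl; exact: ler_norm.
have lo k : v%:E <= ratio k w + e k w.
  rewrite ratioE -(qmean_cst (nu k) v w)// /e -qmeanD//.
  by apply: qmean_le => y _; rewrite -lerBlDl distrC ler_norm.
have ec : e k w @[k --> \oo] --> 0.
  have tail0 := @nneseries_tail_cvg R (fun k => e k w) xpredT cw (fun k _ => e0 k w).
  apply: (@squeeze_cvge _ _ _ _ (cst 0) _ (fun k => \sum_(k <= j <oo) e j w)) => //.
    apply: nearW => k; rewrite /= e0/=.
    have := @nneseries_lim_ge R (fun k => e k w) xpredT k k.+1 (fun n _ _ => e0 n w).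
    by rewrite big_nat1.
  exact: cvg_cst.
have efin k : e k w \is a fin_num.
  rewrite ge0_fin_numE//; apply: le_lt_trans cw.
  have := @nneseries_lim_ge R (fun k => e k w) xpredT 0%N k.+1 (fun n _ _ => e0 n w).
  by apply: le_trans; rewrite big_nat_recr//= leeDr// sume_ge0.
apply: (@squeeze_cvge _ _ _ _ (fun k => v%:E - e k w) _ (fun k => v%:E + e k w)).
- by apply: nearW => k; rewrite up leeBlDr// lo.
- rewrite -[X in _ --> X](sube0 v%:E); apply: cvgeB => //; first exact: cvg_cst.
- rewrite -[X in _ --> X](adde0 v%:E); apply: cvgeD => //; exact: cvg_cst.
Qed.

(** By [integral_qmean] the integral of [ratio k] does not depend on [k], while [ratio k] tends to
    [v] and stays below [L]: dominated convergence. *)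
Lemma stationary_drift : \int[Q]_w local_drift w = v%:E.
Proof.
have nuR k : (0 < (nu k)%:R :> R)%R by rewrite ltr0n.
have FQ := filterQ.
have q0 k w : 0 <= qmean k (asum f) w by apply: qmean_ge0 => y; exact: asum_ge0.
have ratio_int k : \int[Q]_w ratio k w = \int[Q]_w local_drift w.
  rewrite /ratio ge0_integralZl ?lee_fin ?invr_ge0// integral_qmean.
  by rewrite muleA -EFinM mulVf ?gt_eqF// mul1e.
have mratio k : measurable_fun setT (fun w : Env R d => ratio k w).
  exact: measurable_funeM.
have ratio0 k w : 0 <= ratio k w by rewrite mule_ge0 ?lee_fin ?invr_ge0.
have c1 : {ae Q, forall w : Env R d, setT w -> ratio ^~ w @ \oo --> (cst v%:E : Env R d -> \bar R) w}.
  by apply: filterS2 good_env_stationary cvg_event_stationary => w gw cw _; exact: ratio_cvg.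
have c2 : {ae Q, forall (w : Env R d) (k : nat), setT w -> `|ratio k w| <= (cst L%:E : Env R d -> \bar R) w}.
  apply: filterS good_env_stationary => w gw k _.
  rewrite gee0_abs//= /ratio.
  have -> : L%:E = ((nu k)%:R^-1)%:E * ((nu k)%:R * L)%:E.
    by rewrite -EFinM mulrA mulVf ?gt_eqF// mul1r.
  apply: lee_wpmul2l; first by rewrite lee_fin invr_ge0.
  exact: qmean_asum_le.
have [_ _] := @dominated_convergence _ (Env R d) R Q setT measurableT ratio (cst v%:E) (cst L%:E)
  mratio (measurable_cst _) c1 (finite_measure_integrable_cst Q L measurableT) c2.
under eq_fun do rewrite ratio_int.
have iv : \int[Q]_w (cst v%:E : Env R d -> \bar R) w = v%:E.
  apply: (etrans (@integral_cst _ (Env R d) R Q setT measurableT v%:E)).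
  exact: (etrans (congr1 (mule v%:E) (@probability_setT _ (Env R d) R Q)) (mule1 _)).
rewrite iv => cv; apply: cvg_unique cv; [exact: ereal_hausdorff|exact: cvg_cst].
Qed.

End stationary.
End additive_functional.
End quenched.

(** * Coordinates and first passage *)

Definition cpos {R : realType} {d : nat} (i : 'I_d) (z : site d) : R :=
  Num.max (z ord0 i)%:~R 0.
Definition cneg {R : realType} {d : nat} (i : 'I_d) (z : site d) : R :=
  Num.max (- (z ord0 i)%:~R) 0.

Section coordinates.
Context {R : realType} {d : nat} (i : 'I_d).
Implicit Types (z : site d) (y : seq (site d)).

Lemma cposBneg z : (cpos i z : R) - cneg i z = (z ord0 i)%:~R.
Proof.
rewrite /cpos /cneg; set a := (_)%:~R.
have [a0|a0] := leP 0 a; first by rewrite (max_idPr _) ?oppr_le0// subr0.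
by rewrite (max_idPl _) ?oppr_ge0 ?(ltW a0)// sub0r opprK.
Qed.

Lemma cpos_le_l1 z : 0 <= (cpos i z : R) <= l1 z.
Proof.
rewrite /cpos le_max lexx orbT ge_max l1_ge0 andbT.
by apply: le_trans (coord_le_l1 z i); exact: ler_norm.
Qed.

Lemma cneg_le_l1 z : 0 <= (cneg i z : R) <= l1 z.
Proof.
rewrite /cneg le_max lexx orbT ge_max l1_ge0 andbT.
by apply: le_trans (coord_le_l1 z i); rewrite -normrN; exact: ler_norm.
Qed.

Lemma disp_coord y : ((disp y) ord0 i)%:~R = asum (cpos i) y - asum (cneg i) y :> R.
Proof.
rewrite /disp /asum -sumrB summxE rmorph_sum /=.
by apply: eq_bigr => z _; rewrite cposBneg.
Qed.

End coordinates.

Section velocity.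
Context {R : realType} {d : nat} (u : 'rV[R]_d) (delta M p : R).
Hypothesis p1 : 1 < p.
Context (P : probability (Env R d) R).
Context {dS : measure_display} {S : measurableType dS} (Pr : probability S R).
Context (W : S -> Env R d) (X : nat -> S -> site d).
Hypothesis iidP : iid_product P.
Hypothesis walkX : annealed_walk P Pr W X.
Hypothesis goodP : {ae P, forall w : Env R d, forall x : site d, good u delta M p (w x)}.
Context (C : R).
Hypothesis C0 : 0 <= C.
Hypothesis survC : forall n N, \sum_(n <= m < N) surv u Pr X m <= C * surv u Pr X n.
Implicit Types (y : seq (site d)) (z : site d) (f : site d -> R).

Notation steps := (steps X).
Notation speed := (speed u Pr X).

(** Integrated over [P], the path weights give the law of the steps under [Pr]; this carries the
    rates proved for the walk over to quenched means. *)
Lemma annealed_qmean n (Phi : seq (site d) -> R) : (forall y, 0 <= Phi y) ->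
  (\int[P]_w qmean u n Phi w = \int[Pr]_s (Phi (steps n s))%:E)%E.
Proof.
move=> Phi0; have mS := measurable_steps P Pr W X walkX n.
rewrite (integral_discrete (steps n) mS Pr Phi Phi0) /qmean.
have mw y : measurable_fun setT (fun w : Env R d => (weight u y w)%:E).
  by apply/measurable_EFinP; apply: measurable_weight => x z _; exact: measurable_Env_coord.
rewrite (integral_esum (T := seq (site d)) (Y := Env R d) P setT (fun y w =>
  if size y == n then (weight u y w * Phi y)%:E else 0%E))//.
- apply: eq_esum => y _; case: eqP => [<-|yn]; last first.
    rewrite integral0 (_ : _ @^-1` _ = set0) ?measure0 ?mule0//.
    by apply/seteqP; split => // s /= sy; apply: yn; rewrite -sy size_steps.
  transitivity ((Phi y)%:E * pathw u P y)%E; last first.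
    by congr (_ * _)%E; apply: esym; exact: (steps_law u delta M p P Pr W X walkX goodP y).
  rewrite /pathw.
  under eq_integral => w _ do rewrite mulrC EFinM.
  by rewrite ge0_integralZl ?lee_fin// => w _; rewrite lee_fin weight_ge0.
- by move=> y w; case: ifP => // _; rewrite lee_fin mulr_ge0// weight_ge0.
- move=> y; case: (size y == n) => //; apply/measurable_EFinP; apply: measurable_funM => //.
  by apply: measurable_weight => x z _; exact: measurable_Env_coord.
Qed.

Lemma stationary_speed (Q : probability (Env R d) R) f : Pinfty_spec u P Q ->
  (forall z, 0 <= f z <= l1 z) -> (\int[Q]_w local_drift u f w = (speed f)%:E)%E.
Proof.
move=> PQ fl; have f0 z : 0 <= f z by have /andP[] := fl z.
have M0 : 0 <= M `^ p by exact: powR_ge0.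
have fM := mean_le_l1 u delta M p p1 f fl.
have [B B0 rateB] := deviation_rate u delta M p p1 P Pr W X iidP walkX goodP C C0 survC.
apply: (stationary_drift u delta M p f (M `^ p) f0 M0 fM P Q PQ goodP (speed f)
  (fun k => k.+1 ^ (rate p * 4))%N (fun k => B / k.+1%:R ^+ 2) (B * 2)).
- exact: (speed_ge0 u delta M p P Pr W X walkX goodP C survC f (M `^ p) f0 fM M0).
- by move=> k; rewrite expn_gt0.
- by move=> n; rewrite -mulr_sumr ler_wpM2l// sum_inv_sq.
move=> k; rewrite annealed_qmean//.
have iA : itg Pr (fun s => asum f (steps (k.+1 ^ (rate p * 4)) s)).
  exact: (itg_asum u delta M p P Pr W X walkX goodP f (M `^ p) f0 fM M0).
rewrite meanE ?lee_fin; first exact: rateB.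
apply: itg_abs; apply: itgB; last exact: itg_cst.
have := itgZ _ ((k.+1 ^ (rate p * 4))%:R^-1) _ iA.
by congr itg; apply/funext => s; rewrite mulrC.
Qed.

(** On [good_env] the entries at 0 are nonnegative, so they factor out of the positive and negative
    parts that define [ssum]. *)
Lemma drift_local w i : good_env u delta M p w ->
  (drift w i = local_drift u (cpos i) w - local_drift u (cneg i) w)%E.
Proof.
move=> gw; have [wE _ _ _] := gw 0 (etrans (congr1 (fun t => 0 <= t) (dotu0 u)) (lexx 0)).
have w0 z : 0 <= w 0 z by rewrite wE sprob_ge0.
rewrite /drift /ssum /local_drift; congr (_ - _)%E; apply: eq_esum => z _;
  by rewrite /pitr subr0 -?mulNr -wE /cpos /cneg maxr_pMl// mul0r.
Qed.

Lemma integral_drift (Q : probability (Env R d) R) i : Pinfty_spec u P Q ->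
  (\int[Q]_w drift w i = (speed (cpos i) - speed (cneg i))%:E)%E.
Proof.
move=> PQ.
have FQ : Filter (nbhs (almost_everywhere Q)) by exact: (@ae_filter_ringOfSetsType _ (Env R d) R Q).
have cp0 z : 0 <= (cpos i z : R) by have /andP[] := cpos_le_l1 (R := R) i z.
have cn0 z : 0 <= (cneg i z : R) by have /andP[] := cneg_le_l1 (R := R) i z.
have Ip := stationary_speed Q (cpos i) PQ (cpos_le_l1 i).
have In := stationary_speed Q (cneg i) PQ (cneg_le_l1 i).
have int f : (forall z, 0 <= f z) -> (\int[Q]_w local_drift u f w < +oo)%E ->
    Q.-integrable setT (local_drift u f : Env R d -> \bar R).
  move=> f0 fin; apply/integrableP; split; first exact: measurable_local_drift.
  by under eq_integral do rewrite gee0_abs ?local_drift_ge0//.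
have ip := int _ cp0 (eq_ind_r (fun t => t < +oo)%E (ltry _) Ip).
have ine := int _ cn0 (eq_ind_r (fun t => t < +oo)%E (ltry _) In).
have mp := measurable_int _ ip; have mn := measurable_int _ ine.
transitivity (\int[Q]_w (local_drift u (cpos i) w - local_drift u (cneg i) w))%E; last first.
  by rewrite integralB// Ip In EFinB.
apply: ae_eq_integral => //.
- apply: emeasurable_funB; apply: (measurable_esum (T := site d) (Y := Env R d)) => [z w|z].
  + by rewrite lee_fin le_max lexx orbT.
  + apply/measurable_EFinP; apply: measurable_maxr => //; apply: measurable_funM => //.
    exact: measurable_Env_coord.
  + by rewrite lee_fin le_max lexx orbT.
  + apply/measurable_EFinP; apply: measurable_maxr => //; apply: measurableT_comp => //.
    by apply: measurable_funM => //; exact: measurable_Env_coord.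
- exact: emeasurable_funB.
by apply: filterS (good_env_stationary u delta M p P Q PQ goodP) => w gw _; exact: drift_local.
Qed.

End velocity.

(** * Limits and means of the coordinates of the walk *)

Section convergence_event.
Context {R : realType} {d0 : measure_display} {Y : measurableType d0}.

(** Convergence is tested with the countably many tolerances 1 / (k + 1). *)
Lemma measurable_cvg_event (F : nat -> Y -> R) (l : R) :
  (forall n, measurable_fun setT (F n)) -> measurable [set y | F n y @[n --> \oo] --> l].
Proof.
move=> mF; pose A k n : set Y := [set y | `|l - F n y| < k.+1%:R^-1].
have mA k n : measurable (A k n).
  rewrite (_ : A k n = setT `&` (fun y => `|l - F n y|) @^-1` `]-oo, k.+1%:R^-1[%classic).
    apply: (measurableT_comp (f := fun x : R => `|x|)) => //.
    exact: measurable_funB.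
  by rewrite setTI; apply/seteqP; split => y; rewrite /= in_itv.
rewrite (_ : [set y | _] = \bigcap_k \bigcup_N \bigcap_n A k (N + n)%N).
  apply: bigcapT_measurable => k; apply: bigcupT_measurable => N.
  by apply: bigcapT_measurable => n; exact: mA.
apply/seteqP; split => y /=.
  move=> /cvgrPdist_lt Fl k _; have k0 : 0 < k.+1%:R^-1 :> R by rewrite invr_gt0.
  have [N _ FN] := Fl _ k0; exists N => // n _.
  by apply: FN; exact: leq_addr.
move=> H; apply/cvgrPdist_lt => e e0.
have [N _ AN] := H (Num.bound e^-1) Logic.I; exists N => // n /= Nn.
have := AN (n - N)%N Logic.I; rewrite subnKC// => /lt_trans; apply.
rewrite invf_plt ?posrE// (lt_trans (archi_boundP _)) ?ltr_nat//.
by rewrite ltW ?invr_gt0.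
Qed.

End convergence_event.

Section coordinate_limits.
Context {R : realType} {d : nat} (u : 'rV[R]_d) (delta M p : R).
Hypothesis p1 : 1 < p.
Context (P : probability (Env R d) R).
Context {dS : measure_display} {S : measurableType dS} (Pr : probability S R).
Context (W : S -> Env R d) (X : nat -> S -> site d).
Hypothesis iidP : iid_product P.
Hypothesis walkX : annealed_walk P Pr W X.
Hypothesis goodP : {ae P, forall w : Env R d, forall x : site d, good u delta M p (w x)}.
Context (C : R).
Hypothesis C0 : 0 <= C.
Hypothesis survC : forall n N, \sum_(n <= m < N) surv u Pr X m <= C * surv u Pr X n.
Implicit Types (y : seq (site d)) (z : site d) (f : site d -> R) (i : 'I_d).

Notation steps := (steps X).
Notation speed := (speed u Pr X).
Notation velocity i := (speed (cpos i) - speed (cneg i)).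

Lemma walk_coord n s i : X 0%N s = 0 -> ((X n s ord0 i)%:~R : R) =
  asum (cpos i) (steps n s) - asum (cneg i) (steps n s).
Proof. by move=> X0; rewrite walk_steps X0 add0r; exact: disp_coord. Qed.

Lemma measurable_coord n i : measurable_fun setT (fun s => (X n s ord0 i)%:~R : R).
Proof.
exact: (measurable_discrete (X n) (measurable_walk P Pr W X walkX n) _ _
  (fun z : site d => (z ord0 i)%:~R : R)).
Qed.

Lemma walk_lln : {ae Pr, forall s, forall i,
  (X n s ord0 i)%:~R / n%:R @[n --> \oo] --> velocity i}.
Proof.
apply: ae_forall_countable => i.
have lln f := asum_lln u delta M p p1 P Pr W X iidP walkX goodP C C0 survC f.
have Hp := lln _ (cpos_le_l1 i); have Hn := lln _ (cneg_le_l1 i).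
apply: filterS (filterI (walk_start P Pr W X walkX) (filterI Hp Hn)) => s [X0 [{}Hp {}Hn]].
have -> : (fun n => (X n s ord0 i)%:~R / n%:R : R) = (fun n =>
    asum (cpos i) (steps n s) / n%:R - asum (cneg i) (steps n s) / n%:R).
  by apply/funext => n; rewrite (walk_coord n s i X0) mulrBl.
exact: cvgB Hp Hn.
Qed.

Lemma walk_lln_probability :
  Pr [set s | forall i, (X n s ord0 i)%:~R / n%:R @[n --> \oo] --> velocity i] = 1%E.
Proof.
apply: probability1_ae; last exact: walk_lln.
apply: (@measurable_forall _ _ 'I_d (fun i =>
  [set s | (X n s ord0 i)%:~R / n%:R @[n --> \oo] --> velocity i])) => i.
apply: measurable_cvg_event => n; apply: measurable_funM => //; exact: measurable_coord.
Qed.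

Lemma integrable_ae_eq (F G : S -> \bar R) : measurable_fun setT F ->
  Pr.-integrable setT G -> {ae Pr, forall s, F s = G s} ->
  Pr.-integrable setT F /\ (\int[Pr]_s F s = \int[Pr]_s G s)%E.
Proof.
move=> mF /integrableP[mG iG] FG.
split; last by apply: ae_eq_integral => //; apply: filterS FG => s ->.
apply/integrableP; split => //; rewrite (@ae_eq_integral _ _ _ Pr setT (fun s => `|G s|)%E)//.
- exact: measurableT_comp.
- exact: measurableT_comp.
- by apply: filterS FG => s ->.
Qed.

(** The factor 2 comes from the positive and negative parts of the coordinate, each controlled by
    [avg_speed] with [L] equal to M^p. *)
Lemma walk_mean n i : Pr.-integrable setT (fun s => ((X n s ord0 i)%:~R)%:E) /\
  `|fine (\int[Pr]_s ((X n s ord0 i)%:~R)%:E)%E - n%:R * velocity i| <= 2 * M `^ p * C ^+ 2.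
Proof.
have M0 : 0 <= M `^ p by exact: powR_ge0.
have cp := cpos_le_l1 (R := R) i; have cn := cneg_le_l1 (R := R) i.
have cp0 z : 0 <= (cpos i z : R) by have /andP[] := cp z.
have cn0 z : 0 <= (cneg i z : R) by have /andP[] := cn z.
have fM := mean_le_l1 u delta M p p1.
have ip := itg_asum u delta M p P Pr W X walkX goodP _ _ cp0 (fM _ cp) M0 n.
have ineg := itg_asum u delta M p P Pr W X walkX goodP _ _ cn0 (fM _ cn) M0 n.
have Ap := avg_speed u delta M p P Pr W X iidP walkX goodP C C0 survC _ _ cp0 (fM _ cp) M0 n.
have An := avg_speed u delta M p P Pr W X iidP walkX goodP C C0 survC _ _ cn0 (fM _ cn) M0 n.
have [|//||iX ->] := integrable_ae_eq (fun s => ((X n s ord0 i)%:~R)%:E)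
  (EFin \o (fun s => asum (cpos i) (steps n s) - asum (cneg i) (steps n s))).
- by apply/measurable_EFinP; exact: measurable_coord.
- exact: itgB.
- by apply: filterS (walk_start P Pr W X walkX) => s X0; rewrite /= walk_coord.
split=> //; rewrite (meanB _ _ _ ip ineg : fine _ = _).
rewrite -/(avg Pr X (cpos i) n) -/(avg Pr X (cneg i) n).
have E (a b c e t : R) : a - b - t * (c - e) = (a - t * c) - (b - t * e) by ring.
rewrite E -mulrA mulr2n mulrDl mul1r; apply: le_trans (lerD Ap An).
exact: ler_normB.
Qed.

End coordinate_limits.

Lemma eseries_truncated {R : realType} (g : nat -> R) k : (forall m, 0 <= g m) ->
  (\sum_(0 <= m <oo) ((m < k)%:R * g m)%:E = (\sum_(m < k) g m)%:E)%E.
Proof.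
move=> g0; rewrite (nneseries_split 0%N k) ?add0n; last first.
  by move=> m _; rewrite lee_fin mulr_ge0.
rewrite eseries0 ?adde0; last by move=> m km _; rewrite ltnNge km mul0r.
rewrite big_mkord sumEFin; congr (_%:E).
by apply: eq_bigr => m _; rewrite ltn_ord mul1r.
Qed.

(** * The first passage time *)

Section first_passage.
Context {R : realType} {d : nat} (u : 'rV[R]_d) {dS : measure_display}
  {S : measurableType dS} (X : nat -> S -> site d).

Notation steps := (steps X).

(** Expresses sigma_1 > m on every path, whereas [alive] looks at the last level and decides this
    only on forward paths. *)
Definition below y : bool := all (fun l => level u (take l y) < 1) (iota 0 (size y).+1).

Lemma take_steps l m s : (l <= m)%N -> take l (steps m s) = steps l s.
Proof.
by move=> lm; rewrite -[steps m s]/(map _ _) -map_take take_iota (minn_idPl lm).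
Qed.

Lemma hitE n s : hit u X n s <-> 1 <= level u (steps n s).
Proof. by rewrite /hit (walk_steps X n s) dotuD lerD2l. Qed.

Lemma belowP m s : reflect (forall l, (l <= m)%N -> ~ hit u X l s) (below (steps m s)).
Proof.
rewrite /below size_steps; apply: (iffP allP) => H l.
  move=> lm; rewrite hitE => hl; have := H l; rewrite mem_iota add0n ltnS => /(_ lm).
  by rewrite take_steps// ltNge hl.
rewrite mem_iota add0n ltnS => lm; rewrite take_steps// ltNge.
by apply/negP => /hitE; exact: H.
Qed.

Lemma sigma1_idx_first s : (exists n, hit u X n s) ->
  hit u X (sigma1_idx u X s) s /\ forall m, (m < sigma1_idx u X s)%N -> ~ hit u X m s.
Proof.
move=> [n /hitE hn]; apply: (@xgetPex nat 0%N
  [set n | hit u X n s /\ forall m, (m < n)%N -> ~ hit u X m s]).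
case: (ex_minnP (ex_intro (fun k => is_true (1 <= level u (steps k s))) n hn)) => k hk kmin.
exists k; split; first exact/hitE.
by move=> m mk /hitE/kmin; rewrite leqNgt mk.
Qed.

Lemma below_lt m s : (exists n, hit u X n s) -> below (steps m s) = (m < sigma1_idx u X s)%N.
Proof.
move=> /sigma1_idx_first[hk kmin]; apply/belowP/idP => [H|mk l lm].
  by rewrite ltnNge; apply/negP => /H.
by apply: kmin; exact: leq_ltn_trans mk.
Qed.

(** The tail-sum formula, valid on every path: without a passage all the terms are 1 and both sides
    are infinite. *)
Lemma sigma1_series s : (sigma1 u X s = \sum_(0 <= m <oo) ((below (steps m s))%:R)%:E)%E.
Proof.
rewrite /sigma1; case: asboolP => [ex|nex].
  under eq_eseriesr do rewrite (below_lt _ _ ex) -[_%:R]mulr1.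
  by rewrite eseries_truncated// sumr_const card_ord.
have -> : (fun n => \sum_(0 <= m < n) ((below (steps m s))%:R)%:E)%E = (fun n => n%:R%:E : \bar R).
  apply/funext => n; rewrite big_mkord (eq_bigr (fun=> 1%:E)) => [|m _].
    by rewrite sumEFin sumr_const card_ord.
  suff -> : below (steps m s) by [].
  by apply/belowP => l _ hl; apply: nex; exists l.
by apply/esym/cvg_lim => //; apply/cvgenyP.
Qed.

Lemma sigma1_idx0 s : hit u X (sigma1_idx u X s) s \/ sigma1_idx u X s = 0%N.
Proof.
have [/sigma1_idx_first[]|nex] := pselect (exists n, hit u X n s); first by left.
by right; apply: xgetPN => n [hn _]; apply: nex; exists n.
Qed.

(** The default value of [sigma1_idx] is 0, so a successor value means a true passage, which the
    first [k.+1] steps decide; measurability rests on this. *)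
Lemma sigma1_idxS k s : sigma1_idx u X s = k.+1 <->
  below (steps k s) && (1 <= level u (steps k.+1 s)).
Proof.
split=> [sk|/andP[bk /hitE hk]].
  have [hs|] := sigma1_idx0 s; last by rewrite sk.
  have ex : exists n, hit u X n s by exists (sigma1_idx u X s).
  by rewrite below_lt// sk ltnS leqnn; rewrite sk in hs; exact/hitE.
have ex : exists n, hit u X n s by exists k.+1.
apply/eqP; rewrite eqn_leq; apply/andP; split; last by rewrite -below_lt.
have [_ kmin] := sigma1_idx_first s ex.
by rewrite leqNgt; apply/negP => /kmin.
Qed.

End first_passage.

Section first_passage_means.
Context {R : realType} {d : nat} (u : 'rV[R]_d) (delta M p : R).
Hypothesis p1 : 1 < p.
Context (P : probability (Env R d) R).
Context {dS : measure_display} {S : measurableType dS} (Pr : probability S R).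
Context (W : S -> Env R d) (X : nat -> S -> site d).
Hypothesis walkX : annealed_walk P Pr W X.
Hypothesis goodP : {ae P, forall w : Env R d, forall x : site d, good u delta M p (w x)}.
Context (C : R).
Hypothesis survC : forall n N, \sum_(n <= m < N) surv u Pr X m <= C * surv u Pr X n.
Implicit Types (y : seq (site d)) (z : site d) (f : site d -> R) (i : 'I_d).

Notation steps := (steps X).
Notation xi := (step X).
Notation itg := (itg Pr).
Notation mean := (mean Pr).
Notation sigma := (sigma1_idx u X).
Notation below := (below u).

Lemma integral_series (F : nat -> S -> R) : (forall m s, 0 <= F m s) ->
  (forall m, itg (F m)) -> cvgn (series (fun m => mean (F m))) ->
  (\int[Pr]_s (\sum_(0 <= m <oo) (F m s)%:E) = (limn (series (fun m => mean (F m))))%:E)%E.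
Proof.
move=> F0 iF cF; rewrite integral_nneseries//; last first.
- by move=> m s _; rewrite lee_fin.
- by move=> m; apply/measurable_EFinP; exact: itg_measurable (iF m).
rewrite -(EFin_lim cF); congr (limn _); apply/funext => n /=.
by rewrite /series /= -sumEFin; apply: eq_bigr => m _; exact: meanE.
Qed.

(** Levels do not decrease along a forward path, so the last one decides. *)
Lemma below_alive : {ae Pr, forall s, forall m, below (steps m s) = alive u (steps m s)}.
Proof.
apply: filterS (steps_forward u delta M p P Pr W X walkX goodP) => s fs m.
rewrite /alive fs /=; apply/belowP/idP => [/(_ m (leqnn _))|lm l ml]; rewrite hitE.
  by rewrite ltNge => /negP.
apply/negP; rewrite -ltNge; apply: le_lt_trans lm; rewrite -(take_steps X l m s ml).
rewrite -{2}(cat_take_drop l (steps m s)) /level disp_cat dotuD lerDl.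
apply: (forward_level u); have := fs m.
by rewrite -{1}(cat_take_drop l (steps m s)) /forward all_cat => /andP[].
Qed.

Lemma integral_sigma1 : (\int[Pr]_s sigma1 u X s = (mean_duration u Pr X)%:E)%E.
Proof.
have E : (fun m => mean (fun s => (below (steps m s))%:R)) = surv u Pr X.
  apply/funext => m.
  apply: mean_ae_eq; [exact: (itg_bool P Pr W X walkX)|exact: (itg_bool P Pr W X walkX)|].
  by apply: filterS below_alive => s ->.
under eq_integral do rewrite sigma1_series.
rewrite integral_series ?E//; first by move=> m; exact: (itg_bool P Pr W X walkX).
have [|//] := series_tail (surv u Pr X) (fun n => C * surv u Pr X n) _ survC.
by move=> n; exact: surv_ge0.
Qed.

(** A passage time with finite mean is almost surely finite. *)
Lemma hits : {ae Pr, forall s, exists n, hit u X n s}.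
Proof.
have i1 : Pr.-integrable setT (sigma1 u X).
  apply/integrableP; split.
    rewrite (_ : sigma1 u X = fun s => \sum_(0 <= m <oo) ((below (steps m s))%:R)%:E)%E; last first.
      by apply/funext => s; exact: sigma1_series.
    apply: ge0_emeasurable_sum => m // _; apply/measurable_EFinP.
    exact: itg_measurable (itg_bool P Pr W X walkX _ _).
  rewrite (eq_integral (sigma1 u X)) ?integral_sigma1 ?ltry// => s _.
  by rewrite gee0_abs// /sigma1; case: asboolP.
apply: filterS (integrable_ae measurableT i1) => s /(_ Logic.I).
by rewrite /sigma1; case: asboolP.
Qed.

Section one_step_function.
Context (f : site d -> R).
Hypothesis f_le_l1 : forall z, 0 <= f z <= l1 z.

(** As a series it makes sense on every path; where the passage occurs it is the sum of [f] over the
    first sigma_1 steps. *)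
Definition passage_sum s : \bar R := (\sum_(0 <= m <oo) ((below (steps m s))%:R * f (xi m s))%:E)%E.

Let f0 z : 0 <= f z. Proof. by have /andP[] := f_le_l1 z. Qed.

Let M0 : 0 <= M `^ p. Proof. exact: powR_ge0. Qed.

Let fM := mean_le_l1 u delta M p p1 f f_le_l1.

Let itg_term m : itg (fun s => (below (steps m s))%:R * f (xi m s)).
Proof.
apply: (itg_weighted u delta M p P Pr W X walkX goodP f _ f0 fM M0 m (fun y => (below y)%:R)) => y.
by case: below; rewrite ?lexx ?ler01.
Qed.

Let term_ge0 m s : 0 <= (below (steps m s))%:R * f (xi m s).
Proof. by rewrite mulr_ge0. Qed.

Lemma integral_passage_sum :
  (\int[Pr]_s passage_sum s = (limn (series (cycle_term u Pr X f)))%:E)%E.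
Proof.
have E : (fun m => mean (fun s => (below (steps m s))%:R * f (xi m s))) = cycle_term u Pr X f.
  apply/funext => m; apply: mean_ae_eq => //.
    apply: (itg_weighted u delta M p P Pr W X walkX goodP f _ f0 fM M0 m (fun y => (alive u y)%:R)) => y.
    by case: alive; rewrite ?lexx ?ler01.
  by apply: filterS below_alive => s ->.
rewrite integral_series// E//.
exact: (cvg_cycle u delta M p P Pr W X walkX goodP C survC f _ f0 fM M0).
Qed.

Lemma integrable_passage_sum : Pr.-integrable setT passage_sum.
Proof.
apply/integrableP; split.
  apply: ge0_emeasurable_sum => m // *; first by rewrite lee_fin.
  by apply/measurable_EFinP; exact: itg_measurable (itg_term m).
rewrite (eq_integral passage_sum) ?integral_passage_sum ?ltry// => s _.
by rewrite gee0_abs//; apply: nneseries_ge0 => m _ _; rewrite lee_fin.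
Qed.

Lemma passage_sumE s : (exists n, hit u X n s) ->
  passage_sum s = (asum f (steps (sigma s) s))%:E.
Proof.
move=> ex; rewrite /passage_sum.
under eq_eseriesr do rewrite (below_lt _ _ _ _ ex).
by rewrite (eseries_truncated (fun m => f (xi m s)))// asum_steps.
Qed.

End one_step_function.

Lemma measurable_sigma k : measurable (sigma @^-1` [set k]).
Proof.
have mS n : measurable (sigma @^-1` [set n.+1]).
  rewrite (_ : _ @^-1` _ = setT `&` (fun s => below (take n (steps n.+1 s)) &&
    (1 <= level u (steps n.+1 s))) @^-1` [set true]).
    exact: (measurable_discrete (steps n.+1) (measurable_steps P Pr W X walkX n.+1) _ bool
      (fun y => below (take n y) && (1 <= level u y))).
  rewrite setTI; apply/seteqP; split => s /=; rewrite take_steps//.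
    by move=> /sigma1_idxS.
  by move=> H; apply/sigma1_idxS.
case: k => [|k]; last exact: mS.
(* The value 0, which includes the default, is the complement of all the positive values. *)
rewrite (_ : _ @^-1` _ = [set s | forall n, (~` (sigma @^-1` [set n.+1])) s]).
  by apply: (@measurable_forall _ _ nat (fun n => ~` (sigma @^-1` [set n.+1]))) => n; exact: measurableC.
apply/seteqP; split => s /=; first by move=> ->.
by case: (sigma s) => // n /(_ n).
Qed.

Lemma measurable_passage_coord i : measurable_fun setT (fun s => (X (sigma s) s ord0 i)%:~R : R).
Proof.
apply: (measurable_discrete (fun s => X (sigma s) s) _ _ _ (fun z : site d => (z ord0 i)%:~R : R)) => z.
rewrite (_ : _ @^-1` _ = [set s | forall k, (~` (sigma @^-1` [set k]) `|` (X k @^-1` [set z])) s]).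
  apply: (@measurable_forall _ _ nat (fun k => ~` (sigma @^-1` [set k]) `|` (X k @^-1` [set z]))) => k.
  apply: measurableU; first by apply: measurableC; exact: measurable_sigma.
  exact: (measurable_walk P Pr W X walkX).
apply/seteqP; split => s /=; last by case/(_ (sigma s)).
by move=> <- k; have [<-|] := pselect (sigma s = k); [right|left].
Qed.

Lemma passage_mean i :
  Pr.-integrable setT (fun s => ((X (sigma s) s ord0 i)%:~R)%:E) /\
  (\int[Pr]_s ((X (sigma s) s ord0 i)%:~R)%:E =
    (limn (series (cycle_term u Pr X (cpos i))) - limn (series (cycle_term u Pr X (cneg i))))%:E)%E.
Proof.
have cp := cpos_le_l1 (R := R) i; have cn := cneg_le_l1 (R := R) i.
have ip := integrable_passage_sum _ cp; have ineg := integrable_passage_sum _ cn.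
have [|||iX ->] := integrable_ae_eq Pr (fun s => ((X (sigma s) s ord0 i)%:~R)%:E)
  (passage_sum (cpos i) \- passage_sum (cneg i))%E.
- by apply/measurable_EFinP; exact: measurable_passage_coord.
- exact: integrableB.
- apply: filterS (filterI (walk_start P Pr W X walkX) hits) => s [X0 ex] /=.
  rewrite !passage_sumE// -EFinB; congr (_%:E); exact: walk_coord.
split=> //; rewrite integralB//= !integral_passage_sum//.
Qed.

End first_passage_means.

Theorem theorem3p3 (R : realType) (d : nat) (u : 'rV[R]_d)
  (P : probability (Env R d) R) (delta M p : R) :
  (1 <= d)%N -> u != 0 ->
  iid_product P ->
  P [set w : env R d | is_probvec (w 0)] = 1%E ->
  P [set w : env R d |
       (\esum_(z in [set z : site d | (0 <= dotu z u)%R]) (pitr 0 z w)%:E = 1)%E] = 1%E ->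
  0 < delta ->
  P [set w : env R d | (delta%:E <= ssum (fun z => (dotu z u * pitr 0 z w)%R))%E] = 1%E ->
  1 < p -> 0 < M ->
  P [set w : env R d |
       (\esum_(z in [set: site d]) ((l1 z `^ p * pitr 0 z w)%R)%:E <= (M `^ p)%:E)%E]
    = 1%E ->
  forall Q : probability (Env R d) R, Pinfty_spec u P Q ->
  let v := fun i : 'I_d => fine (\int[Q]_w drift w i)%E in
  forall (dS : measure_display) (S : measurableType dS) (Pr : probability S R)
         (W : S -> Env R d) (X : nat -> S -> site d),
  annealed_walk P Pr W X ->
  [/\ (forall i : 'I_d, (\int[Q]_w drift w i)%E \is a fin_num),
      Pr [set s | forall i : 'I_d,
            (fun n : nat => (X n s ord0 i)%:~R / n%:R) @ \oo --> v i] = 1%E,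
      (\int[Pr]_s sigma1 u X s < +oo)%E,
      (forall i : 'I_d,
         Pr.-integrable setT (fun s => ((X (sigma1_idx u X s) s ord0 i)%:~R)%:E) /\
         v i = fine (\int[Pr]_s ((X (sigma1_idx u X s) s ord0 i)%:~R)%:E)%E
               / fine (\int[Pr]_s sigma1 u X s)%E) &
      exists C : R, forall n : nat,
        (forall i : 'I_d, Pr.-integrable setT (fun s => ((X n s ord0 i)%:~R)%:E)) /\
        \sum_(i < d) `| fine (\int[Pr]_s ((X n s ord0 i)%:~R)%:E)%E - n%:R * v i | <= C].
Proof.
move=> _ _ iidP P_probvec P_forward delta0 P_drift p1 _ P_moment Q PQ v dS S Pr W X walkX.
have goodP := good_sites u delta M p P iidP P_probvec P_forward P_drift P_moment.
have [C C0 survC] := surv_tail u delta M p delta0 p1 P Pr W X walkX goodP.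
pose vel i : R := speed u Pr X (cpos i) - speed u Pr X (cneg i).
have intQ i : (\int[Q]_w drift w i = (vel i)%:E)%E.
  exact: (integral_drift u delta M p p1 P Pr W X iidP walkX goodP C C0 survC Q i PQ).
have vE i : v i = vel i by rewrite /v intQ.
have sigE := integral_sigma1 u delta M p P Pr W X walkX goodP C survC.
split.
- by move=> i; rewrite intQ.
- have := walk_lln_probability u delta M p p1 P Pr W X iidP walkX goodP C C0 survC.
  rewrite (_ : [set s | forall i, _] =
    [set s | forall i : 'I_d, (fun n : nat => (X n s ord0 i)%:~R / n%:R) @ \oo --> v i])//.
  by apply/seteqP; split => s H i; have := H i; rewrite vE.
- by rewrite sigE ltry.
- move=> i.
  have [iX EX] := passage_mean u delta M p p1 P Pr W X walkX goodP C survC i.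
  (* Both speeds have the denominator E[sigma_1], so their difference is a single ratio. *)
  by split=> //; rewrite vE EX sigE /= /vel /speed mulrBl.
exists (\sum_(i < d) (2 * M `^ p * C ^+ 2)) => n.
have H := walk_mean u delta M p p1 P Pr W X iidP walkX goodP C C0 survC n.
split=> [i|]; first by have [] := H i.
by apply: ler_sum => i _; rewrite vE; have [] := H i.
Qed.
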